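(* Let $(\mathcal{A},\gamma,\mathbb{T})$ be a full $C^*$-dynamical system with $\mathcal{A}$ unital. Let $\{y_i\}$, $\{x_j\}$ be finite subsets of $\mathcal{A}^1$ such that $\sum_iy_i^*y_i=I$ and $\sum_jx_jx_j^*=I$. For a tracial state $\tau$ on $\mathcal{A}^0$ set $$\mu_n(\tau)=\min\{\tau(y_{i_1}\cdots y_{i_n}(y_{i_1}\cdots y_{i_n})^* ):y_{i_1}\cdots y_{i_n}\ne0\},$$ $$\nu_n(\tau)=\min\{\tau((x_{j_1}\cdots x_{j_n})^*x_{j_1}\cdots x_{j_n}):x_{j_1}\cdots x_{j_n}\ne0\}.$$ If $\limsup_n\mu_n(\tau)^{1/n}=1$, then $$\beta_{\min}=-h(T_{\{y_i\}})=-h_{\mathrm{top}}(\sigma|_{\ell'_{\{y_i\}}})=-\limsup_n\tfrac1n\log\delta_n(\tau).$$ In particular, if moreover $\tau$ is the restriction of a KMS state $\omega$, then $\omega$ has minimal inverse temperature $\beta_{\min}$. If instead $\limsup_n\nu_n(\tau)^{1/n}=1$, then $$\beta_{\max}=h(S_{\{x_j\}})=h_{\mathrm{top}}(\sigma|_{\ell_{\{x_j\}}})=\limsup_n\tfrac1n\log\epsilon_n(\tau).$$ If moreover $\tau$ is the restriction of a KMS state $\omega$, then $\omega$ has maximal inverse temperature $\beta_{\max}$.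
   Context: $\gamma$ is a (strongly continuous) action of $\mathbb{T}$ on $\mathcal{A}$ by $*$-automorphisms; $\mathcal{A}^k=\{a:\gamma_z(a)=z^ka\ \forall z\in\mathbb{T}\}$; the system is full if for every $k\in\mathbb{Z}$ the closed linear span of $\mathcal{A}^k\mathcal{A}^{-k}$ equals $\mathcal{A}^0$. On the Banach space $\mathcal{T}(\mathcal{A}^0)$ of bounded trace functionals of $\mathcal{A}^0$ let $s'(\tau)(a)=\tau(\sum_jx_j^*ax_j)$ (an invertible operator, independent of the choice of $\{x_j\}$). $\beta_{\max}=\log r_{\max}(s')$ and $\beta_{\min}=\log r_{\min}(s')$, where $r_{\max}(s')$, $r_{\min}(s')$ are the maximum and minimum of $|\lambda|$ over the spectrum of $s'$; these are the largest and smallest inverse temperatures of KMS states. With $\alpha_t=\gamma_{e^{it}}$, a KMS state at inverse temperature $\beta$ is a state $\omega$ of $\mathcal{A}$ with $\omega(a\alpha_{i\beta}(b))=\omega(ba)$ for all $a,b$ in a dense $*$-subalgebra of entire elements for $\alpha$ (equivalently, on the linear span of the $\mathcal{A}^k$). Put $h(T_{\{y_i\}})=\lim_n\frac1n\log\big(\sum_{i_1,\dots,i_n}\|y_{i_1}\cdots y_{i_n}(y_{i_1}\cdots y_{i_n})^*\|\big)$ and $h(S_{\{x_j\}})=\lim_n\frac1n\log\big(\sum_{j_1,\dots,j_n}\|(x_{j_1}\cdots x_{j_n})^*x_{j_1}\cdots x_{j_n}\|\big)$. $\ell_{\{x_j\}}$ is the one-sided subshift of all sequences $(\lambda_r)_{r\in\mathbb{N}}$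 of indices with $x_{\lambda_1}\cdots x_{\lambda_r}\ne0$ for all $r$, and $\ell'_{\{y_i\}}$ is that of all sequences with $y_{\lambda_r}\cdots y_{\lambda_1}\ne0$ for all $r$; $\sigma$ is the left shift and $h_{\mathrm{top}}$ is topological entropy. $\delta_n(\tau)=\tau(\sum_iz_iz_i^* )$ for any finite $\{z_i\}\subset\mathcal{A}^n$ with $\sum_iz_i^*z_i=I$, and $\epsilon_n(\tau)=\tau(\sum_jw_j^*w_j)$ for any finite $\{w_j\}\subset\mathcal{A}^n$ with $\sum_jw_jw_j^*=I$ (independent of choices). *)

(* Defs.v *)
From HB Require Import structures.
From mathcomp Require Import all_boot all_order all_algebra.
From mathcomp Require Import complex.
From mathcomp Require Import all_classical all_reals all_analysis.

Set Implicit Arguments.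
Unset Strict Implicit.
Unset Printing Implicit Defensive.

Import Order.TTheory GRing.Theory Num.Theory.
Import numFieldNormedType.Exports.

Local Open Scope classical_set_scope.
Local Open Scope ring_scope.

Definition modulus (R : realType) (c : R[i]) : R := complex.Re `|c|.

(* The norm is real valued and is a field of the structure: MathComp does not
   allow a join of its (R[i]-valued) normed modules with its algebras.  The
   library's normed module over R[i] is recovered on the alias normed A. *)
HB.mixin Record isPreCStar (R : realType) A & GRing.Algebra R[i] A := {
  star : A -> A;
  starK : involutive star;
  starD : {morph star : x y / x + y};
  starZ : forall (c : R[i]) (x : A), star (c *: x) = Num.conj c *: star x;
  starM : forall x y : A, star (x * y) = star y * star x;
  cnorm : A -> R;
  cnormD_le : forall x y : A, cnorm (x + y) <= cnorm x + cnorm y;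
  cnormZ : forall (c : R[i]) (x : A), cnorm (c *: x) = modulus c * cnorm x;
  cnorm0_eq0 : forall x : A, cnorm x = 0 -> x = 0;
  cnormM_le : forall x y : A, cnorm (x * y) <= cnorm x * cnorm y;
  cnorm_starM : forall x : A, cnorm (star x * x) = cnorm x ^+ 2
}.

#[short(type="preCStarAlgType")]
HB.structure Definition PreCStarAlgebra (R : realType) :=
  {A of GRing.Algebra R[i] A & isPreCStar R A}.

HB.mixin Record isCStarComplete (R : realType) A & PreCStarAlgebra R A := {
  cstar_complete : forall u : nat -> A,
    (forall e : R, 0 < e -> exists N : nat, forall m n : nat,
       (N <= m)%N -> (N <= n)%N -> cnorm (u m - u n) < e) ->
    exists l : A, cnorm (u n - l) @[n --> \oo] --> (0 : R)
}.

#[short(type="cstarAlgType")]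
HB.structure Definition CStarAlgebra (R : realType) :=
  {A of PreCStarAlgebra R A & isCStarComplete R A}.

Definition normed (R : realType) (A : preCStarAlgType R) : Type := A.

Section normed.
Context (R : realType) (A : preCStarAlgType R).

HB.instance Definition _ := GRing.Lmodule.copy (normed A) A.

Let norm (a : normed A) : R[i] := (cnorm (a : A))%:C%C.

Let normD (a b : normed A) : norm (a + b) <= norm a + norm b.
Proof. by rewrite /norm -rmorphD lecR; exact: cnormD_le. Qed.

Lemma modulusE (c : R[i]) : (modulus c)%:C%C = `|c|.
Proof. by case: c => a b; rewrite /modulus normc_def. Qed.

Let normZ (c : R[i]) (a : normed A) : norm (c *: a) = `|c| * norm a.
Proof. by rewrite /norm cnormZ rmorphM /= modulusE. Qed.

Let norm_eq0 (a : normed A) : norm a = 0 -> a = 0.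
Proof. by rewrite /norm => -[]; exact: cnorm0_eq0. Qed.

HB.instance Definition _ :=
  Lmodule_isNormed.Build R[i] (normed A) normD normZ norm_eq0.
End normed.


Section functionals.
Context (R : realType) (B : preCStarAlgType R).

Definition is_state (f : B -> R[i]^o) : Prop :=
  [/\ linear f, forall a, 0 <= f (star a * a) & f 1 = 1].

Definition is_tracial (f : B -> R[i]^o) : Prop :=
  forall a b, f (a * b) = f (b * a).

Definition is_bounded_trace (f : B -> R[i]^o) : Prop :=
  [/\ linear f, exists M : R, forall a, modulus (f a) <= M * cnorm a
    & is_tracial f].

Definition bounded_traces : {pred B -> R[i]^o} :=
  fun f => `[< is_bounded_trace f >].

Lemma modulusD (c d : R[i]) : modulus (c + d) <= modulus c + modulus d.
Proof. by rewrite -lecR rmorphD /= !modulusE ler_normD. Qed.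

Lemma modulusM (c d : R[i]) : modulus (c * d) = modulus c * modulus d.
Proof. by apply: complexI; rewrite rmorphM /= !modulusE normrM. Qed.

Lemma modulus_ge0 (c : R[i]) : 0 <= modulus c.
Proof. by rewrite -lecR modulusE; exact: normr_ge0. Qed.

Lemma modulus0 : modulus (0 : R[i]) = 0.
Proof. by apply: complexI; rewrite modulusE normr0. Qed.

Lemma modulus0_eq0 (c : R[i]) : modulus c = 0 -> c = 0.
Proof. by move=> c0; apply: normr0_eq0; rewrite -modulusE c0. Qed.

Fact bounded_traces_submod_closed : submod_closed bounded_traces.
Proof.
split=> [|c f g]; rewrite !unfold_in.
  apply/asboolP; split=> //.
  - by move=> c a b /=; rewrite scaler0 addr0.
  - by exists 0 => a; rewrite /= modulus0 mul0r.
move=> /asboolP[flin [M fM] ftr] /asboolP[glin [N gN] gtr].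
apply/asboolP; split.
- move=> d a b /=; rewrite !fctE flin glin scalerDr addrACA scalerDr.
  by rewrite !scalerA (mulrC c d).
- exists (modulus c * M + N) => a; rewrite !fctE mulrDl.
  apply: le_trans (modulusD _ _) _; apply: lerD (gN a).
  by rewrite modulusM -mulrA; apply: ler_wpM2l (fM a); exact: modulus_ge0.
- by move=> a b; rewrite !fctE ftr gtr.
Qed.

HB.instance Definition _ := GRing.isSubmodClosed.Build R[i] (B -> R[i]^o)
  bounded_traces bounded_traces_submod_closed.

Record trace_space := TraceFunctional {
  trace_fun :> B -> R[i]^o;
  trace_funP : trace_fun \in bounded_traces }.

HB.instance Definition _ := [isSub for trace_fun].
HB.instance Definition _ := [Choice of trace_space by <:].
HB.instance Definition _ := [SubChoice_isSubLmodule of trace_space by <:].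

Lemma cnorm_ge0 (a : B) : 0 <= cnorm a.
Proof. by rewrite -lecR; exact: (normr_ge0 (a : normed B)). Qed.

Lemma cnorm0 : cnorm (0 : B) = 0.
Proof. by rewrite -(scale0r (0 : B)) cnormZ modulus0 mul0r. Qed.

Definition trace_norm (f : trace_space) : R :=
  sup [set modulus (f a) | a in [set a : B | cnorm a <= 1]].

Let values (f : trace_space) :=
  [set modulus (f a) | a in [set a : B | cnorm a <= 1]].

Let values_has_sup (f : trace_space) : has_sup (values f).
Proof.
split; first by exists (modulus (f 0)), 0 => //=; rewrite cnorm0.
have /asboolP[_ [M fM] _] := trace_funP f.
exists `|M| => _ [a /= a1 <-]; apply: le_trans (fM a) _.
apply: le_trans (ler_wpM2r (cnorm_ge0 a) (ler_norm M)) _.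
by apply: ler_piMr.
Qed.

Let trace_norm_ub (f : trace_space) (a : B) :
  cnorm a <= 1 -> modulus (f a) <= trace_norm f.
Proof. by move=> a1; apply: ub_le_sup; [case: (values_has_sup f)|exists a]. Qed.

Let trace_norm_le (f : trace_space) (M : R) :
  (forall a : B, cnorm a <= 1 -> modulus (f a) <= M) -> trace_norm f <= M.
Proof.
move=> fM; apply: ge_sup; first by case: (values_has_sup f).
by move=> _ [a a1 <-]; exact: fM.
Qed.

Let tnorm (f : trace_space) : R[i] := (trace_norm f)%:C%C.

Let tnormD (f g : trace_space) : tnorm (f + g) <= tnorm f + tnorm g.
Proof.
rewrite /tnorm -rmorphD lecR; apply: trace_norm_le => a a1.
apply: le_trans (modulusD (f a) (g a)) _.
by apply: lerD; apply: trace_norm_ub.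
Qed.

Let trace_normZ_le (c : R[i]) (f : trace_space) :
  trace_norm (c *: f) <= modulus c * trace_norm f.
Proof.
apply: trace_norm_le => a a1.
rewrite (_ : (c *: f) a = c * f a)// modulusM.
by apply: ler_wpM2l (trace_norm_ub _ a1); exact: modulus_ge0.
Qed.

Let tnormZ (c : R[i]) (f : trace_space) : tnorm (c *: f) = `|c| * tnorm f.
Proof.
rewrite /tnorm -modulusE -rmorphM; congr (_%:C%C).
apply/eqP; rewrite eq_le trace_normZ_le /=.
have [->|c0] := eqVneq c 0.
  rewrite modulus0 mul0r scale0r.
  apply: le_trans (modulus_ge0 ((0 : trace_space) 0)) _.
  by apply: trace_norm_ub; rewrite cnorm0.
have mc0 : 0 < modulus c.
  rewrite lt_neqAle modulus_ge0 andbT eq_sym; apply/eqP => /modulus0_eq0/eqP.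
  by rewrite (negbTE c0).
have := trace_normZ_le c^-1 (c *: f).
rewrite scalerA mulVf// scale1r => fc.
rewrite -ler_pdivlMl//; apply: le_trans fc _.
rewrite (_ : modulus c^-1 = (modulus c)^-1)//.
by apply: complexI; rewrite fmorphV /= !modulusE normfV.
Qed.

Let tnorm_eq0 (f : trace_space) : tnorm f = 0 -> f = 0.
Proof.
move=> -[f0]; apply/val_inj/funext => a /=.
have /asboolP[flin _ _] := trace_funP f.
have f00 : f 0 = 0.
  by have := flin (-1) 0 0; rewrite scaler0 addr0 scaleN1r addNr.
have [->//|a0] := eqVneq a 0.
have na0 : 0 < cnorm a.
  rewrite lt_neqAle cnorm_ge0 andbT eq_sym; apply/eqP => /cnorm0_eq0/eqP.
  by rewrite (negbTE a0).
pose c : R[i] := ((cnorm a)^-1)%:C%C.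
have fZ d b : f (d *: b) = d * f b.
  by have := flin d b 0; rewrite f00 !addr0.
have c0 : c != 0 by rewrite /c fmorph_eq0 invr_eq0 gt_eqF.
have mc : modulus c = (cnorm a)^-1.
  apply: complexI; rewrite modulusE ger0_norm//.
  by rewrite lecR invr_ge0 ltW.
have ca1 : cnorm (c *: a) <= 1 by rewrite cnormZ mc mulVf// gt_eqF.
have := trace_norm_ub f ca1; rewrite f0 => fc.
have /modulus0_eq0 : modulus (f (c *: a)) = 0.
  by apply/eqP; rewrite eq_le fc modulus_ge0.
by rewrite fZ => /eqP; rewrite mulf_eq0 (negbTE c0) /= => /eqP.
Qed.

HB.instance Definition _ :=
  Lmodule_isNormed.Build R[i] trace_space tnormD tnormZ tnorm_eq0.
End functionals.

Definition spectrum (K : numFieldType) (V : normedModType K) (T : V -> V)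
    : set K :=
  [set l | ~ exists S : {linear V -> V},
     [/\ continuous S, cancel (fun v => T v - l *: v) S
       & cancel S (fun v => T v - l *: v)]].

(* The greatest and least elements of a set of reals that has one. *)
Definition maximum (R : realType) (S : set R) : R := get (S `&` ubound S).
Definition minimum (R : realType) (S : set R) : R := get (S `&` lbound S).

Section action.
Context (R : realType) (A : cstarAlgType R).

Record circle_action := CircleAction {
  act :> R[i] -> A -> A;
  act_linear : forall z, `|z| = 1 -> linear (act z);
  act_mul : forall z, `|z| = 1 -> {morph act z : a b / a * b};
  act_star : forall z, `|z| = 1 -> {morph act z : a / star a};
  act_one : forall a, act 1 a = a;
  act_comp : forall z w, `|z| = 1 -> `|w| = 1 ->
    forall a, act (z * w) a = act z (act w a);
  act_continuous : forall a, {within [set z : R[i]^o | `|z| = 1],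
    continuous (fun z : R[i]^o => act z a : normed A)} }.

Variable g : circle_action.

Definition spectral_subspace (k : int) : set A :=
  [set a | forall z : R[i], `|z| = 1 -> g z a = z ^ k *: a].

Definition span (S : set A) : set A :=
  [set a | exists (m : nat) (c : 'I_m -> R[i]) (v : 'I_m -> A),
     (forall i, S (v i)) /\ a = \sum_(i < m) c i *: v i].

Definition full : Prop := forall k : int,
  closure (span [set a * b | a in spectral_subspace k
                           & b in spectral_subspace (- k)] : set (normed A))
  = spectral_subspace 0.

Definition fixed_points : {pred A} := fun a => `[< spectral_subspace 0 a >].

Lemma act_fixed1 (z : R[i]) : `|z| = 1 -> g z 1 = 1.
Proof.
move=> z1; have z0 : z != 0 by rewrite -normr_eq0 z1 oner_eq0.
have zV1 : `|z^-1| = 1 by rewrite normfV z1 invr1.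
have gK : g z (g z^-1 1) = 1 by rewrite -act_comp// mulfV// act_one.
by rewrite -[LHS]mulr1 -{2}gK -act_mul// mul1r.
Qed.

Lemma fixed_pointsP (a : A) :
  reflect (forall z : R[i], `|z| = 1 -> g z a = a) (a \in fixed_points).
Proof.
rewrite unfold_in /fixed_points; apply: (iffP (asboolP _)) => ga z z1; rewrite ga//.
  by rewrite expr0z scale1r.
by rewrite expr0z scale1r.
Qed.

Fact fixed_points_subalg_closed : subalg_closed fixed_points.
Proof.
split=> [|c a b|a b]; first by apply/fixed_pointsP => z; exact: act_fixed1.
- move=> /fixed_pointsP ga /fixed_pointsP gb; apply/fixed_pointsP => z z1.
  by rewrite act_linear// ga// gb.
- move=> /fixed_pointsP ga /fixed_pointsP gb; apply/fixed_pointsP => z z1.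
  by rewrite act_mul// ga// gb.
Qed.

HB.instance Definition _ := GRing.isSubalgClosed.Build R[i] A
  fixed_points (GRing.subalg_closed_semi fixed_points_subalg_closed).

Record fixed_algebra := FixedPoint {
  fixed_val :> A;
  fixed_valP : fixed_val \in fixed_points }.

HB.instance Definition _ := [isSub for fixed_val].
HB.instance Definition _ := [Choice of fixed_algebra by <:].
HB.instance Definition _ := [SubChoice_isSubAlgebra of fixed_algebra by <:].
Fact fixed_starP (a : fixed_algebra) : star (a : A) \in fixed_points.
Proof.
apply/fixed_pointsP => z z1; rewrite act_star//.
by have /fixed_pointsP -> := fixed_valP a.
Qed.

Let fstar (a : fixed_algebra) := FixedPoint (fixed_starP a).
Let fnorm (a : fixed_algebra) : R := cnorm (a : A).

Let fstarK : involutive fstar.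
Proof. by move=> a; apply: val_inj; exact: starK. Qed.
Let fstarD : {morph fstar : a b / a + b}.
Proof. by move=> a b; apply: val_inj; exact: starD. Qed.
Let fstarZ (c : R[i]) (a : fixed_algebra) :
  fstar (c *: a) = Num.conj c *: fstar a.
Proof. by apply: val_inj; exact: starZ. Qed.
Let fstarM (a b : fixed_algebra) : fstar (a * b) = fstar b * fstar a.
Proof. by apply: val_inj; exact: starM. Qed.
Let fnormD (a b : fixed_algebra) : fnorm (a + b) <= fnorm a + fnorm b.
Proof. exact: cnormD_le. Qed.
Let fnormZ (c : R[i]) (a : fixed_algebra) :
  fnorm (c *: a) = modulus c * fnorm a.
Proof. exact: cnormZ. Qed.
Let fnorm_eq0 (a : fixed_algebra) : fnorm a = 0 -> a = 0.
Proof. by move=> a0; apply: val_inj; exact: cnorm0_eq0. Qed.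
Let fnormM (a b : fixed_algebra) : fnorm (a * b) <= fnorm a * fnorm b.
Proof. exact: cnormM_le. Qed.
Let fnorm_star (a : fixed_algebra) : fnorm (fstar a * a) = fnorm a ^+ 2.
Proof. exact: cnorm_starM. Qed.

HB.instance Definition _ := isPreCStar.Build R fixed_algebra
  fstarK fstarD fstarZ fstarM fnormD fnormZ fnorm_eq0 fnormM fnorm_star.

(* The identity on the fixed-point algebra, and 0 outside it. *)
Definition to_fixed (a : A) : fixed_algebra := insubd 0 a.

End action.

Section dual_operator.
Context (R : realType) (A : cstarAlgType R) (g : circle_action A).
Context (q : nat) (x : 'I_q -> A).
Hypothesis x1 : forall j, spectral_subspace g 1 (x j).
Hypothesis xx : \sum_(j < q) x j * star (x j) = 1.

Lemma conj_fixed (i j : 'I_q) (a : fixed_algebra g) :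
  star (x i) * (a : A) * x j \in fixed_points g.
Proof.
apply/fixed_pointsP => z z1; have /fixed_pointsP ga := fixed_valP a.
rewrite !act_mul// act_star// ga// !x1// expr1z starZ.
rewrite -!scalerAl -scalerAr scalerA mulrC -normCK z1.
by rewrite expr1n scale1r.
Qed.

Fact compress_fixed (a : fixed_algebra g) :
  \sum_(j < q) star (x j) * (a : A) * x j \in fixed_points g.
Proof. by apply: rpred_sum => j _; exact: conj_fixed. Qed.

Definition compress (a : fixed_algebra g) : fixed_algebra g :=
  FixedPoint (compress_fixed a).

Let conj_elt i j a := FixedPoint (conj_fixed i j a).

Let fixed_val_sum (I : Type) (r : seq I) (F : I -> fixed_algebra g) :
  fixed_val (\sum_(i <- r) F i) = \sum_(i <- r) fixed_val (F i).
Proof. exact: (raddf_sum (val : fixed_algebra g -> A)). Qed.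

Let compressM a b : compress (a * b) =
  \sum_(j < q) \sum_(k < q) conj_elt j k a * conj_elt k j b.
Proof.
apply: val_inj; rewrite /= fixed_val_sum; apply: eq_bigr => j _.
rewrite fixed_val_sum /= -[in LHS](mulr1 (a : A)) -xx mulr_sumr !mulr_suml.
rewrite mulr_sumr mulr_suml; apply: eq_bigr => k _.
by rewrite !mulrA.
Qed.

Let compress_linear : linear compress.
Proof.
move=> c a b; apply: val_inj; rewrite /= scaler_sumr -big_split.
apply: eq_bigr => j _ /=.
by rewrite mulrDr mulrDl -scalerAr -scalerAl.
Qed.

Let compress_bounded : exists M : R, 0 <= M /\
  forall a, cnorm (compress a) <= M * cnorm a.
Proof.
exists (\sum_(j < q) cnorm (star (x j)) * cnorm (x j)); split.
  by apply: sumr_ge0 => j _; rewrite mulr_ge0// cnorm_ge0.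
move=> a; rewrite mulr_suml.
change (cnorm (\sum_(j < q) star (x j) * (a : A) * x j) <=
  \sum_(i < q) cnorm (star (x i)) * cnorm (x i) * cnorm (a : A)).
apply: (big_ind2 (fun (u : A) (v : R) => cnorm u <= v)).
- by rewrite cnorm0.
- move=> u1 v1 u2 v2 le1 le2.
  exact: le_trans (cnormD_le _ _) (lerD le1 le2).
move=> j _; rewrite mulrAC; apply: le_trans (cnormM_le _ _) _.
by apply: ler_wpM2r (cnormM_le _ _); exact: cnorm_ge0.
Qed.

Fact dual_operatorP (f : trace_space (fixed_algebra g)) :
  (fun a => f (compress a)) \in @bounded_traces R (fixed_algebra g).
Proof.
have /asboolP[flin [M fM] ftr] := trace_funP f.
rewrite unfold_in; apply/asboolP; split.
- by move=> c a b; rewrite compress_linear flin.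
- have [N [N0 cN]] := compress_bounded.
  exists (`|M| * N) => a; apply: le_trans (fM _) _.
  apply: le_trans (ler_wpM2r (cnorm_ge0 _) (ler_norm M)) _.
  by rewrite -mulrA; apply: ler_wpM2l.
- move=> a b; rewrite !compressM.
  have fD u v : f (u + v) = f u + f v.
    by have := flin 1 u v; rewrite !scale1r.
  have f0 : f 0 = 0.
    by have := flin (-1) 0 0; rewrite scaler0 addr0 scaleN1r addNr.
  have fS I (r : seq I) (F : I -> fixed_algebra g) :
      f (\sum_(i <- r) F i) = \sum_(i <- r) f (F i).
    exact: (big_morph (fun u => f u) fD f0).
  rewrite !fS.
  transitivity (\sum_(j < q) \sum_(k < q) f (conj_elt j k a * conj_elt k j b)).
    by apply: eq_bigr => j _; rewrite fS.
  rewrite exchange_big; apply: eq_bigr => k _; rewrite fS.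
  by apply: eq_bigr => j _; exact: ftr.
Qed.

Definition dual_operator (f : trace_space (fixed_algebra g)) :
  trace_space (fixed_algebra g) := TraceFunctional (dual_operatorP f).

Definition r_max : R := maximum [set modulus l | l in spectrum dual_operator].
Definition r_min : R := minimum [set modulus l | l in spectrum dual_operator].

Definition beta_max : R := ln r_max.
Definition beta_min : R := ln r_min.
End dual_operator.

Section kms.
Context (R : realType) (A : cstarAlgType R) (g : circle_action A).

Definition expi (t : R) : R[i] := (cos t +i* sin t)%C.

(* Entire A-valued functions are given by power series converging on all of
   the complex plane. *)
Definition entire (f : R[i] -> A) : Prop :=
  exists c : nat -> A, forall z : R[i],
    (\sum_(0 <= k < n) z ^+ k *: c k : normed A) @[n --> \oo]
      --> (f z : normed A).

(* f z is alpha_z (b), where alpha_t is the action of e^(it). *)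
Definition entire_extension (b : A) (f : R[i] -> A) : Prop :=
  entire f /\ forall t : R, f t%:C%C = g (expi t) b.

Definition star_subalgebra (D : set A) : Prop :=
  [/\ D 0, forall (c : R[i]) a b, D a -> D b -> D (c *: a + b),
      forall a b, D a -> D b -> D (a * b)
    & forall a, D a -> D (star a)].

(* Invariance of the dense *-subalgebra under the action is part of the KMS
   condition: without it point masses on the circle would be KMS states, at
   every inverse temperature, for the rotation action on C(T). *)
Definition is_KMS (beta : R) (omega : A -> R[i]^o) : Prop :=
  is_state omega /\
  exists D : set A,
    [/\ star_subalgebra D, dense (D : set (normed A)),
        forall z : R[i], `|z| = 1 -> forall a, D a -> D (g z a)
      & forall b, D b -> exists f : R[i] -> A, entire_extension b f /\
          forall a, D a -> omega (a * f (0 +i* beta)%C) = omega (b * a)].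
End kms.

Section topological_entropy.
Context (R : realType) (X : topologicalType) (K : set X) (f : X -> X).

Definition open_cover (U : set (set X)) : Prop :=
  (forall V, U V -> open V) /\ K `<=` \bigcup_(V in U) V.

(* k members of the n-fold join of U, f^-1 U, ..., f^-(n-1) U covering K *)
Definition join_subcover (U : set (set X)) (n k : nat) : Prop :=
  exists w : 'I_k -> 'I_n -> set X, (forall j i, U (w j i)) /\
    K `<=` [set a | exists j : 'I_k, forall i : 'I_n, w j i (iter i f a)].

Definition cover_number (U : set (set X)) (n : nat) : R :=
  minimum [set (k%:R : R) | k in join_subcover U n].

Definition cover_entropy (U : set (set X)) : R :=
  limn (fun n : nat => n%:R^-1 * ln (cover_number U n)).

Definition topological_entropy : \bar R :=
  ereal_sup [set (cover_entropy U)%:E | U in open_cover].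
End topological_entropy.

Section words.
Context (R : realType) (A : cstarAlgType R) (g : circle_action A).
Context (p : nat) (y : 'I_p -> A).

Definition word (n : nat) (w : n.-tuple 'I_p) : A :=
  \prod_(i < n) y (tnth w i).

Definition h_T : R := limn (fun n : nat => n%:R^-1 *
  ln (\sum_(w : n.-tuple 'I_p) cnorm (word w * star (word w)))).
Definition h_S : R := limn (fun n : nat => n%:R^-1 *
  ln (\sum_(w : n.-tuple 'I_p) cnorm (star (word w) * word w))).

(* Sequences are indexed from 0: l i stands for lambda_(i+1). *)
Definition sequences : topologicalType :=
  prod_topology (fun _ : nat => discrete_topology 'I_p).

Definition left_shift (l : sequences) : sequences := fun r => l r.+1.

Definition subshift : set sequences :=
  [set l : nat -> 'I_p | forall r : nat, \prod_(i < r) y (l i) != 0].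
Definition subshift' : set sequences :=
  [set l : nat -> 'I_p | forall r : nat, \prod_(i < r) y (l (rev_ord i)) != 0].

Definition mu (tau : fixed_algebra g -> R[i]^o) (n : nat) : R :=
  minimum [set complex.Re (tau (to_fixed g (word w * star (word w))))
          | w in [set w : n.-tuple 'I_p | word w != 0]].
Definition nu (tau : fixed_algebra g -> R[i]^o) (n : nat) : R :=
  minimum [set complex.Re (tau (to_fixed g (star (word w) * word w)))
          | w in [set w : n.-tuple 'I_p | word w != 0]].
End words.

(* delta n tau and epsilon n tau do not depend on the chosen family. *)
Section growth.
Context (R : realType) (A : cstarAlgType R) (g : circle_action A).

Definition delta (tau : fixed_algebra g -> R[i]^o) (n : nat) : R :=
  get [set d : R | exists (m : nat) (z : 'I_m -> A),
    [/\ forall i, spectral_subspace g n (z i),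
        \sum_(i < m) star (z i) * z i = 1
      & d = complex.Re (tau (to_fixed g (\sum_(i < m) z i * star (z i))))]].
Definition epsilon (tau : fixed_algebra g -> R[i]^o) (n : nat) : R :=
  get [set d : R | exists (m : nat) (w : 'I_m -> A),
    [/\ forall j, spectral_subspace g n (w j),
        \sum_(j < m) w j * star (w j) = 1
      & d = complex.Re (tau (to_fixed g (\sum_(j < m) star (w j) * w j)))]].
End growth.

(* Main.v *)
(** Let u be a finite family in A^k with sum_i u_i^* u_i = 1: either u = y with
    k = 1, or u = x^* with k = -1.  Put D(phi)(a) = phi(sum_i u_i a u_i^* ) on
    traces, so that s' is D for x^*, and the operators for y and x^* are inverse
    to each other.  If N_n is the number of nonzero words of length n, then
      mu_n N_n <= D^n(tau)(1) <= sum_w |u_w|^2 <= N_n,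
    so the hypothesis on mu_n gives the same exponential rate h to the three
    quantities.  Every nonzero word extends to an infinite one, hence h is the
    entropy of the subshift.  The norm growth of D^n bounds its spectral radius
    by e^h, and e^h is in the spectrum because D is positive: otherwise the
    resolvent would be positive slightly below e^h, which bounds D^n(tau)(1) by a
    multiple of z^n for some z < e^h.  A KMS state omega satisfies
    omega(v a) = e^(-k beta) omega(a v) for v in A^k, whence
    D^n(tau)(1) = e^(-n k beta) when it restricts to tau. *)

From HB Require Import structures.
Require Import Defs.
From mathcomp Require Import all_boot all_order all_algebra.
From mathcomp Require Import complex.
From mathcomp Require Import all_classical all_reals all_analysis.
From mathcomp Require Import ring lra.

Set Implicit Arguments.
Unset Strict Implicit.
Unset Printing Implicit Defensive.

Import Order.TTheory GRing.Theory Num.Theory.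
Import numFieldNormedType.Exports.

Local Open Scope classical_set_scope.
Local Open Scope ring_scope.

(** * Norms and positivity in C*-algebras *)

(** The hypothesis on mu_n bounds D^n(tau)(1) from below for infinitely many n only. This suffices
    because N_n and sum_w |u_w|^2 are submultiplicative: their rates are limits, hence determined by
    any infinite set of n. Positivity is treated without spectra of elements. A self-adjoint a is
    positive exactly when |t - a| <= t for some t >= 0, and roots come from an iteration. This
    criterion sees only the norm, so it means the same in A and in A^0. That e^h lies in the
    spectrum is the argument of Pringsheim's theorem. For r > e^h the Neumann series makes (r -
    D)^-1 positive. If e^h were a regular value, these resolvents would stay bounded as r decreases
    to e^h, so an expansion around r = e^h + eta, with positive coefficients, would converge at e^h
    - eta. It is run along the orbit of the single trace tau. The dense algebra of a KMS state need
    not contain A^k, and its entire extensions are known only as power series. Its elements are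
    pushed into A^k by averages over roots of unity of order 2^n, and an identity theorem for power
    series identifies the extensions. *)

Section modulus_theory.
Context (R : realType).

Lemma modulusR (t : R) : modulus t%:C%C = `|t|.
Proof. by rewrite /modulus normc_def /= expr0n addr0 sqrtr_sqr. Qed.

Lemma modulusRe (c : R[i]) : `|complex.Re c| <= modulus c.
Proof. by rewrite -lecR modulusE; exact: normc_ge_Re. Qed.

Lemma modulusN (c : R[i]) : modulus (- c) = modulus c.
Proof. by rewrite /modulus normrN. Qed.

Lemma modulusV (c : R[i]) : modulus c^-1 = (modulus c)^-1.
Proof. by apply: complexI; rewrite fmorphV /= !modulusE normfV. Qed.

Lemma modulus_gt0 (c : R[i]) : (0 < modulus c) = (c != 0).
Proof. by rewrite -ltcR modulusE normr_gt0. Qed.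

Lemma conjC_real (t : R) : Num.conj (t%:C%C : R[i]) = t%:C%C.
Proof. by apply: conj_Creal; apply/complex_realP; exists t. Qed.

Lemma modulus1P (z : R[i]) : `|z| = 1 -> modulus z = 1.
Proof. by move=> z1; apply: complexI; rewrite modulusE z1. Qed.

(** In [R[i]] the relation [0 <= z] also says that z is real, so both parts are controlled; the
    imaginary one is read off the real part of i z. *)
Lemma ge0_approx (z : R[i]) : (forall e : R, 0 < e -> exists2 y : R[i], 0 <= y &
  modulus (z - y) <= e) -> 0 <= z.
Proof.
move=> H; rewrite lecE /=; apply/andP; split.
  rewrite -normr_eq0 eq_le normr_ge0 andbT; apply/ler_addgt0Pr => e /H[y].
  rewrite lecE /= => /andP[/eqP y0 _] yz; rewrite add0r; apply: le_trans yz.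
  rewrite -[complex.Im z]subr0 -[X in _ - X]y0.
  have := modulusRe ((z - y) * 'i%C); rewrite modulusM.
  have -> : modulus ('i%C : R[i]) = 1.
    by rewrite /modulus normc_def /= expr0n expr1n add0r sqrtr1.
  rewrite mulr1 ReiNIm normrN.
  by case: z {H} => ? ?; case: y {y0} => ? ?.
apply/ler_addgt0Pr => e /H[y].
rewrite lecE /= => /andP[_ y0] yz.
have := le_trans (modulusRe _) yz; rewrite ler_norml => /andP[h _].
have : complex.Re (z - y) = complex.Re z - complex.Re y by case: (z) => ? ?;
  case: (y) => ? ?.
by move: h => /[swap] ->; lra.
Qed.

End modulus_theory.

Section prec_star.
Context (R : realType) (A : preCStarAlgType R).
Implicit Types a b : A.

Lemma star0 : star (0 : A) = 0.
Proof. by apply: (addrI (star (0 : A))); rewrite -starD !addr0. Qed.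

Lemma starN a : star (- a) = - star a.
Proof. by apply/eqP; rewrite -addr_eq0 -starD addNr star0. Qed.

Lemma starB a b : star (a - b) = star a - star b.
Proof. by rewrite starD starN. Qed.

Lemma star1 : star (1 : A) = 1.
Proof. by rewrite -[LHS]mul1r -[X in X * _]starK -starM mul1r starK. Qed.

Lemma cnormN a : cnorm (- a) = cnorm a.
Proof.
rewrite -scaleN1r cnormZ modulusN (_ : 1 = (1 : R)%:C%C)//.
by rewrite modulusR normr1 mul1r.
Qed.

Lemma cnormBC a b : cnorm (a - b) = cnorm (b - a).
Proof. by rewrite -cnormN opprB. Qed.

Lemma cnormB_le a b : cnorm (a - b) <= cnorm a + cnorm b.
Proof. by rewrite (le_trans (cnormD_le _ _))// cnormN. Qed.

Lemma cnorm_sum (I : Type) (r : seq I) (F : I -> A) :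
  cnorm (\sum_(i <- r) F i) <= \sum_(i <- r) cnorm (F i).
Proof.
apply: (big_ind2 (fun (u : A) (v : R) => cnorm u <= v)) => //.
  by rewrite cnorm0.
by move=> u1 v1 u2 v2 l1 l2; rewrite (le_trans (cnormD_le _ _))// lerD.
Qed.

Lemma cnorm_gt0 a : (0 < cnorm a) = (a != 0).
Proof.
rewrite lt_neqAle cnorm_ge0 andbT eq_sym; congr negb.
by apply/eqP/eqP => [/cnorm0_eq0//|->]; rewrite cnorm0.
Qed.

Lemma cnorm_star a : cnorm (star a) = cnorm a.
Proof.
suff le b : cnorm b <= cnorm (star b).
  by apply/eqP; rewrite eq_le le andbT -{2}[a]starK le.
have [->|b0] := eqVneq b 0; first by rewrite star0.
rewrite -(ler_pM2r (_ : 0 < cnorm b)) ?cnorm_gt0// -expr2 -cnorm_starM.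
exact: cnormM_le.
Qed.

Lemma cnorm_mul_star a : cnorm (a * star a) = cnorm a ^+ 2.
Proof. by rewrite -{1}[a]starK cnorm_starM cnorm_star. Qed.

(** Only an inequality, because the zero algebra is allowed here. *)
Lemma cnorm1_le : cnorm (1 : A) <= 1.
Proof.
have [->|n0] := eqVneq (1 : A) 0; first by rewrite cnorm0.
have := cnorm_starM (1 : A); rewrite star1 mulr1 => /eqP.
rewrite -subr_eq0 expr2 -{1}[cnorm _]mulr1 -mulrBr mulf_eq0 subr_eq0.
by rewrite gt_eqF ?cnorm_gt0//= => /eqP <-.
Qed.

Lemma cnormZr (t : R) a : cnorm (t%:C%C *: a) = `|t| * cnorm a.
Proof. by rewrite cnormZ modulusR. Qed.

Lemma starZr (t : R) a : star (t%:C%C *: a) = t%:C%C *: star a.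
Proof. by rewrite starZ conjC_real. Qed.

Lemma cnorm_real_le (t : R) : cnorm (t%:C%C *: 1 : A) <= `|t|.
Proof. by rewrite cnormZr ler_piMr// cnorm1_le. Qed.

Lemma commZr (c : R[i]) a b : a * b = b * a -> a * (c *: b) = (c *: b) * a.
Proof. by move=> ab; rewrite -scalerAr ab scalerAl. Qed.

Lemma commB (a b c : A) : c * a = a * c -> c * b = b * c ->
  c * (a - b) = (a - b) * c.
Proof. by move=> ca cb; rewrite mulrBr mulrBl ca cb. Qed.

Lemma commM (a b c : A) : c * a = a * c -> c * b = b * c ->
  c * (a * b) = (a * b) * c.
Proof. by move=> ca cb; rewrite mulrA ca -mulrA cb mulrA. Qed.

End prec_star.

Section tends.
Context (R : realType) (A : preCStarAlgType R).

(** Convergence for the real-valued norm of A itself; [normed_cvgP] relates it to the topology of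
    the alias [normed A]. *)
Definition tends (u : nat -> A) (l : A) : Prop :=
  cnorm (u n - l) @[n --> \oo] --> (0 : R).

Implicit Types (u v : nat -> A) (l m : A).

Lemma tends_le u l (e : nat -> R) : (forall n, cnorm (u n - l) <= e n) ->
  e @ \oo --> (0 : R) -> tends u l.
Proof.
move=> ue e0; apply: (@squeeze_cvgr _ _ _ _ (fun=> 0) e).
- by near=> n; rewrite cnorm_ge0 ue.
- exact: cvg_cst.
- exact: e0.
Unshelve. all: by end_near. Qed.

Lemma tends_cst l : tends (fun=> l) l.
Proof. by apply: (@tends_le _ _ (fun=> 0)) => [n|];
  [rewrite subrr cnorm0|exact: cvg_cst]. Qed.

Lemma tendsP u l : tends u l <-> forall e : R, 0 < e ->
  exists N : nat, forall n, (N <= n)%N -> cnorm (u n - l) < e.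
Proof.
split=> [/cvgrPdist_lt ul e e0|ul].
  have [N _ NP] := ul e e0; exists N => n Nn.
  by have := NP n Nn; rewrite sub0r normrN ger0_norm// cnorm_ge0.
apply/cvgrPdist_lt => e e0; have [N NP] := ul e e0.
by exists N => // n /= Nn; rewrite sub0r normrN ger0_norm ?cnorm_ge0// NP.
Qed.

Lemma tendsD u v l m : tends u l -> tends v m ->
  tends (fun n => u n + v n) (l + m).
Proof.
move=> ul vm; apply: (@tends_le _ _ (fun n => cnorm (u n - l) + cnorm (v n - m))).
  by move=> n; rewrite opprD addrACA cnormD_le.
by rewrite -[X in _ --> X]addr0; exact: cvgD.
Qed.

Lemma tendsZ u l (c : R[i]) : tends u l -> tends (fun n => c *: u n) (c *: l).
Proof.
move=> ul; apply: (@tends_le _ _ (fun n => modulus c * cnorm (u n - l))).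
  by move=> n; rewrite -scalerBr cnormZ.
by rewrite -[X in _ --> X](mulr0 (modulus c)); apply: cvgM => //; exact: cvg_cst.
Qed.

Lemma tendsN u l : tends u l -> tends (fun n => - u n) (- l).
Proof.
move=> /(@tendsZ _ _ (-1)); rewrite scaleN1r.
by under eq_fun do rewrite scaleN1r.
Qed.

Lemma tendsB u v l m : tends u l -> tends v m ->
  tends (fun n => u n - v n) (l - m).
Proof. by move=> ul /tendsN; exact: tendsD. Qed.

Lemma tendsM u v l m : tends u l -> tends v m ->
  tends (fun n => u n * v n) (l * m).
Proof.
move=> ul vm.
apply: (@tends_le _ _ (fun n => cnorm (u n - l) * (cnorm (v n - m) + cnorm m) +
  cnorm l * cnorm (v n - m))).
  move=> n; have -> : u n * v n - l * m = (u n - l) * v n + l * (v n - m).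
    by rewrite mulrBl mulrBr addrA subrK.
  rewrite (le_trans (cnormD_le _ _))// lerD ?cnormM_le//.
  rewrite (le_trans (cnormM_le _ _))// ler_wpM2l ?cnorm_ge0//.
  by rewrite (le_trans _ (cnormD_le _ _))// subrK.
rewrite -[X in _ --> X]addr0 -[X in _ --> X + _](mul0r (0 + cnorm m)).
rewrite -[X in _ --> _ + X](mulr0 (cnorm l)).
apply: cvgD; apply: cvgM => //; last exact: cvg_cst.
by apply: cvgD => //; exact: cvg_cst.
Qed.

Lemma tends_star u l : tends u l -> tends (fun n => star (u n)) (star l).
Proof.
move=> ul; apply: (@tends_le _ _ (fun n => cnorm (u n - l))) => // n.
by rewrite -starB cnorm_star.
Qed.

Lemma tends_unique u l m : tends u l -> tends u m -> l = m.
Proof.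
move=> ul um; have := tendsB ul um.
under eq_fun do rewrite subrr.
move=> /tendsP lm; apply/eqP; rewrite -subr_eq0 -[_ == 0]negbK -cnorm_gt0.
apply/negP => /lm[N /(_ N (leqnn _))]; rewrite sub0r cnormN.
by rewrite ltxx.
Qed.

Lemma tends_shift u l (k : nat) : tends u l -> tends (fun n => u (n + k)%N) l.
Proof.
move=> /tendsP ul; apply/tendsP => e /ul[N NP]; exists N => n Nn.
by apply: NP; rewrite (leq_trans Nn)// leq_addr.
Qed.

Lemma tends_norm_le u l (M : R) : (forall n, cnorm (u n) <= M) -> tends u l ->
  cnorm l <= M.
Proof.
move=> uM /tendsP ul; apply/ler_addgt0Pl => e /ul[N /(_ N (leqnn _))] ule.
rewrite -[l](subKr (u N)) (le_trans (cnormB_le _ _))// addrC lerD//.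
exact: ltW.
Qed.

End tends.

(** * Majorants and square roots *)

Section complete.
Context (R : realType) (A : cstarAlgType R).

Lemma tends_cauchy (u : nat -> A) (v : nat -> R) :
  (forall n k, cnorm (u (n + k)%N - u n) <= v (n + k)%N - v n) ->
  cvgn v -> exists l, tends u l.
Proof.
move=> uv /cvg_cauchy/cauchyP vc; apply: cstar_complete => e e0.
have /vc[x [N _ NP]] : 0 < e / 2 by rewrite divr_gt0.
exists N.
suff H m n : (N <= m)%N -> (m <= n)%N -> cnorm (u n - u m) < e.
  by move=> m n Nm Nn; case: (leqP m n) => [|/ltnW] mn; [rewrite cnormBC|];
    exact: H.
move=> Nm mn; rewrite -(subnKC mn) (le_lt_trans (uv _ _))// subnKC//.
have := NP m Nm; have := NP n (leq_trans Nm mn).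
rewrite /ball /= => xn xm.
rewrite (le_lt_trans (ler_norm _))//.
rewrite -(subrKA x) (le_lt_trans (ler_normD _ _))// distrC.
by rewrite [e]splitr ltrD.
Qed.

Let v : nat -> R := fun n => iter n (fun s => 2^-1 * (1 + s ^+ 2)) 0.

Let vS n : v n.+1 = 2^-1 * (1 + v n ^+ 2). Proof. by []. Qed.

Let v_bound n : 0 <= v n <= 1.
Proof.
elim: n => [|n /andP[v0 v1]]; first by rewrite lexx ler01.
rewrite vS; apply/andP; split; first by rewrite mulr_ge0// ?invr_ge0// addr_ge0//
  sqr_ge0.
by rewrite ler_pdivrMl// mulr1 -[leRHS]/(1 + 1) lerD2l expr_le1.
Qed.

Let v_nd : nondecreasing_seq v.
Proof.
apply/nondecreasing_seqP => n.
elim: n => [|n IH]; first by have /andP[] := v_bound 1.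
rewrite !vS ler_pM2l ?invr_gt0// lerD2l.
by rewrite ler_sqr// nnegrE; [have /andP[] := v_bound n|have /andP[] := v_bound
  n.+1].
Qed.

Let v_cvg : cvgn v.
Proof.
apply: (nondecreasing_is_cvgn v_nd); exists 1 => _ [n _ <-].
by have /andP[] := v_bound n.
Qed.

(* The iteration u <- (a + u^2) / 2 is dominated by the same iteration on the
   reals started from a = 1, which is increasing and bounded by 1: hence it
   converges even when the norm of a is 1. *)
Lemma csqrt_ex (a : A) : cnorm a <= 1 -> exists u : A,
  [/\ (1 - u) * (1 - u) = 1 - a, (star a = a -> star u = u),
      (forall b, b * a = a * b -> b * u = u * b) & cnorm u <= 1].
Proof.
move=> a1.
pose u : nat -> A := fun n => iter n (fun s => (2^-1 : R)%:C%C *: (a + s * s)) 0.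
have uS n : u n.+1 = (2^-1 : R)%:C%C *: (a + u n * u n) by [].
have uv n : cnorm (u n) <= v n.
  elim: n => [|n IH]; first by rewrite cnorm0.
  rewrite uS cnormZr vS ger0_norm ?invr_ge0// ler_pM2l ?invr_gt0//.
  rewrite (le_trans (cnormD_le _ _))// lerD// (le_trans (cnormM_le _ _))//.
  by rewrite expr2 ler_pM// cnorm_ge0.
have udiff n k : cnorm (u (n + k)%N - u n) <= v (n + k)%N - v n.
  elim: n => [|n IH]; first by rewrite !subr0.
  rewrite addSn !uS !vS -scalerBr cnormZr -mulrBr ger0_norm ?invr_ge0//.
  rewrite ler_pM2l ?invr_gt0// !opprD !(addrACA _ _ (- _)) !subrr !add0r.
  have -> : u (n + k)%N * u (n + k)%N - u n * u n =
     u (n + k)%N * (u (n + k)%N - u n) + (u (n + k)%N - u n) * u n.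
    by rewrite mulrBr mulrBl addrA subrK.
  have -> : v (n + k)%N ^+ 2 - v n ^+ 2 =
    v (n + k)%N * (v (n + k)%N - v n) + (v (n + k)%N - v n) * v n by ring.
  rewrite (le_trans (cnormD_le _ _))// lerD//.
    by rewrite (le_trans (cnormM_le _ _))// ler_pM// cnorm_ge0.
  by rewrite (le_trans (cnormM_le _ _))// ler_pM// cnorm_ge0.
have [l ul] := tends_cauchy udiff v_cvg.
have l_fix : l = (2^-1 : R)%:C%C *: (a + l * l).
  apply: (@tends_unique _ _ (fun n => u n.+1)).
    by have := tends_shift 1 ul; under eq_fun do rewrite addn1.
  by apply: tendsZ; apply: tendsD (tendsM ul ul); exact: tends_cst.
exists l; split.
(* The fixed point equation 2 l = a + l^2 is (1 - l)^2 = 1 - a. *)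
- have : (2 : R)%:C%C *: l = a + l * l.
    by rewrite {1}l_fix scalerA -rmorphM /= mulfV// scale1r.
  rewrite mulrBl mul1r mulrBr mulr1 => l2.
  have -> : l * l = l + l - a.
    by rewrite -[RHS]/(l + l - a) -[l in l + l]scale1r -scalerDl -(rmorphD _ 1 1)
      l2 [a + _]addrC addrK.
  by rewrite [- (l + l - a)]opprB (addrCA l) [- (l + l)]opprD (addrA l) subrr
    add0r opprB addrA subrK.
- move=> sa; have su n : star (u n) = u n.
    elim: n => [|n IH]; first exact: star0.
    by rewrite uS starZr starD starM IH sa.
  by apply: (tends_unique _ ul); have := tends_star ul; under eq_fun do rewrite su.
- move=> b ba; have bu n : b * u n = u n * b.
    elim: n => [|n IH]; first by rewrite mulr0 mul0r.
    by rewrite uS; apply: commZr; rewrite mulrDr mulrDl ba commM.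
  apply: (tends_unique (tendsM (tends_cst b) ul)).
  by under eq_fun do rewrite bu; exact: tendsM ul (tends_cst b).
- apply: tends_norm_le ul => n; apply: le_trans (uv n) _.
  by have /andP[] := v_bound n.
Qed.

End complete.

(** * The positive cone and positive functionals *)

Section positive.
Context (R : realType) (A : cstarAlgType R).
Implicit Types (a b c d : A) (s t : R).

Notation "t %:a" := (t%:C%C *: (1 : A)) (at level 2, format "t %:a").

(** Squares of self-adjoint elements, which is what the iteration for roots produces; [pos_starM]
    shows that the elements d^* d are positive in this sense. *)
Definition pos a : Prop := exists2 b, star b = b & a = b * b.

Lemma pos_star a : pos a -> star a = a.
Proof. by move=> [b sb ->]; rewrite starM sb. Qed.

Lemma star_real t : star t%:a = t%:a.
Proof. by rewrite starZr star1. Qed.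

Lemma commr_real t a : a * t%:a = t%:a * a.
Proof. by rewrite -scalerAl -scalerAr mul1r mulr1. Qed.

(* If b and c commute and b^2 + c^2 = t, then u = b + i c satisfies
   u^* u = t, and b is the real part of u. *)
Lemma comm_sq_le b c t : 0 <= t -> star b = b -> star c = c -> b * c = c * b ->
  b * b + c * c = t%:a -> cnorm b ^+ 2 <= t.
Proof.
move=> t0 sb sc bc bct; pose u := b + 'i%C *: c.
have su : star u = b - 'i%C *: c.
  rewrite starD starZ sb sc; congr (_ + _).
  by rewrite (_ : Num.conj _ = - 'i%C) ?scaleNr//; apply/eqP;
    rewrite eq_complex /= oppr0 !eqxx.
have uu : star u * u = t%:a.
  rewrite su mulrBl !mulrDr -bct -!scalerAl -!scalerAr bc scalerA.
  rewrite -[_ * 'i%C]expr2 sqr_i scaleN1r opprD opprK addrA.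
  by congr (_ + _); rewrite addrK.
have ut : cnorm u ^+ 2 <= t by rewrite -cnorm_starM uu (le_trans (cnorm_real_le _
  _))// ger0_norm.
apply: le_trans ut; rewrite ler_sqr ?nnegrE ?cnorm_ge0//.
have -> : b = (2^-1 : R)%:C%C *: (u + star u).
  rewrite su addrACA subrr addr0 scalerDr -scalerDl -rmorphD /=.
  by rewrite (_ : 2^-1 + 2^-1 = 1) ?scale1r//; lra.
rewrite cnormZr ger0_norm ?invr_ge0// ler_pdivrMl// mulrC mulr_natr mulr2n.
by rewrite (le_trans (cnormD_le _ _))// cnorm_star.
Qed.

Lemma cnorm_sa_sq b : star b = b -> cnorm (b * b) = cnorm b ^+ 2.
Proof. by move=> sb; rewrite -{1}sb cnorm_starM. Qed.

(** [csqrt_ex] gives a self-adjoint c with c^2 = 1 - b^2 that commutes with b. Then b^2 + c^2 = 1,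
    and [comm_sq_le] bounds |c|^2 = |c^2|. *)
Lemma unit_sub_sq_le b : star b = b -> cnorm b <= 1 -> cnorm (1 - b * b) <= 1.
Proof.
move=> sb b1; have bb1 : cnorm (b * b) <= 1.
  by rewrite cnorm_sa_sq// expr_le1// cnorm_ge0.
have [u [uu su cu _]] := csqrt_ex bb1.
have {}su : star (1 - u) = 1 - u by rewrite starB star1 su// starM sb.
rewrite -uu cnorm_sa_sq// (@comm_sq_le _ b)//.
  by apply/esym/commB; [rewrite mulr1 mul1r|rewrite cu// mulrA].
by rewrite uu subrK scale1r.
Qed.

Lemma real_sub_sq_le b t : star b = b -> cnorm b ^+ 2 <= t ->
  cnorm (t%:a - b * b) <= t.
Proof.
move=> sb bt.
have t0 : 0 <= t by rewrite (le_trans _ bt)// sqr_ge0.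
have [t00|tn0] := eqVneq t 0.
  have -> : b = 0.
    by apply: cnorm0_eq0; apply/eqP; rewrite -sqrf_eq0 eq_le sqr_ge0 andbT
      -[leRHS]t00.
  by rewrite t00 scale0r mulr0 subrr cnorm0.
have tp : 0 < t by rewrite lt_def tn0.
pose b' := ((Num.sqrt t)^-1)%:C%C *: b.
have tt : (Num.sqrt t)^-1 * (Num.sqrt t)^-1 = t^-1.
  by rewrite -invfM -expr2 sqr_sqrtr.
have b'b' : b' * b' = (t^-1)%:C%C *: (b * b).
  by rewrite -scalerAl -scalerAr scalerA -rmorphM /= tt.
have -> : t%:a - b * b = t%:C%C *: (1 - b' * b').
  by rewrite b'b' scalerBr scalerA -rmorphM /= mulfV// scale1r.
rewrite cnormZr ger0_norm// ler_piMr// unit_sub_sq_le//.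
  by rewrite starZr sb.
rewrite cnormZr ger0_norm ?invr_ge0 ?sqrtr_ge0// ler_pdivrMl ?sqrtr_gt0// mulr1.
by rewrite -(ler_sqr (_ : _ \in Num.nneg)) ?nnegrE ?cnorm_ge0 ?sqrtr_ge0//
  sqr_sqrtr.
Qed.

(** After division by t this is [csqrt_ex] for 1 - a/t. The last clause is the same distance
    condition for the root, which makes the root itself positive. *)
Lemma sqrt_of_dist a t : 0 <= t -> star a = a -> cnorm (t%:a - a) <= t ->
  exists b, [/\ star b = b, a = b * b, forall c, c * a = a * c -> c * b = b * c
    & cnorm ((Num.sqrt t)%:a - b) <= Num.sqrt t].
Proof.
move=> t0 sa at_.
have [t00|tn0] := eqVneq t 0.
  have -> : a = 0.
    apply: cnorm0_eq0; apply/eqP; rewrite eq_le cnorm_ge0 andbT.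
    by move: at_; rewrite t00 scale0r sub0r cnormN.
  exists 0; split; rewrite ?star0 ?mulr0//.
  by rewrite subr0 (le_trans (cnorm_real_le _ _))// ger0_norm// sqrtr_ge0.
have tp : 0 < t by rewrite lt_def tn0.
pose a' := (t^-1)%:C%C *: a.
have a'1 : cnorm (1 - a') <= 1.
  have -> : 1 - a' = (t^-1)%:C%C *: (t%:a - a).
    by rewrite scalerBr scalerA -rmorphM /= mulVf// scale1r.
  by rewrite cnormZr ger0_norm ?invr_ge0// ler_pdivrMl// mulr1.
have [u [uu su cu u1]] := csqrt_ex a'1.
have ss : Num.sqrt t * Num.sqrt t = t by rewrite -expr2 sqr_sqrtr.
exists ((Num.sqrt t)%:C%C *: (1 - u)); split.
- by rewrite starZr starB star1 su// starB star1 starZr sa.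
- rewrite -scalerAl -scalerAr scalerA -rmorphM /= ss uu opprB addrC subrK.
  by rewrite scalerA -rmorphM /= mulfV// scale1r.
- move=> c ca; apply: commZr; apply: commB; first by rewrite mulr1 mul1r.
  apply: cu; apply: commB; first by rewrite mulr1 mul1r.
  exact: commZr.
- by rewrite -scalerBr opprB addrC subrK cnormZr ger0_norm ?sqrtr_ge0//
  ler_piMr ?sqrtr_ge0.
Qed.

(** With [dist_pos], this describes positivity by the norm alone. The triangle inequality then shows
    that sums of positive elements are positive, although a sum of squares is not visibly a
    square. *)
Lemma pos_dist a t : 0 <= t -> star a = a -> cnorm (t%:a - a) <= t -> pos a.
Proof. by move=> t0 sa /sqrt_of_dist[]// b [sb -> _ _]; exists b. Qed.

Lemma pos_sqrt a : pos a -> exists b,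
  [/\ pos b, a = b * b & forall c, c * a = a * c -> c * b = b * c].
Proof.
move=> [b sb aE].
have [|||c [sc ac cc cdist]] := @sqrt_of_dist a (cnorm b ^+ 2); rewrite ?sqr_ge0//.
- by rewrite aE starM sb.
- by rewrite aE; apply: real_sub_sq_le.
by exists c; split=> //; apply: pos_dist cdist => //; rewrite sqrtr_ge0.
Qed.

Lemma dist_pos a t : pos a -> cnorm a <= t -> cnorm (t%:a - a) <= t.
Proof. by move=> [b sb ->]; rewrite cnorm_sa_sq//; exact: real_sub_sq_le. Qed.

Lemma posD a b : pos a -> pos b -> pos (a + b).
Proof.
move=> pa pb; apply: (@pos_dist _ (cnorm a + cnorm b)).
- by rewrite addr_ge0// cnorm_ge0.
- by rewrite starD !pos_star.
rewrite rmorphD scalerDl opprD addrACA (le_trans (cnormD_le _ _))// lerD//;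
by rewrite dist_pos.
Qed.

Lemma pos0 : pos 0.
Proof. by exists 0; rewrite ?star0 ?mulr0. Qed.

Lemma posZ a t : 0 <= t -> pos a -> pos (t%:C%C *: a).
Proof.
move=> t0 [b sb ->]; exists ((Num.sqrt t)%:C%C *: b); first by rewrite starZr sb.
by rewrite -scalerAl -scalerAr scalerA -rmorphM /= -[_ * Num.sqrt t]expr2 sqr_sqrtr.
Qed.

Lemma pos_sum (I : Type) (r : seq I) (F : I -> A) :
  (forall i, pos (F i)) -> pos (\sum_(i <- r) F i).
Proof. by move=> pF; apply: big_ind => //; [exact: pos0|exact: posD]. Qed.

Lemma posM a b : pos a -> pos b -> a * b = b * a -> pos (a * b).
Proof.
move=> /pos_sqrt[a1 [/pos_star sa1 aE ca1]] /pos_sqrt[b1 [/pos_star sb1 bE cb1]] ab.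
have a1b1 : a1 * b1 = b1 * a1 by apply: cb1; apply/esym/ca1.
exists (a1 * b1); first by rewrite starM sa1 sb1.
by rewrite aE bE -!mulrA; congr (_ * _); rewrite !mulrA a1b1.
Qed.

(** The roots of a and of t - a commute, so [comm_sq_le] applies to them. *)
Lemma pos_le_real a t : 0 <= t -> pos a -> pos (t%:a - a) -> cnorm a <= t.
Proof.
move=> t0 /pos_sqrt[b [/pos_star sb aE cb]] /pos_sqrt[c [/pos_star sc cE cc]].
rewrite aE cnorm_sa_sq//; apply: (@comm_sq_le b c) => //; last first.
  by rewrite -aE -cE addrC subrK.
by apply: cc; apply: commB; [exact: commr_real|rewrite aE mulrA].
Qed.

Lemma pos_norm_sub a : pos a -> pos ((cnorm a)%:a - a).
Proof.
move=> pa; apply: (@pos_dist _ (cnorm a)); first exact: cnorm_ge0.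
  by rewrite starB star_real pos_star.
by rewrite opprB addrC subrK.
Qed.

Lemma pos_norm_mono a b : pos a -> pos (b - a) -> cnorm a <= cnorm b.
Proof.
move=> pa pba; apply: pos_le_real => //; first exact: cnorm_ge0.
have pb : pos b by rewrite -[b](subrK a); exact: posD.
by rewrite -[(cnorm b)%:a](subrK b) -addrA; apply: posD => //; exact: pos_norm_sub.
Qed.

(* If |e| = 1, x = e e^* >= 0 and y = e^* e <= 0, then x + x^2 = e (1 + y) e^*
   has norm at most 1, whereas x + x^2 >= 2 x^2 and |x^2| = 1. *)
Lemma pos_neg_star_eq0 e : pos (e * star e) -> pos (- (star e * e)) -> e = 0.
Proof.
move=> px0 ny0.
have [->//|e0] := eqVneq e 0; exfalso.
have ne0 : 0 < cnorm e by rewrite cnorm_gt0.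
pose f := ((cnorm e)^-1)%:C%C *: e.
have nf : cnorm f = 1 by rewrite cnormZr ger0_norm ?invr_ge0 ?ltW// mulVf// gt_eqF.
pose k := (cnorm e)^-1 * (cnorm e)^-1.
have k0 : 0 <= k by rewrite -[k]expr2 sqr_ge0.
have fX : f * star f = k%:C%C *: (e * star e).
  by rewrite starZr -scalerAl -scalerAr scalerA -rmorphM.
have fY : star f * f = k%:C%C *: (star e * e).
  by rewrite starZr -scalerAl -scalerAr scalerA -rmorphM.
have px : pos (f * star f) by rewrite fX; exact: posZ.
have ny : pos (- (star f * f)) by rewrite fY -scalerN; exact: posZ.
set x := f * star f in px; set y := star f * f in ny.
have nx : cnorm x = 1 by rewrite cnorm_mul_star nf expr1n.
have y1 : cnorm (1 + y) <= 1.
  have := dist_pos ny (_ : cnorm _ <= 1); rewrite opprK scale1r; apply.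
  by rewrite cnormN cnorm_starM nf expr1n.
have xx : x + x * x = f * (1 + y) * star f.
  by rewrite mulrDr mulr1 mulrDl /y !mulrA.
have xx1 : cnorm (x + x * x) <= 1.
  rewrite xx (le_trans (cnormM_le _ _))// cnorm_star nf mulr1.
  by rewrite (le_trans (cnormM_le _ _))// nf mul1r.
have sx : star x = x by exact: pos_star.
have : cnorm (2%:C%C *: (x * x)) <= cnorm (x + x * x).
  apply: pos_norm_mono; first by apply: posZ => //; exists x.
  have -> : x + x * x - 2%:C%C *: (x * x) = x * (1 - x).
    rewrite (_ : 2 = 1 + 1 :> R)// rmorphD scalerDl scale1r.
    by rewrite opprD addrA addrK mulrBr mulr1.
  apply: posM => //.
    by have := pos_norm_sub px; rewrite nx scale1r.
  by rewrite mulrBr mulrBl mulr1 mul1r.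
rewrite cnormZr normr_nat cnorm_sa_sq// nx expr1n mulr1 => /le_trans/(_ xx1).
by rewrite leNgt (_ : 1 < 2) // ltr1n.
Qed.

(** It turns the positivity of - e^* e into that of e e^* in [pos_starM]. *)
Lemma pos_re_im (e : A) : pos (star e * e + e * star e).
Proof.
pose p := e + star e; pose q := 'i%C *: (e - star e).
have sp : star p = p by rewrite starD starK addrC.
have sq : star q = q.
  rewrite starZ starB starK (_ : Num.conj _ = - 'i%C).
    by rewrite scaleNr -scalerN opprB.
  by apply/eqP; rewrite eq_complex /= oppr0 !eqxx.
have -> : star e * e + e * star e = (2^-1 : R)%:C%C *: (p * p + q * q).
  have -> : q * q = - ((e - star e) * (e - star e)).
    by rewrite -scalerAl -scalerAr scalerA -expr2 sqr_i scaleN1r.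
  have -> : p * p - (e - star e) * (e - star e) =
     2%:C%C *: (star e * e + e * star e).
    rewrite (_ : 2 = 1 + 1 :> R)// rmorphD scalerDl scale1r.
    rewrite /p !mulrDl !mulrDr !mulrNN !mulrN !mulNr !opprD !opprK.
    set z1 := e * e; set z2 := e * star e; set z3 := star e * e;
      set z4 := star e * star e.
    rewrite addrACA [z1 + z2 + _]addrACA subrr add0r.
    by rewrite [z3 + z4 + _]addrACA [z4 + _]addrC addNr addr0 addrC addrACA.
  by rewrite scalerA -rmorphM /= mulVf// scale1r.
by apply: posZ; [rewrite invr_ge0|apply: posD; [exists p|exists q]].
Qed.

(* Kaplansky: with m = |a| for a = d^* d and n = m - a, the element e = d n
   satisfies e^* e = n a n = - m n^2 <= 0, so that e = 0. *)
Lemma pos_starM d : pos (star d * d).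
Proof.
set a := star d * d; have sa : star a = a by rewrite starM starK.
have /pos_sqrt[m [pm mm cm]] : pos (a * a) by exists a.
have am : a * m = m * a by apply: cm; rewrite mulrA.
have [r [/pos_star sr rr cr]] := pos_sqrt pm.
pose n := m - a.
have sn : star n = n by rewrite starB sa pos_star.
have mn : n * m = m * n by rewrite mulrBl mulrBr am.
have rn : n * r = r * n by exact: cr.
have an : a * n = - (m * n) by rewrite !mulrBr opprB am mm.
have srn : star (r * n) = r * n by rewrite starM sr sn.
pose e := d * n.
have ee : - (star e * e) = (r * n) * (r * n).
  have -> : star e * e = n * (a * n) by rewrite starM sn /a !mulrA.
  by rewrite an mulrN opprK rr -{1}rn -!mulrA.
have pe : pos (- (star e * e)) by rewrite ee; exists (r * n).
have e0 : e = 0.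
  apply: pos_neg_star_eq0 => //; rewrite -[e * _](addKr (star e * e)).
  by apply: posD => //; exact: pos_re_im.
(* Now m n = 0, hence a n = - m n = 0 and n^2 = (m - a) n = 0: a is equal to its modulus m. *)
have rn0 : r * n = 0.
  apply: cnorm0_eq0; apply/eqP; rewrite -sqrf_eq0 -cnorm_sa_sq// -ee e0.
  by rewrite mulr0 oppr0 cnorm0.
have mn0 : m * n = 0 by rewrite rr -mulrA rn0 mulr0.
have nn0 : n * n = 0 by rewrite {1}/n mulrBl an mn0 oppr0 subr0.
have /eqP : n = 0.
  by apply: cnorm0_eq0; apply/eqP; rewrite -sqrf_eq0 -cnorm_sa_sq// nn0 cnorm0.
by rewrite subr_eq0 => /eqP <-.
Qed.

Lemma star_le1_cnorm c b : pos b -> star c * c + b = 1 -> cnorm c <= 1.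
Proof.
move=> pb cb; have : cnorm (star c * c) <= 1.
  apply: pos_le_real => //; first exact: pos_starM.
  by rewrite scale1r -cb addrC addKr.
by rewrite cnorm_starM expr_le1// cnorm_ge0.
Qed.

Lemma sum_star_le1 (I : finType) (u : I -> A) i :
  \sum_i star (u i) * u i = 1 -> cnorm (u i) <= 1.
Proof.
move=> u1; apply: (@star_le1_cnorm _ (\sum_(j | j != i) star (u j) * u j)).
  by apply: big_ind => [||j _]; [exact: pos0|exact: posD|exact: pos_starM].
by rewrite -u1 [in RHS](bigD1 i).
Qed.

Definition positive_functional (f : A -> R[i]^o) : Prop :=
  linear f /\ forall a, 0 <= f (star a * a).

(** For self-adjoint a, both |a| - a and |a| + a are positive, which bounds f(a). A general a is
    first multiplied by a phase that makes f(a) nonnegative, then replaced by its self-adjoint part,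
    where f has the same value. *)
Lemma positive_functional_bound (f : A -> R[i]^o) : positive_functional f ->
  forall a, modulus (f a) <= complex.Re (f 1) * cnorm a.
Proof.
move=> [fl fp].
have fD a b : f (a + b) = f a + f b by rewrite -{1}[a]scale1r fl scale1r.
have f0 : f 0 = 0 by apply: (addrI (f 0)); rewrite -fD !addr0.
have fZ (k : R[i]) a : f (k *: a) = k * f a by rewrite -[k *: a]addr0 fl f0 addr0.
have fN a : f (- a) = - f a by rewrite -scaleN1r fZ mulN1r.
have fpos a : pos a -> 0 <= f a by move=> [b sb ->]; rewrite -{1}sb.
have fsa a : star a = a -> complex.Im (f a) = 0 /\
    `|complex.Re (f a)| <= complex.Re (f 1) * cnorm a.
  move=> sa.
  have pp b : star b = b -> cnorm b <= cnorm a -> 0 <= f ((cnorm a)%:a - b).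
    move=> sb ba; apply: fpos; apply: (@pos_dist _ (cnorm a)); rewrite ?cnorm_ge0//.
      by rewrite starB star_real sb.
    by rewrite opprB addrC subrK.
  have f1 : complex.Im (f 1) = 0.
    have := fp 1; rewrite star1 mulr1 => /ger0_Im //.
  have := pp a sa (lexx _); have := pp (- a).
  rewrite starN sa cnormN => /(_ erefl (lexx _)).
  rewrite opprK fD [f (_ - _)]fD fN fZ; case: (f 1) f1 => x1 y1 /= ->.
  case: (f a) => x y; rewrite !lecE /= !mul0r !mulr0 !addr0 !subr0 !add0r.
  move=> /andP[/eqP y0 l1] /andP[_ l2]; split=> //.
  by rewrite ler_norml; apply/andP; split; lra.
have fherm a : f (star a) = Num.conj (f a).
  pose p := (2^-1 : R)%:C%C *: (a + star a).
  pose q := (2^-1 : R)%:C%C *: ('i%C *: (star a - a)).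
  have sp : star p = p by rewrite starZr starD starK addrC.
  have ci : Num.conj ('i%C : R[i]) = - 'i%C.
    by apply/eqP; rewrite eq_complex /= oppr0 !eqxx.
  have sq : star q = q.
    by rewrite starZr starZ starB starK ci scaleNr -scalerN opprB.
  have aE : a = p + 'i%C *: q.
    rewrite /q !scalerA mulrAC -expr2 sqr_i mulN1r scaleNr -scalerN opprB -scalerDr.
    by rewrite addrACA subrr addr0 scalerDr -scalerDl -rmorphD /=
      (_ : 2^-1 + 2^-1 = 1) ?scale1r//; lra.
  have saE : star a = p - 'i%C *: q.
    by rewrite {1}aE starD sp starZ sq ci scaleNr.
  rewrite saE {1}aE !fD fN !(fZ _ q).
  have [] := fsa p sp; have [] := fsa q sq.
  case: (f p) => x1 y1; case: (f q) => x2 y2 /= -> _ -> _.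
  by apply/eqP; rewrite eq_complex /=; apply/andP; split; apply/eqP; ring.
move=> a; have [fa0|fa0] := eqVneq (f a) 0.
  have := fsa 1 (star1 _) => -[_ /(le_trans (normr_ge0 _))].
  rewrite fa0 modulus0 => _; rewrite mulr_ge0 ?cnorm_ge0//.
  by have := fp 1; rewrite star1 mulr1 lecE => /andP[].
pose c := Num.conj (f a) / (modulus (f a))%:C%C.
have mf : (modulus (f a))%:C%C != 0 :> R[i].
  by rewrite modulusE normr_eq0.
have cf : c * f a = (modulus (f a))%:C%C.
  by rewrite mulrAC [_ * f a]mulrC -normCK -modulusE expr2 mulfK.
have c1 : modulus c = 1.
  rewrite modulusM modulusV modulusR [`|_|]ger0_norm ?modulus_ge0//.
  rewrite {1}/modulus norm_conjC mulfV//.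
  by rewrite -(inj_eq (@complexI R)).
pose b := (2^-1 : R)%:C%C *: (c *: a + star (c *: a)).
have sb : star b = b by rewrite starZr starD starK addrC.
have fb : f b = (modulus (f a))%:C%C.
  rewrite fZ fD fherm fZ cf conjC_real -rmorphD /= -rmorphM /=.
  by congr (_%:C%C); lra.
have [_] := fsa b sb; rewrite fb /= ger0_norm ?modulus_ge0// => /le_trans; apply.
rewrite ler_wpM2l//; first by have := fp 1; rewrite star1 mulr1 lecE => /andP[].
rewrite cnormZr ger0_norm ?invr_ge0// ler_pdivrMl// mulrC mulr_natr mulr2n.
rewrite (le_trans (cnormD_le _ _))// cnorm_star cnormZ c1 mul1r//.
Qed.

End positive.

(** The morphism carries a root of |a|^2 - a^2 to one of |a|^2 - f(a)^2, which settles self-adjoint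
    a; the C*-identity reduces the general case to a^* a. It is how the action is seen to be
    contractive. *)
Lemma morphism_contractive (R : realType) (A B : cstarAlgType R) (f : A -> B) :
  linear f -> {morph f : a b / a * b} -> {morph f : a / star a} -> f 1 = 1 ->
  forall a, cnorm (f a) <= cnorm a.
Proof.
move=> fl fM fs f1.
have fB a b : f (a - b) = f a - f b.
  by rewrite addrC -scaleN1r fl scaleN1r addrC.
have fZ c a : f (c *: a) = c *: f a.
  have f0 : f 0 = 0 by rewrite -(subrr (0 : A)) fB subrr.
  by rewrite -[c *: a]addr0 fl f0 addr0.
have fsa a : star a = a -> cnorm (f a) <= cnorm a.
  move=> sa; have : pos ((cnorm a ^+ 2)%:C%C *: 1 - a * a).
    apply: (@pos_dist _ _ _ (cnorm a ^+ 2)); rewrite ?sqr_ge0//.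
      by rewrite starB star_real starM sa.
    by rewrite opprB addrC subrK cnorm_sa_sq.
  move=> [b sb /(congr1 f)]; rewrite fB fZ f1 !fM => fab.
  rewrite -(ler_sqr (_ : _ \in Num.nneg)) ?nnegrE ?cnorm_ge0//
    -cnorm_sa_sq -?fs ?sa//.
  apply: pos_le_real; first by rewrite sqr_ge0.
    by exists (f a); rewrite // -fs sa.
  by rewrite fab; exists (f b); rewrite // -fs sb.
move=> a; rewrite -(ler_sqr (_ : _ \in Num.nneg)) ?nnegrE ?cnorm_ge0//.
rewrite -!cnorm_starM -fs -fM; apply: fsa.
by rewrite starM starK.
Qed.

(** * Growth rates *)

Section real_sequences.
Context (R : realType).
Implicit Types (a b v : nat -> R) (h : R).

Lemma fekete b : (forall n, 0 <= b n) ->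
  (forall m n, b (m + n)%N <= b m + b n) ->
  cvgn (fun n : nat => n%:R^-1 * b n).
Proof.
move=> b0 bD.
pose E : set R := [set n%:R^-1 * b n | n in [set n : nat | (0 < n)%N]].
have Einf : has_inf E.
  split; first by exists (1%:R^-1 * b 1%N), 1%N.
  by exists 0 => _ [n _ <-]; rewrite mulr_ge0// invr_ge0.
apply/cvg_ex; exists (inf E); apply/cvgrPdist_le => e e0.
have e2 : 0 < e / 2 by rewrite divr_gt0.
have [_ [m m0 <-] mE] := inf_adherent e2 Einf.
(* B bounds every remainder term b(n mod m); the rank chosen below makes its share B / n at most e /
   2. *)
pose B := \sum_(r < m) b r.
have bq q r : b (q * m + r)%N <= q%:R * b m + b r.
  elim: q => [|q IH]; first by rewrite mul0n add0n mul0r add0r.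
  rewrite mulSn -addnA (le_trans (bD _ _))// -natr1 mulrDl mul1r.
  by rewrite [_ + b m]addrC -addrA lerD2l.
have B0 : 0 <= B by apply: sumr_ge0.
exists (Num.truncn (B / (e / 2))).+1 => // n /= nB.
have n0 : (0 < n)%N by apply: leq_ltn_trans nB.
have Bn : B / (e / 2) <= n%:R.
  rewrite (le_trans (ltW (truncnS_gt _)))// ler_nat.
  exact: nB.
have nR : 0 < n%:R :> R by rewrite ltr0n.
have inf_le : inf E <= n%:R^-1 * b n.
  by apply: ge_inf; [case: Einf|exists n].
rewrite distrC ger0_norm ?subr_ge0// lerBlDr.
have mR : 0 < m%:R :> R by rewrite ltr0n.
have : b n <= (n %/ m)%N%:R * b m + B.
  rewrite {1}(divn_eq n m) (le_trans (bq _ _))// lerD2l.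
  have lt : (n %% m < m)%N by rewrite ltn_mod.
  by rewrite /B (bigD1 (Ordinal lt))//= lerDl sumr_ge0.
have qm : (n %/ m)%N%:R <= n%:R / m%:R :> R.
  by rewrite ler_pdivlMr// -natrM ler_nat leq_trunc_div.
have qb : (n %/ m)%N%:R * b m <= n%:R * (m%:R^-1 * b m).
  by rewrite mulrA ler_wpM2r.
move=> bn; rewrite ler_pdivrMl// (le_trans bn)//.
have -> : n%:R * (e + inf E) = n%:R * (inf E + e / 2) + n%:R * (e / 2).
  by rewrite -mulrDr; congr (_ * _); lra.
rewrite lerD//; last by rewrite -ler_pdivrMr.
by rewrite (le_trans qb)// ler_wpM2l ?ltW.
Qed.

Lemma submultiplicative_cvg a : (forall n, 1 <= a n) ->
  (forall m n, a (m + n)%N <= a m * a n) ->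
  cvgn (fun n : nat => n%:R^-1 * ln (a n)).
Proof.
move=> a1 aM; have a0 n : 0 < a n by rewrite (lt_le_trans ltr01).
apply: fekete => [n|m n]; first exact: ln_ge0.
by rewrite -lnM ?posrE// ler_ln ?posrE// mulr_gt0.
Qed.

Lemma cvgn_within v h : v @ \oo --> h -> forall e, 0 < e ->
  exists N : nat, forall n, (N <= n)%N -> h - e <= v n <= h + e.
Proof.
move=> /cvgrPdist_le vh e /vh[N _ NP]; exists N => n /NP.
by rewrite /= ler_distlC.
Qed.

Lemma limn_esup_eq v h : (forall e, 0 < e -> exists N : nat, forall n,
  (N <= n)%N -> v n <= h + e) ->
  (forall e, 0 < e -> forall N : nat, exists2 n, (N <= n)%N & h - e <= v n) ->
  limn_esup (fun n : nat => (v n)%:E) = h%:E.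
Proof.
move=> vle vge; apply/eqP; rewrite eq_le; apply/andP; split.
  apply/lee_addgt0Pr => e e0; have [N NP] := vle e e0.
  apply: (@le_trans _ _ (ereal_sup [set (v n)%:E | n in [set n | (N <= n)%N]])).
    by apply: ereal_inf_lbound; exists [set n | (N <= n)%N] => //; exists N.
  by apply: ge_ereal_sup => _ [n /= Nn <-]; rewrite -EFinD lee_fin NP.
apply: le_ereal_inf_tmp => _ [V [N _ NV] <-]; apply/lee_addgt0Pr => e e0.
have [n Nn hn] := vge e e0 N.
apply: (@le_trans _ _ ((v n)%:E + e%:E)%E).
  by rewrite -EFinD lee_fin -lerBlDr.
by rewrite leeD2r//; apply: ereal_sup_ubound; exists n => //; exact: NV.
Qed.

Lemma limn_esup_often v h : limn_esup (fun n : nat => (v n)%:E) = h%:E ->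
  forall e, 0 < e -> forall N : nat, exists2 n, (N <= n)%N & h - e < v n.
Proof.
move=> vh e e0 N; apply: contrapT => H.
suff : (limn_esup (fun n : nat => (v n)%:E) <= (h - e)%:E)%E.
  by rewrite vh lee_fin; lra.
apply: (@le_trans _ _ (ereal_sup [set (v n)%:E | n in [set n | (N <= n)%N]])).
  by apply: ereal_inf_lbound; exists [set n | (N <= n)%N] => //; exists N.
apply: ge_ereal_sup => _ [n /= Nn <-]; rewrite lee_fin leNgt; apply/negP => lt.
by apply: H; exists n.
Qed.

Lemma maximumP (S : set R) m : S m -> ubound S m -> maximum S = m.
Proof.
move=> Sm um; have [Sg ug] : (S `&` ubound S) (maximum S) by apply: (@getI _ _ m).
by apply/eqP; rewrite eq_le; apply/andP; split; [exact: um|exact: ug].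
Qed.

Lemma minimumP (S : set R) m : S m -> lbound S m -> minimum S = m.
Proof.
move=> Sm um; have [Sg ug] : (S `&` lbound S) (minimum S) by apply: (@getI _ _ m).
by apply/eqP; rewrite eq_le; apply/andP; split; [exact: ug|exact: um].
Qed.

Lemma finite_minimum (T : finType) (P : set T) (f : T -> R) : P !=set0 ->
  exists2 i, P i & minimum [set f i | i in P] = f i /\ forall j, P j -> f i <= f j.
Proof.
move=> [i0 Pi0].
have i0P : [pred i | `[< P i >]] i0 by apply/asboolP.
case: (arg_minP f i0P) => i /asboolP Pi imin.
exists i => //; split=> [|j Pj]; last by apply: imin; apply/asboolP.
apply: minimumP; first by exists i.
by move=> _ [j Pj <-]; apply: imin; apply/asboolP.
Qed.

End real_sequences.

Section tuple_sums.
Context (T : finType) (V : nmodType).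

(** In this section the summand is a function of the underlying sequence, so that words are cut and
    concatenated without casts between tuple types. *)
Lemma sum_tuple0 (F : seq T -> V) : \sum_(w : 0.-tuple T) F w = F [::].
Proof.
by rewrite (big_pred1 [tuple]) // => w; apply/esym/eqP; rewrite [LHS]tuple0.
Qed.

Lemma sum_tupleS (n : nat) (F : seq T -> V) :
  \sum_(w : n.+1.-tuple T) F w = \sum_i \sum_(w : n.-tuple T) F (i :: w).
Proof.
rewrite pair_bigA /=.
rewrite (reindex (fun iw : T * n.-tuple T => [tuple of iw.1 :: iw.2])) //=.
exists (fun w : n.+1.-tuple T => (thead w, behead_tuple w)) => [[i w] _|w _] /=.
  by rewrite theadE; congr (_, _); apply: val_inj.
by rewrite [RHS]tuple_eta.
Qed.

Lemma sum_tupleD (m n : nat) (F : seq T -> V) :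
  \sum_(w : (m + n).-tuple T) F w =
  \sum_(v : m.-tuple T) \sum_(w : n.-tuple T) F (v ++ w).
Proof.
elim: m F => [|m IH] F.
  by rewrite (sum_tuple0 (fun v => \sum_(w : n.-tuple T) F (v ++ w))).
rewrite sum_tupleS (sum_tupleS m (fun v => \sum_(w : n.-tuple T) F (v ++ w))).
by apply: eq_bigr => i _; rewrite (IH (fun w => F (i :: w))).
Qed.

Lemma sum_tuple_rev (n : nat) (F : seq T -> V) :
  \sum_(w : n.-tuple T) F (rev w) = \sum_(w : n.-tuple T) F w.
Proof.
have revK : involutive (fun w : n.-tuple T => [tuple of rev w]).
  by move=> w; apply: val_inj; rewrite /= revK.
by rewrite [RHS](reindex_inj (inv_inj revK)).
Qed.

End tuple_sums.

(** * Words in a spectral subspace *)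

Section spectral_subspaces.
Context (R : realType) (A : cstarAlgType R) (g : circle_action A).

Lemma act_contractive (z : R[i]) : `|z| = 1 -> forall a, cnorm (g z a) <= cnorm a.
Proof.
move=> z1; apply: morphism_contractive.
- exact: act_linear.
- exact: act_mul.
- exact: act_star.
- exact: act_fixed1.
Qed.

Lemma act0 (z : R[i]) : `|z| = 1 -> g z 0 = 0.
Proof.
move=> z1; apply: cnorm0_eq0; apply/eqP; rewrite eq_le cnorm_ge0 andbT.
by rewrite (le_trans (act_contractive z1 _))// cnorm0.
Qed.

Lemma actD (z : R[i]) : `|z| = 1 -> {morph g z : a b / a + b}.
Proof. by move=> z1 a b; rewrite -{1}[a]scale1r act_linear// scale1r. Qed.

Lemma actZ (z : R[i]) : `|z| = 1 -> forall c a, g z (c *: a) = c *: g z a.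
Proof. by move=> z1 c a; rewrite -[c *: a]addr0 act_linear// act0// addr0. Qed.

Lemma actN (z : R[i]) : `|z| = 1 -> {morph g z : a / - a}.
Proof. by move=> z1 a; rewrite -scaleN1r actZ// scaleN1r. Qed.

Lemma act_sum (z : R[i]) : `|z| = 1 -> forall (I : Type) (r : seq I) (F : I -> A),
  g z (\sum_(i <- r) F i) = \sum_(i <- r) g z (F i).
Proof. by move=> z1 I r F; apply: (big_morph (g z)); [exact: actD|exact: act0]. Qed.

Lemma tends_act (z : R[i]) (u : nat -> A) l : `|z| = 1 -> tends u l ->
  tends (fun n => g z (u n)) (g z l).
Proof.
move=> z1 ul; apply: tends_le ul => n.
by rewrite -actN// -actD// act_contractive.
Qed.

Lemma norm1_neq0 (z : R[i]) : `|z| = 1 -> z != 0.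
Proof. by move=> z1; rewrite -normr_eq0 z1 oner_eq0. Qed.

Lemma spectral1 : spectral_subspace g 0 1.
Proof. by move=> z z1; rewrite act_fixed1// expr0z scale1r. Qed.

Lemma spectralM (k l : int) a b : spectral_subspace g k a ->
  spectral_subspace g l b -> spectral_subspace g (k + l) (a * b).
Proof.
move=> ka lb z z1; rewrite act_mul// ka// lb// -scalerAl -scalerAr scalerA.
by rewrite -expfzDr// norm1_neq0.
Qed.

Lemma spectral_star (k : int) a : spectral_subspace g k a ->
  spectral_subspace g (- k) (star a).
Proof.
move=> ka z z1; rewrite act_star// ka// starZ; congr (_ *: _).
have zz : z * Num.conj z = 1 by rewrite -normCK z1 expr1n.
have zJ : Num.conj z = z^-1.
  by rewrite -[LHS]mul1r -(mulVf (norm1_neq0 z1)) -mulrA zz mulr1.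
rewrite -exprz_inv -zJ.
by case: k {ka} => n; rewrite /= ?NegzE -?exprnN -?exprnP ?fmorphV rmorphXn.
Qed.

Lemma spectral_sum (I : Type) (r : seq I) (F : I -> A) (k : int) :
  (forall i, spectral_subspace g k (F i)) ->
  spectral_subspace g k (\sum_(i <- r) F i).
Proof.
move=> kF z z1; rewrite act_sum// scaler_sumr.
by apply: eq_bigr => i _; exact: kF.
Qed.

Lemma fixed_spectral (a : A) : (a \in fixed_points g) = `[< spectral_subspace g 0
  a >].
Proof. by []. Qed.

Lemma conj_spectral (k : int) a b c : spectral_subspace g k a ->
  spectral_subspace g 0 b -> spectral_subspace g k c ->
  spectral_subspace g 0 (a * b * star c).
Proof.
move=> ka b0 kc.
by have := spectralM (spectralM ka b0) (spectral_star kc); rewrite addr0 subrr.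
Qed.

Lemma to_fixedK (a : A) : spectral_subspace g 0 a -> to_fixed g a = a :> A.
Proof. by move=> a0; rewrite /to_fixed insubdK// fixed_spectral; apply/asboolP. Qed.

Lemma spectral_fixed (a : fixed_algebra g) : spectral_subspace g 0 a.
Proof. by apply/asboolP; have := fixed_valP a. Qed.

(** Makes A^0 a C*-algebra, so that the results on positivity hold inside it. The limit stays fixed
    because each [g z] is contractive. *)
Lemma fixed_complete (u : nat -> fixed_algebra g) :
  (forall e : R, 0 < e -> exists N : nat, forall m n : nat,
     (N <= m)%N -> (N <= n)%N -> cnorm (u m - u n) < e) ->
  exists l : fixed_algebra g, cnorm (u n - l) @[n --> \oo] --> (0 : R).
Proof.
move=> uc; have [l ul] := @cstar_complete _ A (fun n => u n : A) uc.
suff l0 : l \in fixed_points g by exists (FixedPoint l0).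
apply/fixed_pointsP => z z1; apply: (tends_unique (tends_act z1 ul)).
under eq_fun => n do have /fixed_pointsP -> // := fixed_valP (u n).
exact: ul.
Qed.

HB.instance Definition _ := isCStarComplete.Build R (fixed_algebra g)
  fixed_complete.

End spectral_subspaces.

Section trace_norm.
Context (R : realType) (B : preCStarAlgType R).
Implicit Types (f : trace_space B) (a b : B).

Lemma trace_linear f : linear f.
Proof. by have /asboolP[] := trace_funP f. Qed.

Lemma trace_tracial f a b : f (a * b) = f (b * a).
Proof. by have /asboolP[_ _ ->] := trace_funP f. Qed.

Lemma trace0 f : f 0 = 0.
Proof.
by have := trace_linear f (-1) 0 0; rewrite scaler0 addr0 scaleN1r addNr.
Qed.

Lemma traceZ f (c : R[i]) a : f (c *: a) = c * f a.
Proof. by rewrite -[c *: a]addr0 trace_linear trace0 addr0. Qed.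

Lemma traceD f a b : f (a + b) = f a + f b.
Proof. by rewrite -{1}[a]scale1r trace_linear scale1r. Qed.

Lemma traceN f a : f (- a) = - f a.
Proof. by rewrite -scaleN1r traceZ mulN1r. Qed.

Lemma trace_sum f (I : Type) (r : seq I) (F : I -> B) :
  f (\sum_(i <- r) F i) = \sum_(i <- r) f (F i).
Proof. exact: (big_morph _ (traceD f) (trace0 f)). Qed.

Lemma trace_norm_le f (M : R) :
  (forall a, cnorm a <= 1 -> modulus (f a) <= M) -> trace_norm f <= M.
Proof.
move=> fM; apply: ge_sup; first by exists (modulus (f 0)), 0 => //=; rewrite cnorm0.
by move=> _ [a a1 <-]; exact: fM.
Qed.

Lemma trace_norm_ub f a : modulus (f a) <= trace_norm f * cnorm a.
Proof.
have ub b : cnorm b <= 1 -> modulus (f b) <= trace_norm f.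
  move=> b1; apply: ub_le_sup; last by exists b.
  have /asboolP[_ [M fM] _] := trace_funP f.
  exists `|M| => _ [c /= c1 <-]; apply: le_trans (fM c) _.
  apply: le_trans (ler_wpM2r (cnorm_ge0 c) (ler_norm M)) _.
  exact: ler_piMr.
have [->|a0] := eqVneq a 0; first by rewrite trace0 modulus0 cnorm0 mulr0.
have na0 : 0 < cnorm a by rewrite cnorm_gt0.
have na0' := ltW na0.
have := ub (((cnorm a)^-1)%:C%C *: a).
rewrite cnormZr [`|_|]ger0_norm ?invr_ge0//.
rewrite mulVf ?gt_eqF// => /(_ (lexx _)).
rewrite traceZ modulusM modulusR ger0_norm ?invr_ge0//.
by rewrite ler_pdivrMl// mulrC.
Qed.

Lemma trace_norm_ge0 f : 0 <= trace_norm f.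
Proof. by rewrite -lecR; exact: (normr_ge0 f). Qed.

Lemma trace_normD f1 f2 : trace_norm (f1 + f2) <= trace_norm f1 + trace_norm f2.
Proof. by rewrite -lecR rmorphD; exact: (ler_normD f1 f2). Qed.

Lemma trace_normZ (c : R[i]) f : trace_norm (c *: f) = modulus c * trace_norm f.
Proof. by apply: complexI; rewrite rmorphM /= modulusE; exact: (normrZ c f). Qed.

Lemma trace_normN f : trace_norm (- f) = trace_norm f.
Proof. by apply: complexI; exact: (normrN f). Qed.

Lemma traceP f1 f2 : (forall a, f1 a = f2 a) -> f1 = f2.
Proof. by move=> f12; apply/val_inj/funext. Qed.

End trace_norm.

Section positive_trace.
Context (R : realType) (B : cstarAlgType R).
Implicit Types (f : trace_space B) (a b : B).

Definition positive_trace f : Prop := forall a, 0 <= f (star a * a).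

Lemma positive_trace_pos f a : positive_trace f -> pos a -> 0 <= f a.
Proof. by move=> fp [b sb ->]; rewrite -{1}sb. Qed.

End positive_trace.

Section fixed_positive.
Context (R : realType) (A : cstarAlgType R) (g : circle_action A).

(** The given root lies in A only; the distance criterion, which depends on the norm alone, provides
    one in A^0. *)
Lemma pos_fixed (a : fixed_algebra g) : pos (a : A) -> pos a.
Proof.
move=> pa; apply: (@pos_dist _ _ _ (cnorm a)); first exact: cnorm_ge0.
  by apply: val_inj; exact: (pos_star pa).
exact: (dist_pos pa).
Qed.

Lemma val_sum (I : Type) (r : seq I) (F : I -> fixed_algebra g) :
  fixed_val (\sum_(i <- r) F i) = \sum_(i <- r) fixed_val (F i).
Proof. exact: (raddf_sum (val : fixed_algebra g -> A)). Qed.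

Lemma to_fixed_sum (I : Type) (r : seq I) (F : I -> A) :
  (forall i, spectral_subspace g 0 (F i)) ->
  to_fixed g (\sum_(i <- r) F i) = \sum_(i <- r) to_fixed g (F i).
Proof.
move=> F0; apply: val_inj; rewrite /= val_sum to_fixedK; last exact: spectral_sum.
by apply: eq_bigr => i _; rewrite to_fixedK.
Qed.

End fixed_positive.

Section words.
Context (R : realType) (A : cstarAlgType R) (g : circle_action A).
Context (p : nat) (u : 'I_p -> A).

Definition prodw (s : seq 'I_p) : A := \prod_(i <- s) u i.

Lemma wordE n (w : n.-tuple 'I_p) : word u w = prodw w.
Proof. by rewrite /prodw big_tuple. Qed.

Lemma prodw_cons i s : prodw (i :: s) = u i * prodw s.
Proof. by rewrite /prodw big_cons. Qed.

Lemma prodw_cat s t : prodw (s ++ t) = prodw s * prodw t.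
Proof. by rewrite /prodw big_cat. Qed.

Definition nonzero_words n : R := \sum_(w : n.-tuple 'I_p) (prodw w != 0)%:R.
(** By the C*-identity these are the sums that define [h_T]. *)
Definition norm_words n : R := \sum_(w : n.-tuple 'I_p) cnorm (prodw w) ^+ 2.

Lemma nonzero_words_submul m n :
  nonzero_words (m + n) <= nonzero_words m * nonzero_words n.
Proof.
rewrite /nonzero_words (sum_tupleD m n (fun s => (prodw s != 0)%:R)) mulr_suml.
apply: ler_sum => v _; rewrite mulr_sumr; apply: ler_sum => w _.
rewrite -natrM ler_nat mulnb prodw_cat.
have [->|] := eqVneq (prodw v) 0; first by rewrite mul0r eqxx.
by have [->|] := eqVneq (prodw w) 0; [rewrite mulr0 eqxx|rewrite leq_b1].
Qed.

Lemma norm_words_submul m n :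
  norm_words (m + n) <= norm_words m * norm_words n.
Proof.
rewrite /norm_words (sum_tupleD m n (fun s => cnorm (prodw s) ^+ 2)) mulr_suml.
apply: ler_sum => v _; rewrite mulr_sumr; apply: ler_sum => w _.
rewrite prodw_cat -exprMn ler_sqr ?nnegrE ?mulr_ge0 ?cnorm_ge0//.
exact: cnormM_le.
Qed.

Context (k : int) (uk : forall i, spectral_subspace g k (u i)).
Hypothesis uu : \sum_(i < p) star (u i) * u i = 1.

Lemma prodw_spectral s : spectral_subspace g (k *+ size s) (prodw s).
Proof.
elim: s => [|i s IH]; first by rewrite /prodw big_nil; exact: spectral1.
by rewrite prodw_cons /= mulrS; exact: spectralM.
Qed.

Lemma prodw_fixed s : spectral_subspace g 0 (prodw s * star (prodw s)).
Proof.
rewrite -[X in X * _]mulr1; apply: conj_spectral; first exact: prodw_spectral.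
  exact: spectral1.
exact: prodw_spectral.
Qed.

Lemma prodw_sum1 n : \sum_(w : n.-tuple 'I_p) star (prodw w) * prodw w = 1.
Proof.
elim: n => [|n IH].
  rewrite (sum_tuple0 (fun s => star (prodw s) * prodw s)) /prodw big_nil.
  by rewrite mulr1 star1.
rewrite (sum_tupleS n (fun s => star (prodw s) * prodw s)) exchange_big -IH.
apply: eq_bigr => w _; rewrite -[X in _ = X * _]mulr1 -uu mulr_sumr mulr_suml.
by apply: eq_bigr => i _; rewrite prodw_cons starM !mulrA.
Qed.

Lemma prodw_le1 n (w : n.-tuple 'I_p) : cnorm (prodw w) <= 1.
Proof. exact: (sum_star_le1 w (prodw_sum1 n)). Qed.

Lemma norm_words_le n : norm_words n <= nonzero_words n.
Proof.
apply: ler_sum => w _; have [->|_] := eqVneq (prodw w) 0.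
  by rewrite cnorm0 expr0n.
by rewrite expr_le1// ?cnorm_ge0// prodw_le1.
Qed.

Hypothesis A1 : (1 : A) != 0.

Lemma norm_words_ge1 n : 1 <= norm_words n.
Proof.
have <- : cnorm (1 : A) = 1.
  have := cnorm_starM (1 : A); rewrite star1 mulr1 expr2 => /esym/eqP.
  by rewrite -{3}[cnorm 1]mul1r -subr_eq0 -mulrBl mulf_eq0 subr_eq0 [X in _ ||
    X]gt_eqF ?cnorm_gt0// orbF => /eqP.
rewrite -(prodw_sum1 n) (le_trans (cnorm_sum _ _))//.
by apply: ler_sum => w _; rewrite cnorm_starM.
Qed.

Lemma nonzero_words_ge1 n : 1 <= nonzero_words n.
Proof. exact: le_trans (norm_words_ge1 n) (norm_words_le n). Qed.

(** The rate h, a genuine limit by Fekete's lemma; [subshift'_entropy] identifies it with the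
    entropy of the subshift. *)
Definition entropy : R := limn (fun n : nat => n%:R^-1 * ln (nonzero_words n)).

Lemma entropy_cvg : (n%:R^-1 * ln (nonzero_words n)) @[n --> \oo] --> entropy.
Proof.
apply: submultiplicative_cvg; [exact: nonzero_words_ge1|exact:
  nonzero_words_submul].
Qed.

Context (tau : fixed_algebra g -> R[i]^o).
Hypothesis tau_state : is_state tau.

(** This is D^n(tau)(1), by [state_trace_words]. *)
Definition trace_words n : R :=
  complex.Re (tau (to_fixed g (\sum_(w : n.-tuple 'I_p) prodw w * star (prodw w)))).

Let tauD a b : tau (a + b) = tau a + tau b.
Proof. by have [tl _ _] := tau_state; rewrite -{1}[a]scale1r tl scale1r. Qed.

Let tau0 : tau 0 = 0.
Proof. by apply: (addrI (tau 0)); rewrite -tauD !addr0. Qed.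

Let ReD : {morph (@complex.Re R) : x y / x + y}.
Proof. by move=> [a b] [c d]. Qed.

Lemma trace_wordsE n : trace_words n =
  \sum_(w : n.-tuple 'I_p) complex.Re (tau (to_fixed g (prodw w * star (prodw w)))).
Proof.
rewrite /trace_words to_fixed_sum; last by move=> w; exact: prodw_fixed.
by rewrite (big_morph _ tauD tau0) (big_morph _ ReD (erefl : complex.Re (0 :
  R[i]) = 0)).
Qed.

Lemma state_pos a : pos a -> 0 <= complex.Re (tau a).
Proof.
move=> [b sb ->]; have [_ /(_ b)] := tau_state.
by rewrite sb lecE => /andP[].
Qed.

Lemma state_bound a : modulus (tau a) <= cnorm a.
Proof.
have [tl tp t1] := tau_state.
have := @positive_functional_bound _ _ tau (conj tl tp) a.
by rewrite t1 mul1r.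
Qed.

Lemma tau_prodw_ge0 s : 0 <= complex.Re (tau (to_fixed g (prodw s * star (prodw
  s)))).
Proof.
apply/state_pos/pos_fixed; rewrite to_fixedK; last exact: prodw_fixed.
by rewrite -{1}[prodw s]starK; exact: pos_starM.
Qed.

Lemma trace_words_le n : trace_words n <= norm_words n.
Proof.
rewrite trace_wordsE; apply: ler_sum => w _.
rewrite (le_trans (ler_norm _))// (le_trans (modulusRe _))//.
rewrite (le_trans (state_bound _))// -cnorm_mul_star.
by rewrite -[leRHS](congr1 (@cnorm _ A) (to_fixedK (prodw_fixed w))).
Qed.

Lemma mu_ge0 n : 0 <= mu u tau n.
Proof.
(* The w^* w sum to 1, so some word is nonzero and the minimum is over a nonempty set. *)
have [w0 w0P] : [set w : n.-tuple 'I_p | word u w != 0] !=set0.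
  apply: contrapT => H; move: A1; rewrite -(prodw_sum1 n) big1 ?eqxx// => w _.
  have [->|w0] := eqVneq (prodw w) 0; first by rewrite mulr0.
  by exfalso; apply: H; exists w; rewrite /= wordE.
rewrite /mu; have [|w _ [-> _]] := @finite_minimum R _ [set w :
  n.-tuple 'I_p | word u w != 0]
  (fun w => complex.Re (tau (to_fixed g (word u w * star (word u w))))).
  by exists w0.
by rewrite wordE tau_prodw_ge0.
Qed.

Lemma mu_nonzero_words n : mu u tau n * nonzero_words n <= trace_words n.
Proof.
rewrite trace_wordsE mulr_sumr; apply: ler_sum => w _.
have [w0|w0] := eqVneq (prodw w) 0; first by rewrite mulr0 tau_prodw_ge0.
rewrite mulr1 /mu.
have [|v _ [-> vmin]] := @finite_minimum R _ [set w : n.-tuple 'I_p | word u w != 0]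
  (fun w => complex.Re (tau (to_fixed g (word u w * star (word u w))))).
  by exists w; rewrite /= wordE.
by rewrite -wordE; apply: vmin; rewrite /= wordE.
Qed.

Hypothesis mu1 : limn_esup (fun n : nat => (mu u tau n `^ n%:R^-1)%:E) = 1%E.

(** Half of e pays for the decay of [mu], the other half for the distance of the rate of
    [nonzero_words] to its limit. *)
Lemma trace_words_often (e : R) : 0 < e -> forall N : nat, exists2 n : nat,
  (N <= n)%N & (0 < n)%N /\ expR (n%:R * (entropy - e)) <= trace_words n.
Proof.
move=> e0 N.
have e2 : 0 < e / 2 by rewrite divr_gt0.
have [N1 N1P] := cvgn_within entropy_cvg e2.
(* Chosen so that 1 minus this number is exp(- e / 2), whose n-th power then bounds [mu] from
   below. *)
have e'0 : 0 < 1 - expR (- (e / 2)).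
  by rewrite subr_gt0 -[ltRHS]expR0 ltr_expR oppr_lt0.
have [n] := limn_esup_often mu1 e'0 (maxn N (maxn N1 1)).
rewrite !geq_max => /and3P[Nn N1n n0]; rewrite subKr => mun.
exists n => //; split=> //.
have nR : 0 < n%:R :> R by rewrite ltr0n.
have le_mu : expR (n%:R * - (e / 2)) <= mu u tau n.
  have -> : mu u tau n = (mu u tau n `^ n%:R^-1) ^+ n.
    rewrite -powR_mulrn ?powR_ge0// -powRrM mulVf ?gt_eqF// powRr1//.
    exact: mu_ge0.
  by rewrite expRM_natl lerXn2r ?nnegrE ?expR_ge0 ?powR_ge0 ?ltW.
have N0 : 0 < nonzero_words n by rewrite (lt_le_trans ltr01)// nonzero_words_ge1.
have le_N : expR (n%:R * (entropy - e / 2)) <= nonzero_words n.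
  rewrite -[leRHS]lnK ?posrE// ler_expR -ler_pdivlMl//.
  by have /andP[] := N1P n N1n.
apply: le_trans (mu_nonzero_words n).
have -> : n%:R * (entropy - e) = n%:R * - (e / 2) + n%:R * (entropy - e / 2).
  by rewrite -mulrDr; congr (_ * _); lra.
by rewrite expRD ler_pM// expR_ge0.
Qed.

(** Submultiplicativity already gives a limit, at most [entropy]; the lower bound on infinitely many
    n then suffices to identify it. *)
Lemma norm_words_cvg : (n%:R^-1 * ln (norm_words n)) @[n --> \oo] --> entropy.
Proof.
have nc : cvgn (fun n : nat => n%:R^-1 * ln (norm_words n)).
  by apply: submultiplicative_cvg; [exact: norm_words_ge1|exact: norm_words_submul].
suff -> : entropy = limn (fun n : nat => n%:R^-1 * ln (norm_words n)) by [].
have nw0 n : 0 < norm_words n by rewrite (lt_le_trans ltr01)// norm_words_ge1.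
apply/eqP; rewrite eq_le; apply/andP; split; last first.
  apply: ler_lim => //; first by apply/cvg_ex; exists entropy; exact: entropy_cvg.
  near=> n; rewrite ler_wpM2l ?invr_ge0// ler_ln ?posrE ?norm_words_le//.
  by rewrite (lt_le_trans ltr01)// nonzero_words_ge1.
apply/ler_addgt0Pr => e e0; have e2 : 0 < e / 2 by rewrite divr_gt0.
have [N NP] := cvgn_within nc e2.
have [n Nn [n0 nP]] := trace_words_often e2 N.
have nR : 0 < n%:R :> R by rewrite ltr0n.
have /andP[_ le1] := NP n Nn.
have : entropy - e / 2 <= n%:R^-1 * ln (norm_words n).
  rewrite ler_pdivlMl// -ler_expR lnK ?posrE//.
  exact: le_trans nP (trace_words_le n).
by move=> /le_trans/(_ le1); lra.
Unshelve. all: by end_near. Qed.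

Lemma trace_words_limsup :
  limn_esup (fun n : nat => (n%:R^-1 * ln (trace_words n))%:E) = entropy%:E.
Proof.
apply: limn_esup_eq => e e0.
  have [N NP] := cvgn_within norm_words_cvg e0.
  exists N => n Nn; have /andP[_] := NP n Nn.
  apply: le_trans; rewrite ler_wpM2l ?invr_ge0//.
  have nw0 : 0 < norm_words n by rewrite (lt_le_trans ltr01)// norm_words_ge1.
  (* If [trace_words n] vanishes, its [ln] is 0 by convention, which is still at most
     [ln (norm_words n)]. *)
  have [t0|t0] := ltP 0 (trace_words n);
    first by rewrite ler_ln ?posrE// trace_words_le.
  by rewrite ln0// ln_ge0// norm_words_ge1.
move=> N; have [n Nn [n0 nP]] := trace_words_often e0 N.
exists n => //; have nR : 0 < n%:R :> R by rewrite ltr0n.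
by rewrite ler_pdivlMl// -ler_expR lnK// posrE (lt_le_trans _ nP)// expR_gt0.
Qed.

Lemma norm_words_bound (r : R) : expR entropy < r ->
  exists2 C : R, 0 < C & forall n, norm_words n <= C * r ^+ n.
Proof.
move=> hr; have r0 : 0 < r by rewrite (lt_trans _ hr)// expR_gt0.
have e0 : 0 < ln r - entropy by rewrite subr_gt0 -[entropy]expRK ltr_ln ?posrE
  ?expR_gt0.
have [N NP] := cvgn_within norm_words_cvg e0.
have nw0 n : 0 < norm_words n by rewrite (lt_le_trans ltr01)// norm_words_ge1.
(* The sum absorbs the n below N, where the asymptotic bound says nothing; the 1 serves for all
   others. *)
pose C := 1 + \sum_(n < N) norm_words n / r ^+ n.
have C1 : 1 <= C.
  by rewrite lerDl sumr_ge0// => n _; rewrite divr_ge0 ?exprn_ge0 ?ltW.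
exists C; first by rewrite (lt_le_trans ltr01).
move=> n; have rn : 0 < r ^+ n by rewrite exprn_gt0.
case: (ltnP n N) => nN.
  rewrite -ler_pdivrMr//.
  rewrite /C (bigD1 (Ordinal nN))//= addrCA lerDl addr_ge0// sumr_ge0// => i _.
  by rewrite divr_ge0 ?exprn_ge0 ?ltW.
apply: (@le_trans _ _ (r ^+ n)); last by rewrite ler_peMl// ltW.
(* At n = 0 the factor [n%:R^-1] is 0 and the rate carries no information. *)
have [->|n0] := posnP n.
  by rewrite /norm_words (sum_tuple0 (fun s =>
    cnorm (prodw s) ^+ 2)) /prodw big_nil expr0 expr_le1// ?cnorm_ge0// cnorm1_le.
have /andP[_] := NP n nN.
rewrite addrC subrK ler_pdivrMl ?ltr0n// mulr_natl -lnXn//.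
by rewrite ler_ln ?posrE.
Qed.

End words.

(** * The spectrum of the dual operator *)

Section trace_spectrum.
Context (R : realType) (B : preCStarAlgType R).
Notation V := (trace_space B).

Lemma trace_bounded_continuous (S : {linear V -> V}) :
  continuous S <-> exists M : R, forall f, trace_norm (S f) <= M * trace_norm f.
Proof.
split=> [/linear_bounded_continuous/linear_boundedP/pinfty_ex_gt0[M M0 SM]|[M SM]].
  exists (complex.Re M) => f.
  have ME : M = (complex.Re M)%:C%C by rewrite RRe_real// gtr0_real.
  by rewrite -lecR rmorphM /= -ME; exact: SM.
apply/linear_bounded_continuous/linear_boundedP.
exists (M%:C%C); split; first by apply/complex_realP; exists M.
move=> r Mr f.
apply: (@le_trans _ _ (M%:C%C * `|f|)); last by rewrite ler_wpM2r// ltW.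
by rewrite /Num.norm /= -rmorphM lecR.
Qed.

Lemma spectrumPn (T : V -> V) (l : R[i]) : ~ spectrum T l <-> exists S : V -> V,
  [/\ linear S, exists M : R, forall f, trace_norm (S f) <= M * trace_norm f,
      forall f, S (T f - l *: f) = f & forall f, T (S f) - l *: S f = f].
Proof.
split=> [/contrapT[S [Sc TS ST]]|[S [Sl Sb TS ST]] H].
  exists S; split=> //; first by move=> c a b; rewrite linearP.
  exact/trace_bounded_continuous.
apply: H; pose SM := GRing.isLinear.Build _ _ _ _ S Sl.
pose S' : {linear V -> V} := HB.pack S SM.
by exists S'; split=> //; exact/trace_bounded_continuous.
Qed.

End trace_spectrum.

Section complete_series.
Context (R : realType) (A : cstarAlgType R).

Lemma tends_series (x : nat -> A) (b : nat -> R) : (forall n, cnorm (x n) <= b n) ->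
  cvgn (series b) -> exists l, tends (fun K => \sum_(0 <= n < K) x n) l.
Proof.
move=> xb; apply: tends_cauchy => n k; elim: k => [|k IH].
  by rewrite addn0 !subrr cnorm0.
rewrite addnS /series /= !big_nat_recr//= [X in cnorm X]addrAC [leRHS]addrAC.
by rewrite (le_trans (cnormD_le _ _))// lerD.
Qed.

Lemma trace_lim0 (f : trace_space A) (u : nat -> A) l :
  (forall n, f (u n) = 0) -> tends u l -> f l = 0.
Proof.
move=> fu ul; apply: modulus0_eq0; apply/eqP; rewrite eq_le modulus_ge0 andbT.
apply/ler_addgt0Pr => e e0; rewrite add0r.
have M0 : 0 < trace_norm f + 1 by rewrite ltr_wpDl// trace_norm_ge0.
have [N /(_ N (leqnn _)) NP] := (tendsP u l).1 ul (e / (trace_norm f + 1))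
  (divr_gt0 e0 M0).
have -> : f l = - f (u N - l) by rewrite traceD traceN fu add0r opprK.
rewrite modulusN (le_trans (trace_norm_ub _ _))//.
rewrite (le_trans (ler_wpM2l (trace_norm_ge0 _) (ltW NP)))//.
rewrite mulrA ler_pdivrMr// mulrC ler_pM2l//.
by rewrite lerDl.
Qed.

End complete_series.

Section resolvent_growth.
Context (R : realType).

(* Under these hypotheses q(n,0) is bounded by a multiple of (r - t)^n: the
   generating functions F(n) = sum_k t^k q(n,k+1) satisfy
   F(n+1) = (r - t) F(n) - q(n,0). *)
Lemma resolvent_growth (q : nat -> nat -> R) (a : nat -> R) (r t m : R) :
  (forall n k, 0 <= q n k) ->
  (forall n k, q n.+1 k.+1 = r * q n k.+1 - q n k) ->
  (forall n k, q n k <= a n * m ^+ k) -> 0 <= m ->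
  0 <= t -> t * m <= 2^-1 -> t <= r ->
  exists C, forall n, q n 0%N <= C * (r - t) ^+ n.
Proof.
move=> q0 qS qa m0 t0 tm tr.
have a0 n : 0 <= a n by have := qa n 0%N; rewrite mulr1; exact: le_trans.
pose F n K := \sum_(k < K) t ^+ k * q n k.+1.
(* Truncation at K leaves the boundary term t^K q(n,K), which is at most a(n) 2^-K because t m <=
   1/2. *)
have FS n K : F n.+1 K = (r - t) * F n K - q n 0%N + t ^+ K * q n K.
  elim: K => [|K IH]; first by rewrite /F !big_ord0 mulr0 mul1r sub0r addNr.
  rewrite /F !big_ord_recr /= -/(F n.+1 K) -/(F n K) IH qS exprS.
  by ring.
have half0 K : 0 <= (2^-1 : R) ^+ K by rewrite exprn_ge0// invr_ge0.
have tmK K : t ^+ K * m ^+ K <= 2^-1 ^+ K.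
  by rewrite -exprMn lerXn2r// nnegrE ?mulr_ge0// invr_ge0.
have F0 K : F 0%N K <= 2 * a 0%N * m.
  (* The k-th term is at most a(0) m 2^-k; the exact geometric partial sum is the bound that passes
     through the induction. *)
  apply: (@le_trans _ _ (2 * a 0%N * m * (1 - 2^-1 ^+ K))); last first.
    by rewrite ler_piMr ?mulr_ge0// gerBl.
  elim: K => [|K IH]; first by rewrite /F big_ord0 subrr mulr0.
  rewrite /F big_ord_recr /= -/(F 0%N K).
  have le1 : t ^+ K * q 0%N K.+1 <= a 0%N * m * 2^-1 ^+ K.
    apply: (@le_trans _ _ (t ^+ K * (a 0%N * m ^+ K.+1))).
      by rewrite ler_wpM2l// exprn_ge0.
    have -> : t ^+ K * (a 0%N * m ^+ K.+1) = a 0%N * m * (t ^+ K * m ^+ K).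
      by rewrite exprS; ring.
    by rewrite ler_wpM2l// mulr_ge0.
  apply: (le_trans (lerD IH le1)); rewrite exprS.
  by rewrite [leLHS](_ : _ = 2 * a 0%N * m * (1 - 2^-1 * 2^-1 ^+ K))//; field.
have z0 : 0 <= r - t by rewrite subr_ge0.
(* The error b may depend on n: its factor 2^-K removes it as K tends to infinity. *)
have claim n : exists2 b : R, 0 <= b & forall K,
    F n K <= (r - t) ^+ n * (2 * a 0%N * m) + b * 2^-1 ^+ K.
  elim: n => [|n [b b0 IH]].
    by exists 0 => // K; rewrite mul0r addr0 mul1r.
  exists ((r - t) * b + a n); first by rewrite addr_ge0// mulr_ge0.
  move=> K; rewrite FS.
  have le1 : t ^+ K * q n K <= a n * 2^-1 ^+ K.
    apply: (@le_trans _ _ (t ^+ K * (a n * m ^+ K))).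
      by rewrite ler_wpM2l// exprn_ge0.
    by rewrite mulrCA ler_wpM2l.
  have := ler_wpM2l z0 (IH K); have := q0 n 0%N; rewrite exprS.
  move: le1; set P := (r - t) ^+ n * _; set h := 2^-1 ^+ K.
  have -> : (r - t) * (r - t) ^+ n * (2 * a 0%N * m) = (r - t) * P by rewrite /P;
    ring.
  move: (F n K) (t ^+ K * q n K) (q n 0%N) => x1 x2 x3.
  rewrite [(r - t) * (_ + _)]mulrDr [((r - t) * b + _) * _]mulrDl mulrA.
  lra.
exists ((r - t) * (2 * a 0%N * m)) => n; have [b b0 bP] := claim n.
(* As F(n+1) is nonnegative, the recursion bounds q(n,0) by (r - t) F(n) up to the boundary term. *)
have Fpos K : 0 <= F n.+1 K by rewrite sumr_ge0// => k _;
  rewrite mulr_ge0// exprn_ge0.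
have le K : q n 0%N <= (r - t) * (2 * a 0%N * m) * (r - t) ^+ n + ((r - t) * b +
  a n) * 2^-1 ^+ K.
  have := Fpos K; rewrite FS.
  have le1 : t ^+ K * q n K <= a n * 2^-1 ^+ K.
    apply: (@le_trans _ _ (t ^+ K * (a n * m ^+ K))).
      by rewrite ler_wpM2l// exprn_ge0.
    by rewrite mulrCA ler_wpM2l.
  have := ler_wpM2l z0 (bP K).
  have -> : (r - t) * (2 * a 0%N * m) * (r - t) ^+ n = (r - t) * ((r - t) ^+ n *
    (2 * a 0%N * m)) by ring.
  rewrite [(r - t) * (_ + _ * _)]mulrDr [((r - t) * b + _) * _]mulrDl mulrA.
  move: le1; move: ((r - t) * F n K) (t ^+ K * q n K) => x1 x2.
  lra.
have c0 : (fun K : nat => (r - t) * (2 * a 0%N * m) * (r - t) ^+ n + ((r - t) * b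
  + a n) * 2^-1 ^+ K) @ \oo -->
    (r - t) * (2 * a 0%N * m) * (r - t) ^+ n.
  rewrite -[X in _ --> X]addr0; apply: cvgD; first exact: cvg_cst.
  by apply: cvg_geometric; rewrite ger0_norm ?invr_ge0// invf_lt1// ltr1n.
rewrite -(cvg_lim _ c0)//; apply: limr_ge; first by apply/cvg_ex; eexists;
  exact: c0.
by near=> K.
Unshelve. all: by end_near. Qed.

End resolvent_growth.

Section trace_operator.
Context (R : realType) (A : cstarAlgType R) (g : circle_action A).
Context (p : nat) (u : 'I_p -> A) (k : int).
Hypothesis uk : forall i, spectral_subspace g k (u i).
Hypothesis uu : \sum_(i < p) star (u i) * u i = 1.
Notation B := (fixed_algebra g).

Definition sandwich (a : B) : B := to_fixed g (\sum_(i < p) u i * (a :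
  A) * star (u i)).

Let sandwich_spectral i j (a : B) : spectral_subspace g 0 (u i * (a :
  A) * star (u j)).
Proof. by apply: conj_spectral => //; exact: spectral_fixed. Qed.

Lemma sandwichE (a : B) : sandwich a = \sum_(i < p) u i * (a : A) * star (u i) :> A.
Proof. by rewrite to_fixedK//; apply: spectral_sum. Qed.

Lemma sandwich_linear : linear sandwich.
Proof.
move=> c a b; apply: val_inj; rewrite /= !sandwichE scaler_sumr -big_split.
by apply: eq_bigr => i _ /=; rewrite mulrDr mulrDl -scalerAr -scalerAl.
Qed.

Let sandwichD : {morph sandwich : a b / a + b}.
Proof. by move=> a b; rewrite -{1}[a]scale1r sandwich_linear scale1r. Qed.

Let sandwich0 : sandwich 0 = 0.
Proof. by apply: (addrI (sandwich 0)); rewrite -sandwichD !addr0. Qed.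

Let sandwichZ (c : R[i]) a : sandwich (c *: a) = c *: sandwich a.
Proof. by rewrite -[c *: a]addr0 sandwich_linear sandwich0 addr0. Qed.

Let sandwichN : {morph sandwich : a / - a}.
Proof. by move=> a; rewrite -scaleN1r sandwichZ scaleN1r. Qed.

Lemma iter_sandwich n (a : B) : iter n sandwich a =
  \sum_(w : n.-tuple 'I_p) prodw u w * (a : A) * star (prodw u w) :> A.
Proof.
elim: n => [|n IH].
  rewrite (sum_tuple0 (fun s => prodw u s * (a : A) * star (prodw u s))).
  by rewrite /prodw big_nil star1 mul1r mulr1.
rewrite iterS sandwichE IH (sum_tupleS n (fun s =>
  prodw u s * (a : A) * star (prodw u s))).
apply: eq_bigr => i _; rewrite mulr_sumr mulr_suml; apply: eq_bigr => w _.
by rewrite prodw_cons starM !mulrA.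
Qed.

Lemma iter_sandwich_norm n (a : B) :
  cnorm (iter n sandwich a) <= norm_words u n * cnorm a.
Proof.
rewrite -[cnorm (iter _ _ _)]/(cnorm (iter n sandwich a : A)) iter_sandwich.
rewrite (le_trans (cnorm_sum _ _))// mulr_suml; apply: ler_sum => w _.
rewrite (le_trans (cnormM_le _ _))// cnorm_star expr2 mulrAC.
by rewrite ler_wpM2r ?cnorm_ge0// cnormM_le.
Qed.

Lemma norm_words1 (a : B) : cnorm (sandwich a) <= norm_words u 1 * cnorm a.
Proof. exact: (iter_sandwich_norm 1). Qed.

Let elt i j (a : B) : B := to_fixed g (u i * (a : A) * star (u j)).

(** Insert sum_j u_j^* u_j = 1 between a and b: the matrix with entries u_i a u_j^* is
    multiplicative in a, and [sandwich] is the sum of its diagonal. Composition with [sandwich]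
    therefore preserves traces. *)
Let sandwichM a b : sandwich (a * b) = \sum_(i < p) \sum_(j < p) elt i j a * elt
  j i b.
Proof.
apply: val_inj; rewrite /= sandwichE val_sum; apply: eq_bigr => i _.
rewrite val_sum /= -[in LHS](mulr1 (a : A)) -uu mulr_sumr !mulr_suml.
rewrite mulr_sumr mulr_suml; apply: eq_bigr => j _.
by rewrite !to_fixedK// !mulrA.
Qed.

Fact dual_traceP (f : trace_space B) :
  (fun a => f (sandwich a)) \in @bounded_traces R B.
Proof.
rewrite unfold_in; apply/asboolP; split.
- by move=> c a b; rewrite sandwich_linear trace_linear.
- exists (trace_norm f * norm_words u 1) => a.
  rewrite (le_trans (trace_norm_ub _ _))// -mulrA ler_wpM2l ?trace_norm_ge0//.
  exact: norm_words1.
- move=> a b; rewrite !sandwichM !trace_sum.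
  under eq_bigr do rewrite trace_sum.
  rewrite exchange_big; apply: eq_bigr => j _; rewrite trace_sum.
  by apply: eq_bigr => i _; exact: trace_tracial.
Qed.

Definition dual_trace (f : trace_space B) :
  trace_space B := TraceFunctional (dual_traceP f).

Notation D := dual_trace.

Lemma dual_traceE f a : D f a = f (sandwich a). Proof. by []. Qed.

Lemma iter_dual_trace n f a : iter n D f a = f (iter n sandwich a).
Proof.
elim: n a => [//|n IH] a; rewrite iterS dual_traceE IH.
by rewrite -iterSr.
Qed.

Lemma dual_trace_linear : linear D.
Proof. by move=> c f1 f2; apply: traceP. Qed.

Lemma dual_trace_norm n f :
  trace_norm (iter n D f) <= norm_words u n * trace_norm f.
Proof.
apply: trace_norm_le => a a1; rewrite iter_dual_trace.
rewrite (le_trans (trace_norm_ub _ _))// mulrC ler_wpM2r ?trace_norm_ge0//.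
rewrite (le_trans (iter_sandwich_norm _ _))// ler_piMr//.
by rewrite sumr_ge0// => w _; rewrite sqr_ge0.
Qed.

Lemma dual_trace_positive f : positive_trace f -> positive_trace (D f).
Proof.
move=> fp a; rewrite dual_traceE; apply: positive_trace_pos => //; apply: pos_fixed.
rewrite sandwichE; apply: pos_sum => i.
have <- : star ((a : A) * star (u i)) * ((a :
  A) * star (u i)) = u i * (star a * a : A) * star (u i).
  by rewrite starM starK -!mulrA.
exact: pos_starM.
Qed.

Context (rho : R).
Hypothesis rho0 : 0 < rho.
Hypothesis growth : forall r, rho < r ->
  exists2 C : R, 0 < C & forall n, norm_words u n <= C * r ^+ n.

(** The Neumann series G = sum_n l^(-n-1) [sandwich]^n is summed pointwise in the complete algebra
    A^0 and then dualised: the inverse of D - l sends f to the composite of - f with G. *)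
Lemma dual_trace_resolvent (l : R[i]) : rho < modulus l -> ~ spectrum D l.
Proof.
move=> rl.
have ml : 0 < modulus l by exact: lt_trans rl.
have l0 : l != 0 by rewrite -modulus_gt0.
have [r rhor rl'] : exists2 r, rho < r & r < modulus l.
  by exists ((rho + modulus l) / 2); rewrite ?midf_lt.
have [C C0 CP] := growth rhor.
have r0 : 0 < r by exact: lt_trans rhor.
have rl1 : 0 < r / modulus l < 1.
  by rewrite divr_gt0//= ltr_pdivrMr// mul1r.
have nrl1 : `|r / modulus l| < 1 by case/andP: rl1 => h1 h2; rewrite gtr0_norm.
pose x n (a : B) : B := l^-1 ^+ n.+1 *: iter n sandwich a.
pose s K a := \sum_(0 <= n < K) x n a.
have xb n a : cnorm (x n a) <= geometric (C / modulus l * cnorm a) (r / modulus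
  l) n.
  rewrite cnormZ.
  have -> : modulus (l^-1 ^+ n.+1) = (modulus l)^-1 ^+ n.+1.
    elim: n.+1 => [|m IH]; last by rewrite !exprS modulusM modulusV IH.
    by rewrite !expr0 -[1]/(1%:C%C) modulusR normr1.
  apply: (@le_trans _ _ ((modulus l)^-1 ^+ n.+1 * (C * r ^+ n * cnorm a))).
    rewrite ler_wpM2l ?exprn_ge0 ?invr_ge0 ?modulus_ge0//.
    by rewrite (le_trans (iter_sandwich_norm _ _))// ler_wpM2r ?cnorm_ge0.
  by rewrite le_eqVlt; apply/orP; left; apply/eqP;
    rewrite /geometric /= exprMn exprS; ring.
have /choice[G GP] : forall a, exists b, tends (s^~ a) b.
  move=> a; apply: tends_series (xb ^~ a) _; exact: is_cvg_geometric_series.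
have xl n : linear (x n).
  move=> c a b; rewrite /x.
  have -> : iter n sandwich (c *: a + b) = c *: iter n sandwich a + iter n
    sandwich b.
    by elim: n => [//|n IH]; rewrite !iterS IH sandwich_linear.
  by rewrite scalerDr !scalerA mulrC.
have sl K : linear (s K).
  move=> c a b; rewrite /s scaler_sumr -big_split /=.
  by apply: eq_bigr => n _; exact: xl.
have Gl : linear G.
  move=> c a b; apply: (tends_unique (GP _)).
  under eq_fun do rewrite sl.
  by apply: tendsD => //; exact: tendsZ.
pose M := C / modulus l * (1 - r / modulus l)^-1.
have Gb a : cnorm (G a) <= M * cnorm a.
  apply: tends_norm_le (GP a) => K; rewrite (le_trans (cnorm_sum _ _))//.
  apply: (@le_trans _ _ (series (geometric (C / modulus l * cnorm a) (r / modulus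
    l)) K)).
    by apply: ler_sum => n _; exact: xb.
  rewrite /M [leRHS]mulrAC; apply: geometric_le_lim => //.
    by rewrite mulr_ge0 ?cnorm_ge0// divr_ge0// ltW.
  by case/andP: rl1.
have sS K a : s K (sandwich a) = l *: s K.+1 a - a.
  rewrite /s scaler_sumr big_nat_recl// /x /= expr1 scalerA mulfV//
    scale1r addrC addKr.
  apply: eq_bigr => n _; rewrite -iterS iterSr scalerA; congr (_ *: _).
  by rewrite [in RHS]exprS mulrA mulfV// mul1r.
have sS' K a : sandwich (s K a) = s K (sandwich a).
  rewrite /s (big_morph _ sandwichD sandwich0); apply: eq_bigr => n _.
  by rewrite /x sandwichZ -iterS iterSr.
have GS a : G (sandwich a) = l *: G a - a.
  apply: (tends_unique (GP _)); under eq_fun do rewrite sS.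
  apply: tendsB; last exact: tends_cst.
  by apply: tendsZ; have := tends_shift 1 (GP a); under eq_fun do rewrite addn1.
have SG a : sandwich (G a) = l *: G a - a.
  rewrite -GS; apply: (@tends_unique _ _ (fun K => s K (sandwich a))) => //.
  apply: (@tends_le _ _ _ _ (fun K => norm_words u 1 * cnorm (s K a - G a))).
    move=> K; rewrite -sS'; apply: le_trans (norm_words1 _).
    by rewrite sandwichD sandwichN.
  by rewrite -[X in _ --> X](mulr0 (norm_words u 1)); apply: cvgM;
    [exact: cvg_cst|exact: GP].
have fG (f : trace_space B) : (fun a => - f (G a)) \in @bounded_traces R B.
  rewrite unfold_in; apply/asboolP; split.
  - by move=> c a b; rewrite Gl trace_linear opprD scalerN.
  - exists (trace_norm f * M) => a; rewrite modulusN.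
    rewrite (le_trans (trace_norm_ub _ _))// -mulrA ler_wpM2l ?trace_norm_ge0//.
  - move=> a b; congr (- _); apply/eqP; rewrite -subr_eq0 -traceN -traceD;
    apply/eqP.
    (* Each partial sum of G(ab) - G(ba) is killed by f, because every D^n f is a trace. *)
    apply: (@trace_lim0 _ _ _ (fun K => s K (a * b) - s K (b * a)));
      last exact: tendsB.
    move=> K; rewrite /s -sumrB trace_sum big1// => n _.
    rewrite -scalerBr traceZ traceD traceN -!iter_dual_trace trace_tracial subrr.
    by rewrite mulr0.
apply/spectrumPn; exists (fun f => TraceFunctional (fG f)); split.
- move=> c f1 f2; apply: traceP => a.
  change (- (c * f1 (G a) + f2 (G a)) = c * - f1 (G a) + - f2 (G a)).
  by rewrite opprD mulrN.
- exists M => f; apply: trace_norm_le => a a1 /=; rewrite modulusN.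
  rewrite (le_trans (trace_norm_ub _ _))// mulrC ler_wpM2r ?trace_norm_ge0//.
  rewrite (le_trans (Gb _))// ler_piMr// /M mulr_ge0 ?divr_ge0 ?invr_ge0// ltW//.
  by rewrite subr_gt0; case/andP: rl1.
- move=> f; apply: traceP => a.
  change (- (f (sandwich (G a)) - l * f (G a)) = f a).
  by rewrite SG traceD traceN traceZ addrAC subrr sub0r opprK.
- move=> f; apply: traceP => a.
  change (- f (G (sandwich a)) - l * - f (G a) = f a).
  by rewrite GS traceD traceN traceZ opprB mulrN opprK subrK.
Qed.

(** Suppose that S inverts D - rho, and let P = (r - D)^-1 with r = rho + eta. The series sum_k (2
    eta)^k P^(k+1) is the resolvent at r - 2 eta = rho - eta, and its terms are positive;
    [resolvent_growth] draws from it a growth rate below rho for f0, contrary to [low]. *)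
Lemma dual_trace_spectral_radius (f0 : trace_space B) : positive_trace f0 ->
  (forall z, 0 < z -> z < rho -> ~ exists C, forall n,
     complex.Re (f0 (iter n sandwich 1)) <= C * z ^+ n) ->
  spectrum D rho%:C%C.
Proof.
move=> f0p low; apply: contrapT => /spectrumPn[S [Sl [M0 SM0] DS SD]].
pose M : R := `|M0| + 1.
have M_gt0 : 0 < M by rewrite ltr_wpDl.
have SM f : trace_norm (S f) <= M * trace_norm f.
  rewrite (le_trans (SM0 f))// ler_wpM2r ?trace_norm_ge0//.
  by rewrite (le_trans (ler_norm _))// lerDl.
(* The bound eta M <= 1/8 gives both |P| <= 2 M and 2 eta * 2 M <= 1/2, as [resolvent_growth]
   requires; eta <= rho / 2 keeps rho - eta positive. *)
pose eta := Num.min (rho / 2) ((8 * M)^-1).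
have eta0 : 0 < eta by rewrite lt_min divr_gt0//= invr_gt0 mulr_gt0.
have etaM : eta * M <= 8^-1.
  apply: (@le_trans _ _ ((8 * M)^-1 * M)).
    by rewrite ler_wpM2r ?(ltW M_gt0)// ge_min lexx orbT.
  by rewrite invfM mulfVK// gt_eqF.
have etarho : eta <= rho / 2 by rewrite ge_min lexx.
pose r := rho + eta.
have rrho : rho < r by rewrite ltrDl.
have r0 : 0 < r by exact: lt_trans rrho.
have [|Sr [Srl _ DSr SrD]] := (spectrumPn D r%:C%C).1 _.
  by apply: dual_trace_resolvent; rewrite modulusR gtr0_norm.
pose P f := - Sr f.
have DP f : D (P f) = r%:C%C *: P f - f.
  have DN h : D (- h) = - D h by apply: traceP => a.
  have /eqP := SrD f; rewrite DN subr_eq => /eqP ->.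
  by rewrite scalerN opprD addrC.
have PD f : P (D f) = r%:C%C *: P f - f.
  rewrite -{3}(DSr f) /P.
  rewrite -[D f - _]addrC -scaleNr Srl scaleNr scalerN opprD opprK.
  by rewrite addrA addNr add0r.
have Pnorm f : trace_norm (P f) <= 2 * M * trace_norm f.
  (* Since (D - rho) P f = eta P f - f, the bound on S controls P by a constant independent of
     eta. *)
  have SE : P f = S (eta%:C%C *: P f - f).
    rewrite -[LHS](DS (P f)); congr (S _); rewrite DP /r rmorphD scalerDl.
    by rewrite [rho%:C%C *: _ + _]addrC -!addrA; congr (_ + _);
      rewrite addrCA subrr addr0.
  have le1 : trace_norm (P f) <= M * (eta * trace_norm (P f) + trace_norm f).
    rewrite {1}SE (le_trans (SM _))// ler_wpM2l// ?(ltW M_gt0)//.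
    rewrite (le_trans (trace_normD _ _))// trace_normN trace_normZ modulusR.
    by rewrite gtr0_norm.
  have le2 : M * (eta * trace_norm (P f)) <= 8^-1 * trace_norm (P f).
    by rewrite mulrA ler_wpM2r ?trace_norm_ge0// mulrC.
  have Mf : 0 <= M * trace_norm f by rewrite mulr_ge0 ?trace_norm_ge0// ltW.
  move: le1 le2 (trace_norm_ge0 (P f)) Mf; rewrite mulrDr -[_ * M * _]mulrA.
  by lra.
have Ppos f : positive_trace f -> positive_trace (P f).
  move=> fp b; apply: ge0_approx => e e0.
  (* Iterating P f = r^-1 (f + P D f) writes P f as a positive partial sum plus r^-K P D^K f. This
     remainder tends to 0, because D^K grows at any rate r' > rho, in particular at one below r. *)
  have step K : exists2 y : R[i], 0 <= y &
      P f (star b * b) - y = (r^-1 ^+ K)%:C%C * P (iter K D f) (star b * b).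
    elim: K => [|K [y y0 yP]].
      by exists 0 => //; rewrite subr0 expr0 mul1r.
    have fK : positive_trace (iter K D f).
      by elim: K {y y0 yP} => [//|K IH]; rewrite iterS; exact: dual_trace_positive.
    exists (y + (r^-1 ^+ K.+1)%:C%C * iter K D f (star b * b)).
      rewrite addr_ge0// mulr_ge0// ler0c exprn_ge0// invr_ge0 ltW//.
    rewrite opprD addrA yP iterS PD.
    rewrite -[(_ - _ : trace_space B) _]/(r%:C%C * P (iter K D f) (star b * b) -
      iter K D f (star b * b)).
    rewrite mulrBr; congr (_ - _); rewrite mulrA -rmorphM /=; congr (_%:C%C * _).
    by rewrite exprS mulrAC mulVf ?mul1r// gt_eqF.
  have [r' rhor' r'r] : exists2 r', rho < r' & r' < r.
    by exists ((rho + r) / 2); rewrite ?midf_lt.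
  have r'0 : 0 < r' by exact: lt_trans rhor'.
  have [C C0 CP] := growth rhor'.
  have : geometric (2 * M * C * trace_norm f * cnorm (star b * b)) (r' / r) @ \oo
    --> (0 : R).
    by apply: cvg_geometric; rewrite gtr0_norm ?divr_gt0// ltr_pdivrMr// mul1r.
  move=> /cvgn_within/(_ e e0)[N /(_ N (leqnn _))]; rewrite !add0r => /andP[_ Ne].
  have [y y0 yP] := step N; exists y => //; rewrite yP modulusM modulusR.
  apply: (le_trans _ Ne); rewrite ger0_norm ?exprn_ge0 ?invr_ge0 ?(ltW r0)//.
  apply: (@le_trans _ _ (r^-1 ^+ N * (2 * M * (C * r' ^+ N * trace_norm f) *
    cnorm (star b * b)))).
    rewrite ler_wpM2l ?exprn_ge0 ?invr_ge0 ?(ltW r0)//.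
    rewrite (le_trans (trace_norm_ub _ _))// ler_wpM2r ?cnorm_ge0//.
    rewrite (le_trans (Pnorm _))// ler_wpM2l ?mulr_ge0 ?(ltW M_gt0)//.
    rewrite (le_trans (dual_trace_norm _ _))// ler_wpM2r ?trace_norm_ge0//.
  by rewrite le_eqVlt; apply/orP; left; apply/eqP; rewrite /geometric /= exprMn;
    ring.
(* The value at 1 of D^n P^j f0; the relation D P = r P - 1 becomes the recursion of
   [resolvent_growth]. *)
pose q n j := complex.Re (iter j P f0 (iter n sandwich 1)).
have Pj j : positive_trace (iter j P f0) by elim: j => [//|j IH]; rewrite iterS;
  exact: Ppos.
have one_pos n : pos (iter n sandwich 1).
  apply: pos_fixed; rewrite iter_sandwich; apply: pos_sum => w; rewrite mulr1.
  by rewrite -{1}[prodw u w]starK; exact: pos_starM.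
have [] := @resolvent_growth R q (fun n =>
  trace_norm f0 * norm_words u n) r (2 * eta) (2 * M).
- move=> n j; rewrite /q; have := positive_trace_pos (Pj j) (one_pos n).
  by rewrite lecE => /andP[].
- move=> n j; rewrite /q [iter n.+1 _ _]iterS -dual_traceE iterS DP.
  set a := iter n _ _; set h := iter j P f0.
  rewrite -[(_ - _ : trace_space B) a]/(r%:C%C * P h a - h a).
  by case: (P h a) (h a) => ? ? [? ?] /=; rewrite mul0r subr0.
- move=> n j; rewrite /q (le_trans (ler_norm _))// (le_trans (modulusRe _))//.
  rewrite (le_trans (trace_norm_ub _ _))//.
  apply: (@le_trans _ _ ((2 * M) ^+ j * trace_norm f0 * norm_words u n));
    last first.
    by rewrite le_eqVlt; apply/orP; left; apply/eqP; ring.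
  apply: ler_pM; rewrite ?trace_norm_ge0 ?cnorm_ge0//.
    elim: j => [|j IH]; first by rewrite expr0 mul1r.
    rewrite iterS (le_trans (Pnorm _))// exprS -[leRHS]mulrA ler_wpM2l ?mulr_ge0
      ?(ltW M_gt0)//.
  rewrite (le_trans (iter_sandwich_norm _ _))// ler_piMr ?cnorm1_le//.
  by rewrite sumr_ge0// => w _; rewrite sqr_ge0.
- by rewrite mulr_ge0// ltW.
- by rewrite mulr_ge0// ltW.
- by have -> : 2 * eta * (2 * M) = 4 * (eta * M); [ring|lra].
- by rewrite /r; lra.
move=> C CP; apply: (low (r - 2 * eta)); rewrite /r; [lra|lra|].
by exists C => n; exact: CP.
Qed.

End trace_operator.

(** * Topological entropy of a subshift *)

Section sequences_topology.
Context (p : nat).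
Notation X := (sequences p).

(** By contradiction: points outside V that agree with l on longer and longer prefixes would
    converge to l pointwise, hence in the product topology. *)
Lemma nbhs_cylinder (l : X) (V : set X) : nbhs l V ->
  exists n : nat, forall b : X, mkseq b n = mkseq l n -> V b.
Proof.
move=> lV; apply: contrapT => H.
have /choice[a aP] : forall n : nat, exists b : X, mkseq b n = mkseq l n /\ ~ V b.
  move=> n; apply: contrapT => Hn; apply: H; exists n => b bl.
  by apply: contrapT => Vb; apply: Hn; exists b.
have al : a n @[n --> \oo] --> l.
  apply/(@pointwise_cvgP nat (discrete_topology 'I_p)) => t W.
  rewrite /nbhs /= => /principal_filterP Wl.
  exists t.+1 => // n /= tn.
  have [/(congr1 (fun s => nth (l t) s t)) + _] := aP n.
  by rewrite !nth_mkseq// => ->.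
have [N _ NV] := al V lV.
by have [_] := aP N; apply; apply: NV => /=.
Qed.

Lemma open_first_letter (i : 'I_p) : open [set l : X | l 0%N = i].
Proof.
have oi : open [set i : discrete_topology 'I_p].
  by rewrite openE => j ->; apply/principal_filterP.
have := @open_comp X (discrete_topology 'I_p) (fun l => l 0%N) [set i] _ oi.
by apply=> x _; exact: (@proj_continuous nat (fun=> discrete_topology 'I_p) 0%N).
Qed.

End sequences_topology.

(** * Subshifts given by an extendable language *)

Section language_entropy.
Context (R : realType) (p : nat) (L : pred (seq 'I_p)).
Hypothesis L0 : L [::].
Hypothesis L_catl : forall s t, L (s ++ t) -> L s.
Hypothesis L_catr : forall s t, L (s ++ t) -> L t.
Hypothesis L_extend : forall s, L s -> exists i, L (rcons s i).
Notation X := (sequences p).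
Notation shift := (@left_shift p).

Definition language_shift : set X := [set l | forall r, L (mkseq l r)].
Notation K := language_shift.

Definition wordsL (n : nat) := {w : n.-tuple 'I_p | L w}.

Lemma mkseq_le (l : nat -> 'I_p) m n : (m <= n)%N ->
  mkseq l n = mkseq l m ++ mkseq (fun i => l (m + i)%N) (n - m).
Proof.
move=> mn; rewrite /mkseq -{1}(subnKC mn) iotaD map_cat; congr (_ ++ _).
by rewrite add0n -[X in map _ (iota X _)]addn0 iotaDl -map_comp.
Qed.

Let prefix_tuple (l : nat -> 'I_p) n : n.-tuple 'I_p :=
  Tuple (introT eqP (size_mkseq l n)).

Lemma extend_word s : L s -> exists2 l : X, K l & mkseq l (size s) = s.
Proof.
move=> Ls; have [i0 _] := L_extend L0.
have /choice[f fP] : forall t, exists i, L t -> L (rcons t i).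
  move=> t; case: (boolP (L t)) => [/L_extend[i Li]|_]; first by exists i.
  by exists i0.
pose e n := iter n (fun t => rcons t (f t)) s.
have Le n : L (e n) by elim: n => [//|n IH]; exact: fP.
have size_e n : size (e n) = (size s + n)%N.
  by elim: n => [|n IH]; rewrite ?addn0// /e iterS size_rcons -/(e n) IH addnS.
have e_prefix m n : (m <= n)%N -> exists t, e n = e m ++ t.
  move=> mn; rewrite -(subnKC mn); elim: (n - m)%N => [|j [t et]].
    by exists [::]; rewrite addn0 cats0.
  exists (rcons t (f (e (m + j)%N))).
  by rewrite addnS -rcons_cat -et.
pose l : X := fun i => nth i0 (e i.+1) i.
have lE n : mkseq l n = take n (e n).
  apply: (@eq_from_nth _ i0) => [|i].
    by rewrite size_mkseq size_takel// size_e leq_addl.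
  rewrite size_mkseq => ilt; rewrite nth_mkseq// nth_take// /l.
  have [t ->] := e_prefix i.+1 n ilt.
  by rewrite nth_cat size_e addnS ltnS leq_addl.
exists l.
  by move=> r; rewrite lE; apply: (@L_catl _ (drop r (e r))); rewrite cat_take_drop.
rewrite lE; have [t ->] := e_prefix 0%N (size s) (leq0n _).
by rewrite take_size_cat.
Qed.

Lemma mkseq_shift (l : X) i n : mkseq (iter i shift l) n = mkseq (fun j =>
  l (i + j)%N) n.
Proof.
apply: eq_mkseq => j; elim: i j => [//|i IH] j.
by rewrite iterS {1}/left_shift IH addnS.
Qed.

Lemma shift_language (l : X) i : K l -> K (iter i shift l).
Proof.
move=> Kl r; rewrite mkseq_shift; apply: (@L_catr (mkseq l i)).
by have := Kl (i + r)%N; rewrite (@mkseq_le l i) ?leq_addr// addKn.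
Qed.

Lemma language_neq0 : K !=set0.
Proof. by have [l Kl _] := extend_word L0; exists l. Qed.

(* A cover has a Lebesgue number: otherwise the prefixes around which it has
   none form an infinite tree, with a branch in the subshift. *)
Lemma lebesgue_number (U : set (set X)) : open_cover K U -> exists N : nat,
  forall a, K a -> exists2 V, U V & forall b : X, mkseq b N = mkseq a N -> V b.
Proof.
move=> [Uo KU].
pose good s := exists N : nat, forall a, K a -> mkseq a (size s) = s ->
  exists2 V, U V & forall b : X, mkseq b N = mkseq a N -> V b.
have good_children s : (forall i, good (rcons s i)) -> good s.
  move=> /choice[N NP]; exists (\max_(i < p) N i)%N => a Ka sa.
  have : mkseq a (size (rcons s (a (size s)))) = rcons s (a (size s)).
    by rewrite size_rcons /mkseq -addn1 iotaD map_cat -/(mkseq a (size s)) sa cats1.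
  move=> /(NP (a (size s)) a Ka)[V UV VP]; exists V => // b ba; apply: VP.
  have le : (N (a (size s)) <= \max_(i < p) N i)%N by exact: leq_bigmax.
  move: ba; rewrite (mkseq_le b le) (mkseq_le a le) => /eqP.
  by rewrite eqseq_cat ?size_mkseq// => /andP[/eqP].
have [[N NP]|bad] := pselect (good [::]).
  by exists N => a Ka; apply: NP.
exfalso.
have [i0 _] := L_extend L0.
have /choice[f fP] : forall s, exists i, ~ good s -> ~ good (rcons s i).
  move=> s; have [gs|ngs] := pselect (good s); first by exists i0.
  apply: contrapT => H; apply: ngs; apply: good_children => i.
  by apply: contrapT => ngi; apply: H; exists i.
pose e n := iter n (fun t => rcons t (f t)) [::].
have bad_e n : ~ good (e n) by elim: n => [//|n IH]; exact: fP.
have size_e n : size (e n) = n by elim: n => [//|n IH];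
  rewrite /e iterS size_rcons -/(e n) IH.
pose l : X := fun i => f (e i).
have lE n : mkseq l n = e n.
  elim: n => [//|n IH]; rewrite /mkseq -addn1 iotaD map_cat -/(mkseq l n) IH cats1.
  by rewrite addn1.
have Kl : K l.
  (* No point of the subshift begins with a word outside the language, so such a word is vacuously
     good; the bad branch stays in the subshift. *)
  move=> r; rewrite lE; apply: contrapT => nL; apply: (bad_e r);
    exists 0%N => a Ka ar.
  by exfalso; apply: nL; rewrite -ar; exact: Ka.
have [V UV Vl] := KU l Kl.
have [n nP] := nbhs_cylinder (open_nbhs_nbhs (conj (Uo V UV) Vl)).
apply: (bad_e n); exists n => a Ka; rewrite size_e => an.
by exists V => // b ba; apply: nP; rewrite ba an lE.
Qed.

Section cover.
Variable U : set (set X).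

Lemma join_subcover_finType (T : finType) n (w : T -> 'I_n -> set X) :
  (forall j i, U (w j i)) ->
  K `<=` [set a | exists j, forall i : 'I_n, w j i (iter i shift a)] ->
  join_subcover K shift U n #|T|.
Proof.
move=> wU Kw; exists (fun j => w (enum_val j)); split=> [j i|a Ka]; first exact: wU.
by have [j jP] := Kw a Ka; exists (enum_rank j) => i; rewrite enum_rankK.
Qed.

Lemma join_subcoverM m n k1 k2 : join_subcover K shift U m k1 ->
  join_subcover K shift U n k2 -> join_subcover K shift U (m + n) (k1 * k2).
Proof.
move=> [w1 [w1U w1K]] [w2 [w2U w2K]].
have := @join_subcover_finType ('I_k1 * 'I_k2)%type (m + n)
  (fun j i => match fintype.split i with inl i1 => w1 j.1 i1 | inr i2 =>
    w2 j.2 i2 end).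
rewrite card_prod !card_ord; apply=> [j i|a Ka]; first by case: (fintype.split i).
have [j1 j1P] := w1K a Ka.
have [j2 j2P] := w2K _ (shift_language m Ka).
exists (j1, j2) => i /=; case: fintype.splitP => i' ->; first exact: j1P.
by rewrite addnC iterD; exact: j2P.
Qed.

(** A word of length n + N has a window of length N at each i < n, and the Lebesgue property
    attaches to each window a member of U. *)
Lemma join_subcover_words N n : (forall a, K a ->
    exists2 V, U V & forall b : X, mkseq b N = mkseq a N -> V b) ->
  join_subcover K shift U n #|{: wordsL (n + N)}|.
Proof.
move=> NP; have [l0 Kl0] := language_neq0; have [V0 UV0 _] := NP l0 Kl0.
have /choice[f fP] : forall s, exists V, U V /\
    (L s -> size s = N -> forall b : X, mkseq b N = s -> V b).
  move=> s; have [[Ls sN]|H] := pselect (L s /\ size s = N); last first.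
    by exists V0; split=> // Ls sN; case: H.
  have [a Ka aE] := extend_word Ls; have [V UV VP] := NP a Ka.
  by exists V; split=> // _ _ b bs; apply: VP; rewrite bs -sN aE.
apply: (@join_subcover_finType (wordsL (n + N) : finType) n (fun v i =>
  f (take N (drop i (val v))))).
  by move=> v i; have [] := fP (take N (drop i (val v))).
move=> a Ka.
have La : L (prefix_tuple a (n + N)) by exact: Ka.
exists (exist _ (prefix_tuple a (n + N)) La) => i /=.
have iN : (i <= n + N)%N by rewrite (leq_trans (ltnW (ltn_ord i)))// leq_addr.
have E : take N (drop i (mkseq a (n + N))) = mkseq (iter i shift a) N.
  rewrite (mkseq_le a iN) drop_size_cat ?size_mkseq// mkseq_shift.
  have NN : (N <= n + N - i)%N by rewrite leq_subRL// leq_add2r ltnW.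
  by rewrite (mkseq_le _ NN) take_size_cat// size_mkseq.
rewrite E; have [_] := fP (mkseq (iter i shift a) N); apply=> //.
  by apply: shift_language.
by rewrite size_mkseq.
Qed.

Context (U_cover : open_cover K U).

(** A Lebesgue number provides some finite subcover of the join, hence a least one: the minimum is
    attained. *)
Lemma cover_number_ex n : exists k, [/\ cover_number R K shift U n = k%:R,
  join_subcover K shift U n k & forall k',
    join_subcover K shift U n k' -> (k <= k')%N].
Proof.
have [N NP] := lebesgue_number U_cover.
have ex : exists k, `[< join_subcover K shift U n k >].
  by eexists; apply/asboolP; exact: join_subcover_words NP.
case: (ex_minnP ex) => k /asboolP kP kmin; exists k; split=> //.
  apply: minimumP; first by exists k.
  by move=> _ [k' k'P <-]; rewrite ler_nat; apply: kmin; apply/asboolP.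
by move=> k' k'P; apply: kmin; apply/asboolP.
Qed.

Lemma cover_number_ge1 n : 1 <= cover_number R K shift U n.
Proof.
have [k [-> [w [_ wK]] _]] := cover_number_ex n.
have [l Kl] := language_neq0; have [j _] := wK l Kl.
by rewrite ler1n (leq_ltn_trans _ (ltn_ord j)).
Qed.

Lemma cover_number_submul m n : cover_number R K shift U (m + n) <=
  cover_number R K shift U m * cover_number R K shift U n.
Proof.
have [k1 [-> k1P _]] := cover_number_ex m.
have [k2 [-> k2P _]] := cover_number_ex n.
have [k [-> _ kmin]] := cover_number_ex (m + n).
by rewrite -natrM ler_nat; apply: kmin; exact: join_subcoverM.
Qed.

Lemma cover_entropy_cvg : cvgn (fun n : nat =>
  n%:R^-1 * ln (cover_number R K shift U n)).
Proof.
apply: submultiplicative_cvg; [exact: cover_number_ge1|exact: cover_number_submul].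
Qed.

End cover.

(** This partition attains the supremum over covers, since its n-fold join separates the words of
    length n. *)
Let letters : set (set X) := [set [set l : X | l 0%N = i] | i in [set: 'I_p]].

Let letters_cover : open_cover K letters.
Proof.
split=> [_ [i _ <-]|l Kl]; first exact: open_first_letter.
by exists [set l' : X | l' 0%N = l 0%N] => //; exists (l 0%N).
Qed.

(** Extend each word to a point and choose a member of the subcover that contains it. Points in one
    member share their first n letters, so the choice is injective. *)
Let letters_number n : #|{: wordsL n}|%:R <= cover_number R K shift letters n.
Proof.
have [k [-> [w [wU wK]] _]] := cover_number_ex letters_cover n.
have /choice[f fP] : forall v : wordsL n, exists l : X, K l /\ mkseq l n = val v.
  move=> [v Lv]; have [l Kl lv] := extend_word Lv; exists l; split=> //.
  by rewrite -[in LHS](size_tuple v).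
have /choice[h hP] : forall v : wordsL n, exists j : 'I_k, forall i : 'I_n,
  w j i (iter i shift (f v)).
  by move=> v; have [Kf _] := fP v; exact: wK.
rewrite ler_nat -[leqRHS]card_ord; apply: (@leq_card _ _ h) => v1 v2 h12.
apply/val_inj/val_inj; have [_ /= <-] := fP v1; have [_ /= <-] := fP v2.
apply/eq_in_map => i; rewrite mem_iota add0n => ilt.
have := hP v1 (Ordinal ilt); have := hP v2 (Ordinal ilt); rewrite h12.
have [j _ <-] := wU (h v2) (Ordinal ilt).
have it (l : X) : iter i shift l 0%N = l i.
  by have := mkseq_shift l i 1; rewrite /mkseq /= addn0 => -[].
by rewrite /= !it => -> ->.
Qed.

Context (h : R).
Hypothesis words_cvg : (n%:R^-1 * ln (#|{: wordsL n}|%:R : R)) @[n --> \oo] --> h.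
Hypothesis words_submul : forall m n,
  (#|{: wordsL (m + n)}| <= #|{: wordsL m}| * #|{: wordsL n}|)%N.

Let words_gt0 n : (0 < #|{: wordsL n}|)%N.
Proof.
have [l Kl] := language_neq0; apply/card_gt0P.
by exists (exist _ (prefix_tuple l n) (Kl n)).
Qed.

Lemma language_topological_entropy : topological_entropy R K shift = h%:E.
Proof.
apply/eqP; rewrite eq_le; apply/andP; split.
  apply: ge_ereal_sup => _ [U U_cover <-]; rewrite lee_fin.
  have [N NP] := lebesgue_number U_cover.
  (* With W(m) words of length m, a cover of Lebesgue number N needs at most W(n + N) <= W(n) W(N)
     members, and ln W(N) / n vanishes in the limit. *)
  have c0 : (fun n : nat => n%:R^-1 * ln (#|{: wordsL n}|%:R : R) +
      n%:R^-1 * ln (#|{: wordsL N}|%:R : R)) @ \oo --> h.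
    rewrite -[X in _ --> X]addr0; apply: cvgD => //.
    rewrite -[X in _ --> X](mul0r (ln (#|{: wordsL N}|%:R : R))).
    apply: cvgM; last exact: cvg_cst.
    apply/gtr0_cvgV0; last exact: cvgr_idn.
    by exists 1%N => // n /= n0; rewrite ltr0n.
  rewrite -(cvg_lim _ c0)//; apply: ler_lim.
  - exact: cover_entropy_cvg U_cover.
  - by apply/cvg_ex; exists h.
  near=> n; rewrite -mulrDr ler_wpM2l ?invr_ge0//.
  have c1 := cover_number_ge1 U_cover n.
  rewrite -lnM ?posrE ?ltr0n ?words_gt0//.
  rewrite ler_ln ?posrE ?mulr_gt0 ?ltr0n ?words_gt0// ?(lt_le_trans ltr01)//.
  have [k [-> _ kmin]] := cover_number_ex U_cover n.
  rewrite -natrM ler_nat (leq_trans _ (words_submul n N))//.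
  by apply: kmin; exact: join_subcover_words.
apply: (@le_trans _ _ (cover_entropy R K shift letters)%:E); last first.
  by apply: ereal_sup_ubound; exists letters.
rewrite lee_fin -(cvg_lim _ words_cvg)//; apply: ler_lim.
- by apply/cvg_ex; exists h.
- exact: cover_entropy_cvg letters_cover.
near=> n; rewrite ler_wpM2l ?invr_ge0// ler_ln ?posrE ?ltr0n ?words_gt0//.
by rewrite (lt_le_trans ltr01)// cover_number_ge1.
Unshelve. all: by end_near. Qed.

End language_entropy.

(** * KMS states *)

Section exponential.
Context (R : realType).
Implicit Types (s t : R) (k : int).

Lemma expiD s t : expi (s + t) = expi s * expi t.
Proof. by rewrite /expi cosD sinD; apply/eqP; rewrite eq_complex /=; apply/andP;
  split; apply/eqP; ring. Qed.

Lemma expi0 : expi 0 = 1 :> R[i].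
Proof. by rewrite /expi cos0 sin0. Qed.

Lemma norm_expi t : `|expi t| = 1.
Proof. by rewrite normc_def /= cos2Dsin2 sqrtr1. Qed.

Lemma expi_2pi : expi (2 * pi) = 1 :> R[i].
Proof. by rewrite mulr_natl /expi cos2pi sin2pi. Qed.

Lemma expi_exp n t : expi t ^+ n = expi (n%:R * t).
Proof.
elim: n => [|n IH]; first by rewrite mul0r expi0.
by rewrite exprS IH -expiD -natr1 mulrDl mul1r addrC.
Qed.

Lemma expiN t : expi (- t) = (expi t)^-1.
Proof.
have e0 := norm1_neq0 (norm_expi t).
by apply: (mulfI e0); rewrite -expiD subrr expi0 mulfV.
Qed.

Lemma expi_exprz k t : expi t ^ k = expi (k%:~R * t).
Proof.
case: k => n; first by rewrite -exprnP expi_exp.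
by rewrite NegzE -exprnN expi_exp mulNr expiN.
Qed.

Lemma modulus_le_ReIm (c : R[i]) : modulus c <= `|complex.Re c| + `|complex.Im c|.
Proof.
rewrite {1}(complexE c) (le_trans (modulusD _ _))// modulusM !modulusR.
have -> : modulus ('i%C : R[i]) = 1.
  by rewrite /modulus normc_def /= expr0n expr1n add0r sqrtr1.
by rewrite mul1r.
Qed.

Lemma expi_near1 (e : R) : 0 < e -> exists2 d : R, 0 < d &
  forall t, `|t| < d -> modulus (expi t - 1) <= e.
Proof.
move=> e0; have e2 : 0 < e / 2 by rewrite divr_gt0.
have /cvgrPdist_le/(_ _ e2)[d1 /= d10 d1P] := @continuous_cos R 0.
have /cvgrPdist_le/(_ _ e2)[d2 /= d20 d2P] := @continuous_sin R 0.
exists (Num.min d1 d2); first by rewrite lt_min d10.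
move=> t; rewrite lt_min => /andP[td1 td2].
rewrite (le_trans (modulus_le_ReIm _))//= [e]splitr lerD//.
  by rewrite distrC -{1}(@cos0 R); apply: d1P; rewrite /ball_ /= sub0r normrN.
by rewrite distrC -{1}(@sin0 R); apply: d2P; rewrite /ball_ /= sub0r normrN.
Qed.

(* The coefficients of the power series of expi (y t) in t. *)
Definition expi_coeff (y : R) (n : nat) : R[i] := ('i%C * y%:C%C) ^+ n / n`!%:R.

Let i_exp n : ('i%C : R[i]) ^+ n = ((~~ odd n)%:R * (-1) ^+ n./2 +i* ((odd n)%:R
  * (-1) ^+ n./2))%C.
Proof.
have ii : 'i%C * 'i%C = -1 :> R[i] by rewrite -expr2 sqr_i.
have even m : ('i%C : R[i]) ^+ (m.*2) = ((-1) ^+ m)%:C%C.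
  by rewrite -muln2 mulnC exprM expr2 ii rmorphXn rmorphN rmorph1.
rewrite -{1}(odd_double_half n) exprD even.
by case: (odd n); rewrite ?expr1 ?expr0 /= ?mul1r; apply/eqP;
  rewrite eq_complex /=; apply/andP; split; apply/eqP; ring.
Qed.

Lemma expi_series y t : modulus (\sum_(0 <= n < N) (t ^+ n)%:C%C * expi_coeff y n
  - expi (y * t))
  @[N --> \oo] --> (0 : R).
Proof.
have E N : \sum_(0 <= n < N) (t ^+ n)%:C%C * expi_coeff y n =
    (series (cos_coeff (y * t)) N +i* series (sin_coeff (y * t)) N)%C.
  elim: N => [|N IH]; first by rewrite /series /= !big_geq.
  rewrite /series /= !big_nat_recr//= -/(series (cos_coeff (y * t)) N) -/(series
    (sin_coeff (y * t)) N).
  have -> : (t ^+ N)%:C%C * expi_coeff y N =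
      (cos_coeff (y * t) N +i* sin_coeff (y * t) N)%C.
    rewrite /expi_coeff exprMn i_exp cos_coeffE sin_coeffE.
    have -> : (N`!%:R : R[i])^-1 = ((N`!%:R :
      R)^-1)%:C%C by rewrite fmorphV rmorph_nat.
    rewrite -rmorphXn /= exprMn; apply/eqP; rewrite eq_complex /=.
    apply/andP; split; apply/eqP; first by ring.
    case: (boolP (odd N)) => oN; last by rewrite /=; ring.
    have -> : N.-1./2 = N./2.
      by case: (N) oN => //= m /negbTE om; rewrite uphalf_half om.
    by rewrite /=; ring.
  by rewrite IH.
apply: (@squeeze_cvgr _ _ _ _ (fun=> 0)
  (fun N => `|series (cos_coeff (y * t)) N - cos (y * t)| + `|series (sin_coeff
    (y * t)) N - sin (y * t)|)).
- near=> N; rewrite modulus_ge0 /= E (le_trans (modulus_le_ReIm _))//.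
- exact: cvg_cst.
- rewrite -[X in _ --> X]addr0; apply: cvgD.
    rewrite -(normr0 R) -(subrr (cos (y * t))); apply: cvg_norm.
    by apply: cvgB; [rewrite cos.unlock; exact: is_cvg_series_cos_coeff|exact:
      cvg_cst].
  rewrite -(normr0 R) -(subrr (sin (y * t))); apply: cvg_norm.
  by apply: cvgB; [rewrite sin.unlock; exact: is_cvg_series_sin_coeff|exact:
    cvg_cst].
Unshelve. all: by end_near. Qed.

(** The entire function e^(i y z) at z = i s: for y = k and s = beta this is the source of the
    factor e^(-k beta). *)
Lemma expR_series y s : modulus (\sum_(0 <= n < N) (0 +i* s)%C ^+ n * expi_coeff
  y n - (expR (- (y * s)))%:C%C)
  @[N --> \oo] --> (0 : R).
Proof.
have E N : \sum_(0 <= n < N) (0 +i* s)%C ^+ n * expi_coeff y n =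
    (series (exp_coeff (- (y * s))) N)%:C%C.
  rewrite /series /= (rmorph_sum (@real_complex_def R (Phant R))) /=;
    apply: eq_bigr => n _.
  have -> : (0 +i* s)%C = 'i%C * s%:C%C :> R[i].
    by apply/eqP; rewrite eq_complex /=; apply/andP; split; apply/eqP; ring.
  rewrite /expi_coeff /exp_coeff /= mulrA -exprMn mulrACA -expr2 sqr_i.
  rewrite -rmorphM /= mulN1r -rmorphN -rmorphXn /= rmorphM /= fmorphV rmorph_nat.
  by rewrite [s * y]mulrC.
under eq_fun do rewrite E -rmorphB /= modulusR.
rewrite -(normr0 R) -(subrr (expR (- (y * s)))); apply: cvg_norm.
by apply: cvgB; [exact: is_cvg_series_exp_coeff|exact: cvg_cst].
Qed.

End exponential.

Section normed_topology.
Context (R : realType) (A : preCStarAlgType R).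

Lemma normed_cvgP (u : nat -> A) (l : A) :
  (u n : normed A) @[n --> \oo] --> (l : normed A) <-> tends u l.
Proof.
split=> [/cvgrPdist_lt ul|/tendsP ul].
  apply/tendsP => e e0; have [|N _ NP] := ul e%:C%C; first by rewrite ltcR.
  by exists N => n Nn; have := NP n Nn; rewrite /Num.norm /= ltcR cnormBC.
apply/cvgrPdist_lt => e e0.
have eE : e = (complex.Re e)%:C%C by rewrite RRe_real// gtr0_real.
rewrite eE ltcR in e0; have [N NP] := ul _ e0.
exists N => // n /= Nn; rewrite eE /Num.norm /= ltcR.
by rewrite -[l - u n]/((l : A) - u n) cnormBC; exact: NP.
Qed.

Lemma dense_tends (D : set A) : dense (D : set (normed A)) -> forall a,
  exists u : nat -> A, (forall n, D (u n)) /\ tends u a.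
Proof.
move=> Dd a.
have /choice[u uP] : forall n : nat, exists b, D b /\ cnorm (b - a) < n.+1%:R^-1.
  move=> n; have n0 : 0 < (n.+1%:R^-1 : R)%:C%C by rewrite ltcR invr_gt0 ltr0n.
  have [||b [ba Db]] := Dd (ball (a : normed A) (n.+1%:R^-1 : R)%:C%C).
  - by exists (a : normed A); exact: ballxx.
  - exact: ball_open.
  exists b; split=> //; move: ba; rewrite -ball_normE /ball_ /= /Num.norm /= ltcR.
  by rewrite cnormBC.
exists u; split=> [n|]; first by have [] := uP n.
apply: (@tends_le _ _ _ _ harmonic) => [n|]; last exact: cvg_harmonic.
by have [_ /ltW] := uP n.
Qed.

Lemma tends_scale (c : nat -> R[i]) (d : R[i]) (a : A) :
  modulus (c n - d) @[n --> \oo] --> (0 : R) -> tends (fun n => c n *: a) (d *: a).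
Proof.
move=> cd; apply: (@tends_le _ _ _ _ (fun n => modulus (c n - d) * cnorm a)).
  by move=> n; rewrite -scalerBl cnormZ.
by rewrite -[X in _ --> X](mul0r (cnorm a)); apply: cvgM => //; exact: cvg_cst.
Qed.

Lemma pseries_terms_bounded (c : nat -> A) l :
  tends (fun n => \sum_(0 <= j < n) c j) l -> exists M : R, forall n,
    cnorm (c n) <= M.
Proof.
move=> /tendsP/(_ 1 ltr01)[N NP].
exists (2 + \sum_(0 <= j < N) cnorm (c j)) => n.
have S0 : 0 <= \sum_(0 <= j < N) cnorm (c j) by apply: sumr_ge0 => j _;
  exact: cnorm_ge0.
case: (ltnP n N) => nN.
  rewrite big_mkord (bigD1 (Ordinal nN))//= addrCA lerDl addr_ge0// sumr_ge0// =>
    j _.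
  exact: cnorm_ge0.
rewrite (@le_trans _ _ 2) ?lerDl//.
have -> : c n = (\sum_(0 <= j < n.+1) c j - l) - (\sum_(0 <= j < n) c j - l).
  by rewrite opprB addrA subrK big_nat_recr//= addrAC subrr add0r.
rewrite (le_trans (cnormB_le _ _))// -[2]/(1 + 1) lerD// ltW// NP//.
exact: leqW.
Qed.

(** Identity theorem at points tending to 0. Once the coefficients before n vanish, dividing by t^n
    leaves c(n) plus a tail, which for t <= 1/2 is at most 2 M t. *)
Lemma pseries_eq0 (c : nat -> A) (M : R) (t : nat -> R) :
  (forall n, cnorm (c n) <= M) -> (forall r, 0 < t r) -> t @ \oo --> (0 : R) ->
  (forall r, tends (fun n => \sum_(0 <= j < n) (t r ^+ j)%:C%C *: c j) 0) ->
  forall n, c n = 0.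
Proof.
move=> cM t0 tlim tc n; elim/ltn_ind: n => n IH.
have M0 : 0 <= M by rewrite (le_trans (cnorm_ge0 (c 0%N))).
have main r : t r <= 2^-1 -> cnorm (c n) <= 2 * M * t r.
  move=> tr; have s0 := t0 r; set s := t r in tr s0 *.
  apply/ler_addgt0Pr => e e0.
  have sn0 : 0 < s ^+ n by rewrite exprn_gt0.
  have /tendsP/(_ _ (mulr_gt0 e0 sn0))[N NP] := tc r.
  have := NP (N + n.+1)%N (leq_addr _ _); rewrite subr0 addnC.
  rewrite (big_cat_nat (n := n.+1)) ?leq_addr//= big_nat_recr//= big1_seq ?add0r;
    last first.
    by move=> j; rewrite mem_index_iota /= => jn; rewrite IH ?scaler0.
  rewrite -/s; set rest := \sum_(_ <= _ < _) _ => small.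
  have rest_le : cnorm rest <= M * s ^+ n.+1 * 2.
    rewrite /rest (le_trans (cnorm_sum _ _))//.
    apply: (@le_trans _ _ (series (geometric (M * s ^+ n.+1) s) N)).
      rewrite /series /= -[X in \sum_(X <= _ < _) _]add0n big_addn addKn.
      apply: ler_sum => j _; rewrite cnormZr ger0_norm ?exprn_ge0 ?(ltW s0)//.
      have -> : M * s ^+ n.+1 * s ^+ j = s ^+ (j + n.+1) * M by rewrite exprD; ring.
      by rewrite ler_wpM2l ?exprn_ge0 ?(ltW s0).
    apply: le_trans (geometric_le_lim _ _ _ _) _ => //.
    - by rewrite mulr_ge0// exprn_ge0// ltW.
    - by rewrite gtr0_norm// (le_lt_trans tr)// invf_lt1// ltr1n.
    rewrite ler_wpM2l ?mulr_ge0 ?exprn_ge0 ?(ltW s0)//.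
    by rewrite -[leRHS]invrK lef_pV2 ?posrE ?subr_gt0 ?invr_gt0//; lra.
  have : s ^+ n * cnorm (c n) <= e * s ^+ n + M * s ^+ n.+1 * 2.
    have -> : s ^+ n * cnorm (c n) = cnorm ((s ^+ n)%:C%C *: c n).
      by rewrite cnormZr ger0_norm// exprn_ge0// ltW.
    rewrite -[X in cnorm X](addrK rest) (le_trans (cnormB_le _ _))// lerD//.
    exact: ltW.
  have -> : e * s ^+ n + M * s ^+ n.+1 * 2 = s ^+ n * (2 * M * s + e) by rewrite
    exprS; ring.
  by rewrite ler_pM2l.
apply: cnorm0_eq0; apply/eqP; rewrite eq_le cnorm_ge0 andbT.
have c0 : (fun r => 2 * M * t r) @ \oo --> (0 : R).
  by rewrite -[X in _ --> X](mulr0 (2 * M)); apply: cvgM => //; exact: cvg_cst.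
rewrite -(cvg_lim _ c0)//; apply: limr_ge; first by apply/cvg_ex; exists 0.
near=> r; apply: main; near: r.
have h0 : 0 < 2^-1 :> R by rewrite invr_gt0.
have [N NP] := cvgn_within tlim h0.
by exists N => // j /= /NP; rewrite !add0r => /andP[].
Unshelve. all: by end_near. Qed.

End normed_topology.

(** * Projection onto a spectral subspace by averaging *)

Section spectral_projection.
Context (R : realType) (A : cstarAlgType R) (g : circle_action A) (k : int).
Implicit Types (s t : R) (a b : A).

(* The spectral subspace A^k is the space of vectors fixed by all rotations. *)
Definition rot t b : A := expi (- (k%:~R * t)) *: g (expi t) b.

Lemma rot_linear t : linear (rot t).
Proof.
move=> c a b; rewrite /rot act_linear ?norm_expi// scalerDr.
by rewrite !scalerA mulrC.
Qed.

Lemma rotD t : {morph rot t : a b / a + b}.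
Proof. by move=> a b; rewrite -{1}[a]scale1r rot_linear scale1r. Qed.

Lemma rot0r t : rot t 0 = 0.
Proof. by rewrite /rot act0 ?norm_expi// scaler0. Qed.

Lemma rotZ t c a : rot t (c *: a) = c *: rot t a.
Proof. by rewrite -[c *: a]addr0 rot_linear rot0r addr0. Qed.

Lemma modulus_expi t : modulus (expi t : R[i]) = 1.
Proof. exact: modulus1P (norm_expi t). Qed.

Lemma rot_contractive t a : cnorm (rot t a) <= cnorm a.
Proof. by rewrite cnormZ modulus_expi mul1r act_contractive ?norm_expi. Qed.

Lemma rot_add s t a : rot (s + t) a = rot s (rot t a).
Proof.
rewrite /rot actZ ?norm_expi// -act_comp ?norm_expi// scalerA -!expiD.
by congr (expi _ *: _); ring.
Qed.

Lemma rot0 a : rot 0 a = a.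
Proof. by rewrite /rot mulr0 oppr0 expi0 scale1r act_one. Qed.

Lemma rot_2pi a : rot (2 * pi) a = a.
Proof.
rewrite /rot expi_2pi act_one expiN -expi_exprz expi_2pi exp1rz invr1.
by rewrite scale1r.
Qed.

Lemma rot_spectral t a : spectral_subspace g k a -> rot t a = a.
Proof.
move=> ka; rewrite /rot ka ?norm_expi// scalerA expi_exprz -expiD addNr expi0.
by rewrite scale1r.
Qed.

Lemma act_rot t a : g (expi t) a = expi (k%:~R * t) *: rot t a.
Proof. by rewrite /rot scalerA -expiD subrr expi0 scale1r. Qed.

Lemma rot_near0 a (e : R) : 0 < e -> exists2 d : R, 0 < d &
  forall t, 0 <= t -> t <= d -> cnorm (rot t a - a) <= e.
Proof.
move=> e0; have e2 : 0 < e / 2 by rewrite divr_gt0.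
pose N := cnorm a + 1; have N0 : 0 < N by rewrite ltr_wpDl// cnorm_ge0.
have [d1 d10 d1P] := expi_near1 (divr_gt0 e2 N0).
have /subspace_continuousP/(_ 1 (normr1 _))/cvgrPdist_lt := @act_continuous _ _ g a.
have e2C : 0 < (e / 2)%:C%C :> R[i] by rewrite ltcR.
move=> /(_ _ e2C); rewrite near_withinE => -[d0 /= d00 d0P].
have d0E : d0 = (complex.Re d0)%:C%C by rewrite RRe_real// gtr0_real.
have rd0 : 0 < complex.Re d0 by rewrite -ltcR -d0E.
have rd02 : 0 < complex.Re d0 / 2 by rewrite divr_gt0.
have [d2 d20 d2P] := expi_near1 rd02.
(* The added 1 keeps the divisor nonzero when k = 0, as in N for a = 0; the final halving turns the
   bound on t into a strict one. *)
pose K : R := `|k%:~R| + 1; have K0 : 0 < K by rewrite ltr_wpDl.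
exists (Num.min (d1 / K) d2 / 2).
  by rewrite divr_gt0// lt_min divr_gt0.
move=> t t0 td.
have {td} : t < Num.min (d1 / K) d2.
  by rewrite (le_lt_trans td)// gtr_pMr ?invf_lt1 ?ltr1n// lt_min divr_gt0.
rewrite lt_min => /andP[td1 td2].
have -> : rot t a - a = expi (- (k%:~R * t)) *: (g (expi t) a - a) +
    (expi (- (k%:~R * t)) - 1) *: a.
  by rewrite scalerBr scalerBl scale1r addrA subrK.
rewrite (le_trans (cnormD_le _ _))// !cnormZ modulus_expi mul1r [e]splitr lerD//.
  have := d0P (expi t); rewrite /= => /(_ _ (norm_expi t)) H.
  have : ball_ Num.norm (1 : R[i]) d0 (expi t).
    rewrite /ball_ /= distrC d0E -modulusE ltcR.
    rewrite (le_lt_trans (d2P t _)) ?ger0_norm//.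
    by rewrite gtr_pMr// invf_lt1// ltr1n.
  move=> /H {}H; have {H} : (cnorm (g 1 a - g (expi t) a))%:C%C < (e / 2)%:C%C by
    exact: H.
  by rewrite act_one ltcR cnormBC => /ltW.
apply: (@le_trans _ _ (e / 2 / N * cnorm a)).
  rewrite ler_wpM2r ?cnorm_ge0// d1P// normrN normrM (ger0_norm t0).
  rewrite (@le_lt_trans _ _ (K * t))//; first by rewrite ler_wpM2r// lerDl.
  by rewrite mulrC -ltr_pdivlMr.
by rewrite -mulrA ler_piMr ?(ltW e2)// ler_pdivrMl// mulr1 lerDl.
Qed.

(** Means over the roots of unity of order 2^r replace the integral over the circle: each mean is
    half the sum of the previous one and one rotation of it. *)
Definition dyadic (r : nat) : R := 2 * pi / 2 ^+ r.

Lemma dyadic_gt0 r : 0 < dyadic r.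
Proof. by rewrite /dyadic divr_gt0 ?exprn_gt0// mulr_gt0// pi_gt0. Qed.

Lemma dyadicS r : dyadic r = dyadic r.+1 + dyadic r.+1.
Proof.
rewrite /dyadic exprS; have : (2 : R) ^+ r != 0 by rewrite expf_neq0// pnatr_eq0.
by move=> ?; field.
Qed.

Lemma dyadic_cvg0 : dyadic @ \oo --> (0 : R).
Proof.
have -> : dyadic = geometric (2 * pi) 2^-1.
  by apply/funext => r; rewrite /dyadic /geometric /= exprVn.
by apply: cvg_geometric; rewrite ger0_norm ?invr_ge0// invf_lt1// ltr1n.
Qed.

Definition average r b : A := (2^-1 : R)%:C%C *: (b + rot (dyadic r) b).

(* The mean of the rotations of b by the multiples of 2 pi / 2^n. *)
Fixpoint averages n b : A :=
  if n is m.+1 then average m.+1 (averages m b) else b.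

Lemma rot_averages t n b : rot t (averages n b) = averages n (rot t b).
Proof.
elim: n => [//|n IH] /=; rewrite /average rotZ rotD IH; congr (_ *: (_ + _)).
by rewrite -rot_add addrC rot_add IH.
Qed.

Lemma average_contractive r b : cnorm (average r b) <= cnorm b.
Proof.
rewrite cnormZr ger0_norm ?invr_ge0// ler_pdivrMl// mulrC mulr_natr mulr2n.
by rewrite (le_trans (cnormD_le _ _))// lerD// rot_contractive.
Qed.

Lemma averages_contractive n b : cnorm (averages n b) <= cnorm b.
Proof. by elim: n => [//|n IH] /=; rewrite (le_trans (average_contractive _ _)).
  Qed.

Lemma averages_linear n : linear (averages n).
Proof.
elim: n => [//|n IH] c a b /=; rewrite IH /average rot_linear.
rewrite addrACA -scalerDr [LHS]scalerDr !scalerA.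
by congr (_ *: _ + _); rewrite mulrC.
Qed.

Lemma averagesB n a b : averages n (a - b) = averages n a - averages n b.
Proof. by rewrite addrC -scaleN1r averages_linear scaleN1r addrC. Qed.

Lemma averages_spectral n a : spectral_subspace g k a -> averages n a = a.
Proof.
move=> ka; elim: n => [//|n IH] /=; rewrite IH /average rot_spectral//.
rewrite -[X in _ *: (X + _)]scale1r -[X in _ *: (_ + X)]scale1r -scalerDl scalerA.
by rewrite -(rmorphD _ 1 1) -rmorphM /= mulVf ?pnatr_eq0// scale1r.
Qed.

(** The rotation by [dyadic m] exchanges the two terms of the last average, because twice that angle
    fixes the mean before it. *)
Lemma averages_fixed n r b : (r <= n)%N ->
  rot (dyadic r) (averages n b) = averages n b.
Proof.
have H m : rot (dyadic m) (averages m b) = averages m b.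
  elim: m => [|m IH] /=; first by rewrite /dyadic expr0 divr1 rot_2pi.
  rewrite /average rotZ rotD -rot_add -dyadicS IH.
  by rewrite addrC.
move=> rn; rewrite -(subnK rn); move: (n - r)%N => j {rn n};
  elim: j r => [|j IH] r; first exact: H.
by rewrite dyadicS rot_add addSnnS !IH.
Qed.

Lemma averages_diff n m b (e : R) :
  (forall t, 0 <= t -> t <= dyadic n -> cnorm (rot t b - b) <= e) ->
  cnorm (averages (n + m) b - averages n b) <= e.
Proof.
move=> bP.
have {}bP t : 0 <= t -> t <= dyadic n ->
    cnorm (rot t (averages n b) - averages n b) <= e.
  move=> t0 tn; rewrite rot_averages -averagesB.
  by rewrite (le_trans (averages_contractive _ _))// bP.
(* The angles added after stage n sum to at most dyadic n - dyadic (n + m), which leaves room for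
   one extra rotation by t; this is what carries the induction. *)
suff H t : 0 <= t -> t <= dyadic (n + m)%N ->
    cnorm (rot t (averages (n + m) b) - averages n b) <= e.
  by rewrite -[X in cnorm (X - _)]rot0; apply: H => //; exact: ltW (dyadic_gt0 _).
elim: m t => [|m IH] t t0 ts; first by rewrite addn0 in ts *; exact: bP.
rewrite addnS /= /average rotZ rotD -rot_add.
set x := averages (n + m) b; set y := averages n b.
have -> : (2^-1 : R)%:C%C *: (rot t x + rot (t + dyadic (n + m).+1) x) - y =
   (2^-1 : R)%:C%C *: ((rot t x - y) + (rot (t + dyadic (n + m).+1) x - y)).
  rewrite addrACA [RHS]scalerDr; congr (_ + _); rewrite -opprD scalerN; congr (- _).
  rewrite -[y in RHS]scale1r -scalerDl scalerA.
  by rewrite -(rmorphD _ 1 1) -rmorphM /= mulVf ?pnatr_eq0// scale1r.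
rewrite cnormZr ger0_norm ?invr_ge0// ler_pdivrMl// mulrC mulr_natr mulr2n.
have d0 := ltW (dyadic_gt0 (n + m).+1).
rewrite addnS in ts.
rewrite (le_trans (cnormD_le _ _))// lerD// IH ?addr_ge0//.
  by rewrite (le_trans ts)// [leRHS]dyadicS lerDl.
by rewrite [leRHS]dyadicS lerD2r.
Qed.

Lemma averages_cvg b : exists l, tends (averages^~ b) l.
Proof.
apply: cstar_complete => e e0; have e3 : 0 < e / 3 by rewrite divr_gt0.
have [d d0 dP] := rot_near0 b e3.
have [N NP] := cvgn_within dyadic_cvg0 d0.
have {}NP t : 0 <= t -> t <= dyadic N -> cnorm (rot t b - b) <= e / 3.
  move=> t0 tN; apply: dP => //; apply: le_trans tN _.
  by have /andP[_] := NP N (leqnn _); rewrite add0r.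
exists N => m n Nm Nn; rewrite -(subrKA (averages N b)).
rewrite (le_lt_trans (cnormD_le _ _))// (@le_lt_trans _ _ (e / 3 + e / 3))//;
  last by lra.
apply: lerD; first by rewrite -(subnKC Nm) averages_diff.
by rewrite cnormBC -(subnKC Nn) averages_diff.
Qed.

(** The k-th Fourier coefficient of b. The KMS argument rests on its being linear, contractive, the
    identity on A^k and invariant under dyadic rotations. *)
Definition spectral_proj b : A := projT1 (cid (averages_cvg b)).

Lemma spectral_projP b : tends (averages^~ b) (spectral_proj b).
Proof. exact: projT2 (cid (averages_cvg b)). Qed.

Lemma spectral_proj_linear : linear spectral_proj.
Proof.
move=> c a b; apply: (tends_unique (spectral_projP _)).
under eq_fun do rewrite averages_linear.
by apply: tendsD; [apply: tendsZ|]; exact: spectral_projP.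
Qed.

Lemma spectral_projB a b : spectral_proj (a - b) = spectral_proj a -
  spectral_proj b.
Proof. by rewrite addrC -scaleN1r spectral_proj_linear scaleN1r addrC. Qed.

Lemma spectral_proj0 : spectral_proj 0 = 0.
Proof. by have := spectral_projB 0 0; rewrite !subrr. Qed.

Lemma spectral_projZ c a : spectral_proj (c *: a) = c *: spectral_proj a.
Proof. by rewrite -[c *: a]addr0 spectral_proj_linear spectral_proj0 addr0. Qed.

Lemma spectral_proj_contractive b : cnorm (spectral_proj b) <= cnorm b.
Proof. by apply: tends_norm_le (spectral_projP b) => n;
  exact: averages_contractive. Qed.

Lemma spectral_proj_id a : spectral_subspace g k a -> spectral_proj a = a.
Proof.
move=> ka; apply: (tends_unique (spectral_projP _)).
by under eq_fun do rewrite averages_spectral//; exact: tends_cst.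
Qed.

Lemma spectral_proj_rot r b : spectral_proj (rot (dyadic r) b) = spectral_proj b.
Proof.
apply: (@tends_unique _ _ (fun n => averages (n + r) b)).
  have := tends_shift r (spectral_projP (rot (dyadic r) b)).
  by under eq_fun do rewrite -rot_averages averages_fixed ?leq_addl//.
exact: tends_shift (spectral_projP b).
Qed.

Lemma tends_spectral_proj u l : tends u l ->
  tends (fun n => spectral_proj (u n)) (spectral_proj l).
Proof.
by move=> ul; apply: tends_le ul => n;
  rewrite -spectral_projB spectral_proj_contractive.
Qed.

Lemma spectral_proj_sum (I : Type) (r : seq I) (F : I -> A) :
  spectral_proj (\sum_(i <- r) F i) = \sum_(i <- r) spectral_proj (F i).
Proof.
apply: (big_morph spectral_proj) => [a b|]; last exact: spectral_proj0.
by rewrite -{1}[a]scale1r spectral_proj_linear scale1r.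
Qed.

End spectral_projection.

Section kms_spectral.
Context (R : realType) (A : cstarAlgType R) (g : circle_action A).

Lemma entire_coeff_bounded (c : nat -> A) l :
  tends (fun n => \sum_(0 <= j < n) (1 : R[i]) ^+ j *: c j) l ->
  exists M : R, forall n, cnorm (c n) <= M.
Proof.
move=> /pseries_terms_bounded[M MP]; exists M => n.
by have := MP n; rewrite expr1n scale1r.
Qed.

(** Convergence at z = 1 bounds the coefficients. Agreement is asked at the angles [dyadic R r]
    because there [spectral_proj] is known to be invariant. *)
Lemma entire_unique (c c' : nat -> A) l l' (f : nat -> A) :
  tends (fun n => \sum_(0 <= j < n) (1 : R[i]) ^+ j *: c j) l ->
  tends (fun n => \sum_(0 <= j < n) (1 : R[i]) ^+ j *: c' j) l' ->
  (forall r, tends (fun n => \sum_(0 <= j < n) (dyadic R r ^+ j)%:C%C *: c j) (f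
    r)) ->
  (forall r, tends (fun n => \sum_(0 <= j < n) (dyadic R r ^+ j)%:C%C *: c' j) (f
    r)) ->
  forall n, c n = c' n.
Proof.
move=> /entire_coeff_bounded[M MP] /entire_coeff_bounded[M' MP'] cf cf' n.
apply/eqP; rewrite -subr_eq0; apply/eqP.
apply: (@pseries_eq0 _ _ (fun j => c j - c' j) (M + M') (dyadic R)) => [j|r||r].
- by rewrite (le_trans (cnormB_le _ _))// lerD.
- exact: dyadic_gt0.
- exact: dyadic_cvg0.
have := tendsB (cf r) (cf' r); rewrite subrr.
by under eq_fun do (rewrite -sumrB; under eq_bigr do rewrite -scalerBr).
Qed.

Context (beta : R) (omega : A -> R[i]^o).
Hypothesis kms : is_KMS g beta omega.

Let omega_state : is_state omega. Proof. by case: kms. Qed.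

Let omega_linear : linear omega. Proof. by case: omega_state. Qed.

Let omega_bound a : modulus (omega a) <= cnorm a.
Proof.
have [tl tp t1] := omega_state.
by have := @positive_functional_bound _ _ omega (conj tl tp) a; rewrite t1 mul1r.
Qed.

Let omegaB a b : omega (a - b) = omega a - omega b.
Proof. by rewrite addrC -scaleN1r omega_linear scaleN1r addrC. Qed.

Let omega0 : omega 0 = 0.
Proof. by have := omegaB 0 0; rewrite !subrr. Qed.

Let omegaZ c a : omega (c *: a) = c * omega a.
Proof. by rewrite -[c *: a]addr0 omega_linear omega0 addr0. Qed.

Let omegaD a b : omega (a + b) = omega a + omega b.
Proof. by rewrite -{1}[a]scale1r omega_linear scale1r. Qed.

Let omega_lim0 (u : nat -> A) l : (forall n,
  omega (u n) = 0) -> tends u l -> omega l = 0.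
Proof.
move=> u0 /tendsP ul; apply: modulus0_eq0; apply/eqP;
  rewrite eq_le modulus_ge0 andbT.
apply/ler_addgt0Pr => e /ul[N /(_ N (leqnn _)) /ltW uN]; rewrite add0r.
by rewrite -modulusN -[- omega l]add0r -(u0 N) -omegaB (le_trans (omega_bound _)).
Qed.

(** For b in D with entire extension f, the function E(f z) equals e^(ikz) E b at the dyadic angles,
    hence has the same power series, and its value at i beta is e^(-k beta) E b. The KMS identity
    for the rotations of b, averaged, gives the one for E b; density of D then gives all of A^k. *)
Lemma KMS_spectral (k : int) (v a : A) : spectral_subspace g k v ->
  omega (v * a) = (expR (- (k%:~R * beta)))%:C%C * omega (a * v).
Proof.
move=> kv; have [_ [D [[_ _ _ _] Dd Dg DP]]] := kms.
pose E := spectral_proj g k; pose lam : R[i] := (expR (- (k%:~R * beta)))%:C%C.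
suff H b c : D b -> D c -> omega (E b * c - lam *: (c * E b)) = 0.
  have [b [Db bv]] := dense_tends Dd v; have [c [Dc ca]] := dense_tends Dd a.
  apply/eqP; rewrite -subr_eq0 -omegaZ -omegaB; apply/eqP.
  apply: (@omega_lim0 (fun n => E (b n) * c n - lam *: (c n * E (b n)))).
    by move=> n; exact: H.
  have Ebv : tends (fun n => E (b n)) v.
    by rewrite -{1}(spectral_proj_id kv); exact: tends_spectral_proj.
  by apply: tendsB; [exact: tendsM|apply: tendsZ; exact: tendsM].
move=> Db Dc.
have [f [[[cf cfP] fE] fK]] := DP b Db.
have {}cfP z : tends (fun n => \sum_(0 <= j < n) z ^+ j *: cf j) (f z).
  by apply/normed_cvgP; exact: cfP.
pose ib : R[i] := (0 +i* beta)%C.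
have powC (t : R) n : (t ^+ n)%:C%C = (t%:C%C : R[i]) ^+ n by rewrite rmorphXn.
(* The rotated element is again in D; by uniqueness of power series its extension is the rotation of
   f. *)
have gK s : omega (c * g (expi s) (f ib)) = omega (g (expi s) b * c).
  have [f' [[[cf' cfP'] fE'] fK']] := DP _ (Dg _ (norm_expi s) _ Db).
  have {}cfP' z : tends (fun n => \sum_(0 <= j < n) z ^+ j *: cf' j) (f' z).
    by apply/normed_cvgP; exact: cfP'.
  have gcf z : tends (fun n => \sum_(0 <= j < n) z ^+ j *: g (expi s) (cf j)) (g
    (expi s) (f z)).
    have := tends_act g (norm_expi s) (cfP z).
    by under eq_fun do (rewrite act_sum ?norm_expi//;
      under eq_bigr do rewrite actZ ?norm_expi//).
  have cE : forall n, cf' n = g (expi s) (cf n).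
    apply: (@entire_unique _ _ (f' 1) (g (expi s) (f 1)) (fun r =>
      f' (dyadic R r)%:C%C)) => //.
      by move=> r; under eq_fun do under eq_bigr do rewrite powC; exact: cfP'.
    move=> r; under eq_fun do under eq_bigr do rewrite powC.
    rewrite fE' -act_comp ?norm_expi// mulrC act_comp ?norm_expi// -fE.
    exact: gcf.
  rewrite -fK' //; congr (omega (c * _)).
  apply: (tends_unique (gcf ib)); have := cfP' ib.
  by under eq_fun do under eq_bigr do rewrite cE.
(* The additional rotation t is what lets the induction pass through the two terms of an average. *)
have rotK n t : omega (c * rot g k t (averages g k n (f ib))) =
    omega (rot g k t (averages g k n b) * c).
  elim: n t => [|n IH] t /=.
    by rewrite /rot -scalerAr -scalerAl !omegaZ gK.
  rewrite /average !rotZ !rotD -!rot_add -scalerAr -scalerAl !omegaZ.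
  by rewrite mulrDr mulrDl !omegaD !IH.
have EK : omega (c * E (f ib)) = omega (E b * c).
  apply/eqP; rewrite -subr_eq0 -omegaB; apply/eqP.
  apply: (@omega_lim0 (fun n => c * averages g k n (f ib) - averages g k n b * c)).
    by move=> n; rewrite omegaB; have := rotK n 0; rewrite !rot0 => ->;
      rewrite subrr.
  apply: tendsB; apply: tendsM; try exact: tends_cst; exact: spectral_projP.
have Ecf z : tends (fun n => \sum_(0 <= j < n) z ^+ j *: E (cf j)) (E (f z)).
  have := tends_spectral_proj g k (cfP z).
  by under eq_fun do (rewrite spectral_proj_sum;
    under eq_bigr do rewrite spectral_projZ).
have ecf (t : R) : tends (fun n => \sum_(0 <= j < n) (t ^+ j)%:C%C *: (expi_coeff
  k%:~R j *: E b))
    (expi (k%:~R * t) *: E b).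
  have := tends_scale (E b) (expi_series k%:~R t).
  by under eq_fun do (rewrite scaler_suml; under eq_bigr do rewrite -scalerA).
have cE : forall n, E (cf n) = expi_coeff k%:~R n *: E b.
  apply: (@entire_unique _ _ (E (f 1)) (expi (k%:~R * 1) *: E b)
    (fun r => E (f (dyadic R r)%:C%C))) => //.
  - have := ecf 1; under eq_fun do under eq_bigr do rewrite expr1n.
    by under [X in _ -> tends X _]eq_fun do under eq_bigr do rewrite expr1n.
  - by move=> r; under eq_fun do under eq_bigr do rewrite powC; exact: Ecf.
  - move=> r; rewrite fE (act_rot g k) /E spectral_projZ spectral_proj_rot.
    exact: ecf.
have -> : lam *: (c * E b) = c * E (f ib).
  rewrite scalerAr; congr (_ * _); apply: (tends_unique _ (Ecf ib)).
  have := tends_scale (E b) (expR_series k%:~R beta).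
  by under eq_fun do (rewrite scaler_suml; under eq_bigr do rewrite -scalerA -cE).
by rewrite omegaB EK subrr.
Qed.

End kms_spectral.

(** * The theorem *)

Section spectrum_inverse.
Context (R : realType) (B : preCStarAlgType R).
Notation V := (trace_space B).

(** For D = T^-1 one has (T - l)^-1 = - l^-1 (D - l^-1)^-1 D, and at l = 0 the inverse is D
    itself. *)
Lemma spectrum_inverse (T D : V -> V) : linear T -> linear D ->
  (exists M : R, forall f, trace_norm (D f) <= M * trace_norm f) ->
  cancel T D -> cancel D T ->
  forall l, spectrum T l -> l != 0 /\ spectrum D l^-1.
Proof.
move=> Tl Dl [M DM] TK DK l Tsp.
have l0 : l != 0.
  apply/eqP => l0; move: Tsp; apply/spectrumPn; exists D; split=> //.
  - by exists M.
  - by move=> f; rewrite l0 scale0r subr0.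
  - by move=> f; rewrite l0 scale0r subr0.
split=> //; apply: contrapT => /spectrumPn[S [Sl [N SN] DS SD]].
move: Tsp; apply/spectrumPn; exists (fun f => - l^-1 *: S (D f)).
have TZ c f : T (c *: f) = c *: T f.
  have T0 : T 0 = 0 by have := Tl (-1) 0 0; rewrite scaler0 addr0 scaleN1r addNr.
  by rewrite -[c *: f]addr0 Tl T0 addr0.
have SZ c f : S (c *: f) = c *: S f.
  have S0 : S 0 = 0 by have := Sl (-1) 0 0; rewrite scaler0 addr0 scaleN1r addNr.
  by rewrite -[c *: f]addr0 Sl S0 addr0.
have TB f1 f2 : T (f1 - f2) = T f1 - T f2 by rewrite addrC -scaleN1r Tl scaleN1r
  addrC.
split.
- move=> c f1 f2; rewrite Dl Sl scalerDr !scalerA.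
  by rewrite [c * _]mulrC.
- exists (modulus (- l^-1) * (`|N| * M)) => f; rewrite trace_normZ -mulrA.
  rewrite ler_wpM2l ?modulus_ge0// (le_trans (SN _))//.
  rewrite (le_trans (ler_wpM2r (trace_norm_ge0 _) (ler_norm N)))// -mulrA.
  by rewrite ler_wpM2l.
- move=> f; rewrite -{3}(DS f) -SZ; congr (S _).
  rewrite addrC -scaleNr Dl TK scalerDr scalerA mulrNN mulVf// scale1r.
  by rewrite scaleNr.
- move=> f; have := congr1 T (SD (D f)); rewrite TB !DK TZ => {3}<-.
  rewrite TZ scalerA mulrN mulfV// scaleN1r opprK scaleNr addrC.
  by [].
Qed.

End spectrum_inverse.

Section dual_trace_inverse.
Context (R : realType) (A : cstarAlgType R) (g : circle_action A).

(** The products e = v_j u_i have degree k + l = 0, so a trace on A^0 has the same value at e a e^*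
    and at a e^* e; the latter sum to a. *)
Lemma dual_traceK (p q : nat) (u : 'I_p -> A) (v : 'I_q -> A) (k l : int)
  (uk : forall i, spectral_subspace g k (u i)) (uu :
    \sum_(i < p) star (u i) * u i = 1)
  (vl : forall j, spectral_subspace g l (v j)) (vv :
    \sum_(j < q) star (v j) * v j = 1) :
  k + l = 0 -> cancel (dual_trace vl vv) (dual_trace uk uu).
Proof.
move=> kl f; apply: traceP => a; rewrite !dual_traceE.
have vu i j : spectral_subspace g 0 (v j * u i).
  by have := spectralM (vl j) (uk i); rewrite addrC kl.
pose e i j := to_fixed g (v j * u i).
have eE i j : e i j = v j * u i :> A by rewrite to_fixedK.
have -> : sandwich v (sandwich u a) = \sum_(i < p) \sum_(j < q) e i j * (a * star
  (e i j)).
  apply: val_inj; rewrite /= (sandwichE vl) (sandwichE uk) val_sum.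
  under [RHS]eq_bigr do rewrite val_sum.
  rewrite [RHS]exchange_big; apply: eq_bigr => j _ /=; rewrite mulr_sumr mulr_suml.
  by apply: eq_bigr => i _; rewrite eE starM !mulrA.
have {2}-> : a = \sum_(i < p) \sum_(j < q) (a * star (e i j)) * e i j.
  apply: val_inj; rewrite /= val_sum -[LHS]mulr1 -uu mulr_sumr.
  apply: eq_bigr => i _; rewrite val_sum -[X in _ = X]/(\sum_(j < q) fixed_val
    ((a * star (e i j)) * e i j)).
  rewrite -[X in _ * (X * _)]mulr1 -vv mulr_sumr mulr_suml mulr_sumr.
  by apply: eq_bigr => j _ /=; rewrite eE starM !mulrA.
rewrite !trace_sum; apply: eq_bigr => i _; rewrite !trace_sum.
by apply: eq_bigr => j _; exact: trace_tracial.
Qed.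

End dual_trace_inverse.

Section families.
Context (R : realType) (A : cstarAlgType R) (g : circle_action A).
Context (tau : fixed_algebra g -> R[i]^o).
Hypothesis tau_linear : linear tau.
Hypothesis tau_tracial : is_tracial tau.

Let tauD a b : tau (a + b) = tau a + tau b.
Proof. by rewrite -{1}[a]scale1r tau_linear scale1r. Qed.

Let tau0 : tau 0 = 0.
Proof. by apply: (addrI (tau 0)); rewrite -tauD !addr0. Qed.

Let tau_sum (I : Type) (r : seq I) (F : I -> fixed_algebra g) :
  tau (\sum_(i <- r) F i) = \sum_(i <- r) tau (F i).
Proof. exact: (big_morph _ tauD tau0). Qed.

(** Put e = z_i w_j^* , an element of A^0. Inserting each family's relation into the other's sum
    gives the sums of e e^* and of e^* e, on which a trace agrees. *)
Lemma family_independent (I J : finType) (k : int) (z : I -> A) (w : J -> A) :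
  (forall i, spectral_subspace g k (z i)) -> (forall j,
    spectral_subspace g k (w j)) ->
  \sum_i star (z i) * z i = 1 -> \sum_j star (w j) * w j = 1 ->
  tau (to_fixed g (\sum_i z i * star (z i))) = tau (to_fixed g (\sum_j w j * star
    (w j))).
Proof.
move=> kz kw zz ww.
have zw i j : spectral_subspace g 0 (z i * star (w j)).
  by have := spectralM (kz i) (spectral_star (kw j)); rewrite subrr.
have sp a : spectral_subspace g k a -> spectral_subspace g 0 (a * star a).
  by move=> ka; have := spectralM ka (spectral_star ka); rewrite subrr.
pose e i j := to_fixed g (z i * star (w j)).
have eE i j : e i j = z i * star (w j) :> A by rewrite to_fixedK.
have -> : to_fixed g (\sum_i z i * star (z i)) = \sum_i \sum_j e i j * star (e i j).
  apply: val_inj; rewrite /= to_fixedK ?val_sum;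
    last by apply: spectral_sum => i; exact: sp.
  apply: eq_bigr => i _; rewrite val_sum -[X in X * _]mulr1 -ww mulr_sumr mulr_suml.
  by apply: eq_bigr => j _ /=; rewrite eE !starM starK !mulrA.
have -> : to_fixed g (\sum_j w j * star (w j)) = \sum_j \sum_i star (e i j) * e i j.
  apply: val_inj; rewrite /= to_fixedK ?val_sum;
    last by apply: spectral_sum => j; exact: sp.
  apply: eq_bigr => j _; rewrite val_sum -[X in X * _]mulr1 -zz mulr_sumr mulr_suml.
  by apply: eq_bigr => i _ /=; rewrite eE !starM starK !mulrA.
rewrite [in RHS]exchange_big !tau_sum; apply: eq_bigr => i _; rewrite !tau_sum.
by apply: eq_bigr => j _; exact: tau_tracial.
Qed.

End families.

Section language.
Context (R : realType) (A : cstarAlgType R) (p : nat) (u : 'I_p -> A).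
Hypothesis uu : \sum_(i < p) star (u i) * u i = 1.
Hypothesis A1 : (1 : A) != 0.

(** Read backwards, so that appending a letter multiplies on the left: if all u_i v vanish, then v =
    sum_i u_i^* u_i v = 0. Hence every word of the language extends. *)
Definition nonzero_word (s : seq 'I_p) : bool := prodw u (rev s) != 0.

Lemma subshift'E : subshift' u = language_shift nonzero_word.
Proof.
apply/seteqP; split=> l lP r; have := lP r; rewrite /nonzero_word;
suff -> : \prod_(i < r) u (l (rev_ord i)) = prodw u (rev (mkseq l r)) by [].
all: elim: r => [|r IH] in {lP} *; first by rewrite big_ord0 /prodw big_nil.
all: rewrite /mkseq -addn1 iotaD map_cat rev_cat /= prodw_cons add0n -/(mkseq l
  r) -IH.
all: rewrite addn1 big_ord_recl /= subn1; congr (_ * _); apply: eq_bigr => i _.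
all: by congr (u (l _)); rewrite /= /bump /= add1n subSS.
Qed.

Lemma card_wordsL n : #|{: wordsL nonzero_word n}|%:R = nonzero_words u n.
Proof.
rewrite card_sig /nonzero_words -(sum_tuple_rev n (fun s => (prodw u s != 0)%:R)).
by rewrite -natr_sum -sum1_card big_mkcond.
Qed.

Lemma subshift'_entropy : topological_entropy R (subshift' u) (@left_shift p) =
  (entropy u)%:E.
Proof.
rewrite subshift'E; apply: language_topological_entropy.
- by rewrite /nonzero_word /prodw big_nil.
- move=> s t; rewrite /nonzero_word rev_cat prodw_cat.
  by apply: contra_neq => ->; rewrite mulr0.
- move=> s t; rewrite /nonzero_word rev_cat prodw_cat.
  by apply: contra_neq => ->; rewrite mul0r.
- move=> s; rewrite /nonzero_word => s0; apply: contrapT => H.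
  move: s0; rewrite -[prodw _ _]mul1r -uu mulr_suml big1 ?eqxx// => i _.
  rewrite -mulrA -prodw_cons -rev_rcons.
  have [->|i0] := eqVneq (prodw u (rev (rcons s i))) 0; first by rewrite mulr0.
  by exfalso; apply: H; exists i.
- under eq_fun do rewrite card_wordsL; exact: entropy_cvg.
- by move=> m n; rewrite -(ler_nat R) natrM !card_wordsL nonzero_words_submul.
Qed.

End language.

Section generic.
Context (R : realType) (A : cstarAlgType R) (g : circle_action A).
Context (p : nat) (u : 'I_p -> A) (k : int).
Hypothesis uk : forall i, spectral_subspace g k (u i).
Hypothesis uu : \sum_(i < p) star (u i) * u i = 1.
Context (tau : fixed_algebra g -> R[i]^o).
Hypothesis tau_state : is_state tau.
Hypothesis tau_tracial : is_tracial tau.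

Lemma state_one_neq0 : (1 : A) != 0.
Proof.
apply/eqP => A1; have [tl _ t1] := tau_state.
have B1 : (1 : fixed_algebra g) = 0 by apply: val_inj.
have t0 : tau 0 = 0 by have := tl (-1) 0 0; rewrite scaler0 addr0 scaleN1r addNr.
by have := t1; rewrite B1 t0 => /esym/eqP; rewrite oner_eq0.
Qed.

Let A1 := state_one_neq0.

Fact state_traceP : tau \in @bounded_traces R (fixed_algebra g).
Proof.
rewrite unfold_in; apply/asboolP; split=> //; first by have [] := tau_state.
by exists 1 => a; rewrite mul1r; exact: state_bound.
Qed.

Definition state_trace : trace_space (fixed_algebra g) := TraceFunctional
  state_traceP.

Lemma state_trace_words n :
  complex.Re (state_trace (iter n (sandwich u) 1)) = trace_words u tau n.
Proof.
congr (complex.Re (tau _)); apply: val_inj; rewrite /= (iter_sandwich uk) to_fixedK.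
  by apply: eq_bigr => w _; rewrite mulr1.
by apply: spectral_sum => w; exact: prodw_fixed uk _.
Qed.

Lemma KMS_trace_words omega beta n : is_KMS g beta omega ->
  (forall a : fixed_algebra g, omega (a : A) = tau a) ->
  trace_words u tau n = expR (n%:R * - (k%:~R * beta)).
Proof.
move=> kms ot; have [[ol _ o1] _] := kms.
have oD a b : omega (a + b) = omega a + omega b.
  by rewrite -{1}[a]scale1r ol scale1r.
have o0 : omega 0 = 0 by apply: (addrI (omega 0)); rewrite -oD !addr0.
rewrite /trace_words -ot to_fixedK; last first.
  by apply: spectral_sum => w; exact: prodw_fixed uk _.
rewrite (big_morph _ oD o0).
have E (w : n.-tuple 'I_p) : omega (prodw u w * star (prodw u w)) =
    (expR (n%:R * - (k%:~R * beta)))%:C%C * omega (star (prodw u w) * prodw u w).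
  rewrite (KMS_spectral kms _ (prodw_spectral uk w)) size_tuple.
  by congr ((expR _)%:C%C * _); rewrite rmorphMn /= -mulr_natl; ring.
under eq_bigr do rewrite E.
by rewrite -mulr_sumr -(big_morph _ oD o0) (prodw_sum1 uu) o1 mulr1.
Qed.

Hypothesis mu1 : limn_esup (fun n : nat => (mu u tau n `^ n%:R^-1)%:E) = 1%E.

Let growth r : expR (entropy u) < r ->
  exists2 C : R, 0 < C & forall n, norm_words u n <= C * r ^+ n.
Proof. exact: (norm_words_bound uk uu A1 tau_state mu1). Qed.

Lemma dual_trace_spectral_max :
  spectrum (dual_trace uk uu) (expR (entropy u))%:C%C /\
  forall l, spectrum (dual_trace uk uu) l -> modulus l <= expR (entropy u).
Proof.
split; last first.
  move=> l; apply: contraPT; rewrite -ltNge => hl.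
  exact: (dual_trace_resolvent (expR_gt0 _) growth hl).
apply: (dual_trace_spectral_radius (expR_gt0 _) growth (f0 := state_trace)).
  by have [] := tau_state.
move=> z z0 zh [C CP].
(* With e half the gap, a bound C z^n would force exp(n e) <= C for infinitely many n, against exp(n
   e) > n e > C for large n. *)
have e0 : 0 < (entropy u - ln z) / 2.
  by rewrite divr_gt0// subr_gt0 -[entropy u]expRK ltr_ln ?posrE ?expR_gt0.
set e := (entropy u - ln z) / 2 in e0.
have [n] := trace_words_often uk uu A1 tau_state mu1 e0 (Num.truncn (C / e)).+1.
move=> Cn [n0 nP].
have nR : 0 < n%:R :> R by rewrite ltr0n.
have Cne : C < n%:R * e.
  by rewrite -ltr_pdivrMr// (lt_le_trans (truncnS_gt _))// ler_nat.
have := CP n; rewrite state_trace_words => /(le_trans nP).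
have -> : n%:R * (entropy u - e) = n%:R * e + n%:R * ln z.
  by rewrite -mulrDr /e; congr (_ * _); field.
have -> : z ^+ n = expR (n%:R * ln z) by rewrite expRM_natl lnK.
rewrite expRD ler_pM2r ?expR_gt0// leNgt => /negP; apply.
by rewrite (lt_le_trans Cne)// (le_trans _ (expR_ge1Dx _))// lerDr.
Qed.

Lemma h_T_entropy : h_T u = entropy u.
Proof.
apply: cvg_lim => //.
have := norm_words_cvg uk uu A1 tau_state mu1.
suff -> : (fun n : nat => n%:R^-1 * ln (norm_words u n)) =
  (fun n : nat => n%:R^-1 * ln (\sum_(w :
    n.-tuple 'I_p) cnorm (word u w * star (word u w)))) by [].
apply/funext => n; congr (_ * ln _); apply: eq_bigr => w _.
by rewrite wordE cnorm_mul_star.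
Qed.

Lemma KMS_entropy omega beta : is_KMS g beta omega ->
  (forall a : fixed_algebra g, omega (a : A) = tau a) ->
  entropy u = - (k%:~R * beta).
Proof.
move=> kms ot; have := trace_words_limsup uk uu A1 tau_state mu1.
suff -> : limn_esup (fun n : nat => (n%:R^-1 * ln (trace_words u tau n))%:E) =
    (- (k%:~R * beta))%:E by move=> [].
have E n : (0 < n)%N -> n%:R^-1 * ln (trace_words u tau n) = - (k%:~R * beta).
  move=> n0; rewrite (KMS_trace_words _ kms ot) expRK mulrA mulVf ?mul1r//.
  by rewrite pnatr_eq0 -lt0n.
apply: limn_esup_eq => e e0.
  by exists 1%N => n n0; rewrite E// lerDl ltW.
by move=> N; exists N.+1 => //; rewrite E// gerBl ltW.
Qed.

End generic.

Lemma words_family (R : realType) (A : cstarAlgType R) (g : circle_action A)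
    (p : nat) (u : 'I_p -> A) (tau : fixed_algebra g -> R[i]^o) (k : int)
    (uk : forall i, spectral_subspace g k (u i))
    (uu : \sum_(i < p) star (u i) * u i = 1)
    (tau_state : is_state tau) (tau_tracial : is_tracial tau) (n m : nat)
    (z : 'I_m -> A) : (forall i, spectral_subspace g (k *+ n) (z i)) ->
  \sum_(i < m) star (z i) * z i = 1 ->
  complex.Re (tau (to_fixed g (\sum_(i < m) z i * star (z i)))) = trace_words u
    tau n.
Proof.
move=> kz zz; have [tl _ _] := tau_state; congr complex.Re.
apply: (family_independent tl tau_tracial kz _ zz (prodw_sum1 uu n)) => w.
by have := prodw_spectral uk w; rewrite size_tuple.
Qed.

Lemma words_family_ex (R : realType) (A : cstarAlgType R) (g : circle_action A)
    (p : nat) (u : 'I_p -> A) (k : int)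
    (uk : forall i, spectral_subspace g k (u i))
    (uu : \sum_(i < p) star (u i) * u i = 1) (n : nat) :
  exists (m : nat) (z : 'I_m -> A),
    (forall i, spectral_subspace g (k *+ n) (z i)) /\
    \sum_(i < m) star (z i) * z i = 1.
Proof.
exists #|{: n.-tuple 'I_p}|, (fun i => prodw u (enum_val i : n.-tuple 'I_p)); split.
  by move=> i; have := prodw_spectral uk (enum_val i : n.-tuple 'I_p);
    rewrite size_tuple.
rewrite -[RHS](prodw_sum1 uu n).
rewrite -(big_enum_val (A := {: n.-tuple 'I_p}) (fun w : n.-tuple 'I_p =>
  star (prodw u w) * prodw u w)).
exact: eq_bigl.
Qed.

(** [get] returns a value attained by some family. The words of length n are such a family, and all
    families give the same value. *)
Lemma deltaE (R : realType) (A : cstarAlgType R) (g : circle_action A)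
    (p : nat) (y : 'I_p -> A) (tau : fixed_algebra g -> R[i]^o)
    (y1 : forall i, spectral_subspace g 1 (y i))
    (yy : \sum_(i < p) star (y i) * y i = 1)
    (tau_state : is_state tau) (tau_tracial : is_tracial tau) n :
  delta tau n = trace_words y tau n.
Proof.
have E m (z : 'I_m -> A) : (forall i, spectral_subspace g n (z i)) ->
    \sum_(i < m) star (z i) * z i = 1 ->
    complex.Re (tau (to_fixed g (\sum_(i < m) z i * star (z i)))) = trace_words y
      tau n.
  by move=> zn zz; apply: (words_family y1 yy) => // i; rewrite natz.
have [m [z [zn zz]]] := words_family_ex y1 yy n.
rewrite natz in zn.
have [m' [z' [zn' zz' ->]]] : exists (m : nat) (z : 'I_m -> A),
    [/\ forall i, spectral_subspace g n (z i), \sum_(i < m) star (z i) * z i = 1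
      & delta tau n = complex.Re (tau (to_fixed g (\sum_(i < m) z i * star (z
        i))))].
  apply: (@getI _ (fun d => exists (m : nat) (z : 'I_m -> A),
    [/\ forall i, spectral_subspace g n (z i), \sum_(i < m) star (z i) * z i = 1
      & d = complex.Re (tau (to_fixed g (\sum_(i < m) z i * star (z i))))]) _ _);
    exact: (ex_intro _ m (ex_intro _ z (And3 zn zz erefl))).
exact: E.
Qed.

Lemma epsilonE (R : realType) (A : cstarAlgType R) (g : circle_action A)
    (q : nat) (x : 'I_q -> A) (tau : fixed_algebra g -> R[i]^o)
    (x1 : forall i, spectral_subspace g (- 1) (star (x i)))
    (xx : \sum_(i < q) star (star (x i)) * star (x i) = 1)
    (tau_state : is_state tau) (tau_tracial : is_tracial tau) n :
  epsilon tau n = trace_words (fun i => star (x i)) tau n.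
Proof.
have E m (w : 'I_m -> A) : (forall i, spectral_subspace g n (w i)) ->
    \sum_(i < m) w i * star (w i) = 1 ->
    complex.Re (tau (to_fixed g (\sum_(i < m) star (w i) * w i))) =
    trace_words (fun i => star (x i)) tau n.
  move=> wn ww; rewrite -(words_family x1 xx tau_state tau_tracial (z := fun i =>
    star (w i))).
  - by congr (complex.Re (tau (to_fixed g _))); apply: eq_bigr => i _;
    rewrite starK.
  - by move=> i; rewrite mulNrn natz; exact: spectral_star.
  - by rewrite -[RHS]ww; apply: eq_bigr => i _; rewrite starK.
have [m [z [zn zz]]] := words_family_ex x1 xx n.
have wn i : spectral_subspace g n (star (z i)).
  by have := spectral_star (zn i); rewrite mulNrn opprK natz.
have ww : \sum_(i < m) star (z i) * star (star (z i)) = 1.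
  by rewrite -[RHS]zz; apply: eq_bigr => i _; rewrite starK.
have [m' [w' [wn' ww' ->]]] : exists (m : nat) (w : 'I_m -> A),
    [/\ forall i, spectral_subspace g n (w i), \sum_(i < m) w i * star (w i) = 1
      & epsilon tau n = complex.Re (tau (to_fixed g (\sum_(i < m) star (w i) * w
        i)))].
  apply: (@getI _ (fun d => exists (m : nat) (w : 'I_m -> A),
    [/\ forall i, spectral_subspace g n (w i), \sum_(i < m) w i * star (w i) = 1
      & d = complex.Re (tau (to_fixed g (\sum_(i < m) star (w i) * w i)))]) _ _);
    exact: (ex_intro _ m (ex_intro _ (fun i => star (z i)) (And3 wn ww erefl))).
exact: E.
Qed.

Section star_words.
Context (R : realType) (A : cstarAlgType R) (q : nat) (x : 'I_q -> A).
Notation xs := (fun i => star (x i)).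

(** Adjoints reverse words; this turns [h_S], [subshift] and [nu] of x into [h_T], [subshift'] and
    [mu] of the adjoint family. *)
Lemma prodw_star s : prodw xs (rev s) = star (prodw x s).
Proof.
elim: s => [|i s IH]; first by rewrite /prodw !big_nil star1.
by rewrite rev_cons -cats1 prodw_cat IH [in RHS]prodw_cons starM /prodw big_seq1.
Qed.

Lemma h_S_star : h_S x = h_T xs.
Proof.
rewrite /h_S /h_T; congr (limn _); apply/funext => n; congr (_ * ln _).
rewrite -[RHS](eq_bigr _ (fun w _ => congr1 (@cnorm _ A) (congr2 *%R (esym (wordE
  xs w)) (congr1 star (esym (wordE xs w)))))).
rewrite -(sum_tuple_rev n (fun s => cnorm (prodw xs s * star (prodw xs s)))).
by apply: eq_bigr => w _; rewrite prodw_star starK wordE.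
Qed.

Lemma prod_star (l : nat -> 'I_q) r :
  \prod_(i < r) star (x (l (rev_ord i))) = star (\prod_(i < r) x (l i)).
Proof.
elim: r => [|r IH]; first by rewrite !big_ord0 star1.
by rewrite big_ord_recl big_ord_recr starM -IH /= subn1; congr (_ * _).
Qed.

Lemma subshift_star : subshift x = subshift' xs.
Proof.
apply/seteqP; split=> l lP r; have := lP r; apply: contra_neq.
  by rewrite prod_star => /(congr1 star); rewrite starK star0.
by rewrite prod_star => ->; rewrite star0.
Qed.

Lemma nu_star (g : circle_action A) (tau : fixed_algebra g -> R[i]^o) n :
  nu x tau n = mu xs tau n.
Proof.
rewrite /nu /mu; congr minimum; apply/seteqP; split=> _ [w /= w0 <-].
  exists [tuple of rev w] => /=; rewrite !wordE /= in w0 *; rewrite prodw_star.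
    by apply: contra_neq w0 => /(congr1 star); rewrite starK star0.
  by rewrite starK.
exists [tuple of rev w] => /=; rewrite !wordE /= in w0 *.
  by apply: contra_neq w0 => /(congr1 star); rewrite -prodw_star revK star0.
by rewrite -[in RHS](revK w) prodw_star starK.
Qed.

End star_words.

Theorem theorem6p4 (R : realType) (A : cstarAlgType R) (g : circle_action A)
  (gfull : full g)
  (p : nat) (y : 'I_p -> A)
  (y1 : forall i, spectral_subspace g 1 (y i))
  (yy : \sum_(i < p) star (y i) * y i = 1)
  (q : nat) (x : 'I_q -> A)
  (x1 : forall j, spectral_subspace g 1 (x j))
  (xx : \sum_(j < q) x j * star (x j) = 1)
  (tau : fixed_algebra g -> R[i]^o)
  (tau_state : is_state tau) (tau_tracial : is_tracial tau) :
  (limn_esup (fun n : nat => (mu y tau n `^ n%:R^-1)%:E) = 1%E ->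
    [/\ beta_min x1 xx = - h_T y,
        (beta_min x1 xx)%:E
          = (- topological_entropy R (subshift' y) (@left_shift p))%E,
        (beta_min x1 xx)%:E
          = (- limn_esup (fun n : nat => (n%:R^-1 * ln (delta tau n))%:E))%E
      & forall (omega : A -> R[i]^o) (beta : R), is_KMS g beta omega ->
          (forall a : fixed_algebra g, omega (a : A) = tau a) ->
          beta = beta_min x1 xx]) /\
  (limn_esup (fun n : nat => (nu x tau n `^ n%:R^-1)%:E) = 1%E ->
    [/\ beta_max x1 xx = h_S x,
        (beta_max x1 xx)%:E
          = topological_entropy R (subshift x) (@left_shift q),
        (beta_max x1 xx)%:E
          = limn_esup (fun n : nat => (n%:R^-1 * ln (epsilon tau n))%:E)
      & forall (omega : A -> R[i]^o) (beta : R), is_KMS g beta omega ->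
          (forall a : fixed_algebra g, omega (a : A) = tau a) ->
          beta = beta_max x1 xx]).

Proof.
have u1 j : spectral_subspace g (- 1) (star (x j)) by exact: spectral_star.
have uu : \sum_(j < q) star (star (x j)) * star (x j) = 1.
  by rewrite -[RHS]xx; apply: eq_bigr => j _; rewrite starK.
have TE : dual_operator x1 xx = dual_trace u1 uu.
  apply/funext => f; apply: traceP => a; rewrite dual_traceE.
  congr (f _); apply: val_inj; rewrite /= (sandwichE u1).
  by apply: eq_bigr => j _; rewrite starK.
have bounded k' p' (u' : 'I_p' -> A) (uk' : forall i, spectral_subspace g k' (u' i))
    (uu' : \sum_(i < p') star (u' i) * u' i = 1) : exists M : R,
      forall f : trace_space (fixed_algebra g),
    trace_norm (dual_trace uk' uu' f) <= M * trace_norm f.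
  by exists (norm_words u' 1) => f; exact: (dual_trace_norm uk' uu' 1 f).
have yxK := dual_traceK y1 yy u1 uu (subrr 1).
have xyK := dual_traceK u1 uu y1 yy (addNr 1).
split=> lim1.
  have [sp spmax] := dual_trace_spectral_max y1 yy tau_state tau_tracial lim1.
  (* Inversion turns e^h, the largest modulus in the spectrum of the operator of y, into the least
     one for s'. *)
  have bE : beta_min x1 xx = - entropy y.
    rewrite /beta_min /r_min TE (_ : minimum _ = expR (- entropy y)) ?expRK//.
    apply: minimumP.
      exists ((expR (entropy y))%:C%C)^-1.
        by have [] := spectrum_inverse (dual_trace_linear y1 yy)
          (dual_trace_linear u1 uu) (bounded _ _ _ _ _) xyK yxK sp.
      by rewrite modulusV modulusR ger0_norm ?expR_ge0// expRN.
    move=> _ [l lsp <-].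
    have [l0 lV] := spectrum_inverse (dual_trace_linear u1 uu) (dual_trace_linear
      y1 yy) (bounded _ _ _ _ _) yxK xyK lsp.
    have := spmax _ lV; rewrite modulusV expRN => le1.
    by rewrite -[leRHS]invrK lef_pV2 ?posrE ?expR_gt0 ?invr_gt0 ?modulus_gt0.
  rewrite bE; split.
  - by rewrite (h_T_entropy y1 yy tau_state lim1).
  - by rewrite (subshift'_entropy yy (state_one_neq0 tau_state)).
  - under eq_fun do rewrite (deltaE y1 yy tau_state tau_tracial).
    by rewrite (trace_words_limsup y1 yy (state_one_neq0 tau_state) tau_state lim1).
  - move=> omega beta kms ot; rewrite (KMS_entropy y1 yy tau_state lim1 kms ot).
    by rewrite mul1r opprK.
have {}lim1 : limn_esup (fun n : nat => (mu (fun j =>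
  star (x j)) tau n `^ n%:R^-1)%:E) = 1%E.
  have -> : mu (fun j => star (x j)) tau = nu x tau.
    by apply/funext => n; rewrite nu_star.
  exact: lim1.
have [sp spmax] := dual_trace_spectral_max u1 uu tau_state tau_tracial lim1.
have bE : beta_max x1 xx = entropy (fun j => star (x j)).
  rewrite /beta_max /r_max TE (_ : maximum _ = expR (entropy (fun j =>
    star (x j)))) ?expRK//.
  apply: maximumP; last by move=> _ [l lsp <-]; exact: spmax.
  by exists (expR (entropy (fun j => star (x j))))%:C%C => //;
    rewrite modulusR ger0_norm// expR_ge0.
rewrite bE; split.
- by rewrite h_S_star (h_T_entropy u1 uu tau_state lim1).
- by rewrite subshift_star (subshift'_entropy uu (state_one_neq0 tau_state)).
- have -> : epsilon tau = trace_words (fun j => star (x j)) tau.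
    by apply/funext => n; exact: epsilonE.
  by rewrite (trace_words_limsup u1 uu (state_one_neq0 tau_state) tau_state lim1).
- move=> omega beta kms ot; rewrite (KMS_entropy u1 uu tau_state lim1 kms ot).
  by rewrite mulrN1z mulN1r opprK.
Qed.
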